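(* In the polarized setting described in the context, let $\xi\in\Xi_{m/n}\cap F^{\sigma}$. For fixed $m,n$, the isomorphism type of the directed graph $Q_\xi$ together with its involution $(-)^\diamondsuit$ depends only on $(k,\sigma|_k,\beta,\mathrm{Nm}_{F/k}(c),\mathrm{Nm}_{F/k}(\xi))$. Moreover $H=\prod_{\alpha\in\underline{\Pi}}H^\alpha$, $\mathfrak g(\xi)=\bigoplus_{\alpha\in\underline\Pi}\mathfrak g(\xi)^\alpha$, and for each $\alpha\in\underline\Pi$ the pair $(H^\alpha,\mathfrak g(\xi)^\alpha)$ (an algebraic group over $k^\sigma$ and a representation of it) is described as follows according to the shape of $Q_\xi^\alpha$ (vertices labelled as in the context). (1) If $Q_\xi^\alpha$ is of shape (CC-$\ell$), then $$H^\alpha\cong\prod_{i=1}^{\ell}\mathbf{GL}_{D_i/k^\sigma}(M_i),\qquad \mathfrak g(\xi)^\alpha\cong\bigoplus_{i=1}^{\ell}\mathrm{Hom}_{D_i}(M_i,M_{i+1}),$$ where $M_{\ell+1}=M_1$ and $M_{i+1}$ is viewed as a $D_i$-module via $\eta_e^\flat:D_i\cong D_{i+1}$ ($e$ the arrow $i\to i+1$). The factors $\mathbf{GL}_{D_i/k^\sigma}(M_i)$ and $\mathbf{GL}_{D_{i+1}/k^\sigma}(M_{i+1})$ act on $\mathrm{Hom}_{D_i}(M_i,M_{i+1})$ by $(g_i,g_{i+1})\cdot\varphi=g_{i+1}\circ\varphi\circ g_i^{-1}$. (2) If $Q_\xi^\alpha$ is of shape (VV-$\ell$), then $$H^\alpha\cong\mathbf{Aut}_{D_0/k^\sigma}(M_0,\{\cdot,\cdot\}_0)\times\prod_{i=1}^{\ell-1}\mathbf{GL}_{D_i/k^\sigma}(M_i)\times\mathbf{Aut}_{D_\ell/k^\sigma}(M_\ell,\{\cdot,\cdot\}_\ell),\qquad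 \mathfrak g(\xi)^\alpha\cong\bigoplus_{i=0}^{\ell-1}\mathrm{Hom}_{D_i}(M_i,M_{i+1}),$$ with $H^\alpha$ acting as in (1), viewed as a subgroup of $\prod_{i=0}^\ell\mathbf{GL}_{D_i/k^\sigma}(M_i)$. (3) If $Q_\xi^\alpha$ is of shape (VE-$\ell$), with fixed arrow $e:\ell\to\ell^\diamondsuit$, then $$H^\alpha\cong\mathbf{Aut}_{D_0/k^\sigma}(M_0,\{\cdot,\cdot\}_0)\times\prod_{i=1}^{\ell}\mathbf{GL}_{D_i/k^\sigma}(M_i),\qquad \mathfrak g(\xi)^\alpha\cong\Big(\bigoplus_{i=0}^{\ell-1}\mathrm{Hom}_{D_i}(M_i,M_{i+1})\Big)\oplus\mathfrak h^{-\epsilon\epsilon_e}(M_\ell,M_{\ell^\diamondsuit}).$$ The action on $\mathrm{Hom}_{D_i}(M_i,M_{i+1})$ is as in (1), viewing $\mathbf{Aut}_{D_0/k^\sigma}(M_0,\{\cdot,\cdot\}_0)$ as a subgroup of $\mathbf{GL}_{D_0/k^\sigma}(M_0)$; the action of $\mathbf{GL}_{D_\ell/k^\sigma}(M_\ell)$ (for $\ell=0$, of its subgroup $\mathbf{Aut}_{D_0/k^\sigma}(M_0,\{\cdot,\cdot\}_0)$) on $\mathfrak h^{-\epsilon\epsilon_e}(M_\ell,M_{\ell^\diamondsuit})$ is induced by its natural action on $M_\ell$ and the contragredient action $g\mapsto g^{*,-1}$ on $M_{\ell^\diamondsuit}$. (4) If $Q_\xi^\alpha$ is of shape (EE-$\ell$),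 with fixed arrows $e:1^\diamondsuit\to1$ and $e':\ell\to\ell^\diamondsuit$, then $$H^\alpha\cong\prod_{i=1}^\ell\mathbf{GL}_{D_i/k^\sigma}(M_i),\qquad \mathfrak g(\xi)^\alpha\cong\mathfrak h^{-\epsilon\epsilon_e}(M_{1^\diamondsuit},M_1)\oplus\Big(\bigoplus_{i=1}^{\ell-1}\mathrm{Hom}_{D_i}(M_i,M_{i+1})\Big)\oplus\mathfrak h^{-\epsilon\epsilon_{e'}}(M_\ell,M_{\ell^\diamondsuit}).$$ The action on $\mathrm{Hom}_{D_i}(M_i,M_{i+1})$ is as in (1); the actions of $\mathbf{GL}_{D_1/k^\sigma}(M_1)$ on $\mathfrak h^{-\epsilon\epsilon_e}(M_{1^\diamondsuit},M_1)$ and of $\mathbf{GL}_{D_\ell/k^\sigma}(M_\ell)$ on $\mathfrak h^{-\epsilon\epsilon_{e'}}(M_\ell,M_{\ell^\diamondsuit})$ are induced from the natural actions on $M_1$, $M_\ell$ and the contragredient actions $g\mapsto g^{*,-1}$ on $M_{1^\diamondsuit}$, $M_{\ell^\diamondsuit}$.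
   Context: **Setup.** $k$ is a field with $\mathrm{char}(k)\neq2$; $F$ is a finite separable commutative $k$-algebra (possibly a product of fields) with a ring automorphism $\zeta$ of order $n$ such that $F^\zeta=k$; $\mathrm{Nm}_{F/k}(a)=\prod_{j=0}^{n-1}\zeta^j(a)$. $V$ is a finitely generated $F$-module, $\theta:V\to V$ an additive bijection with $\theta(av)=\zeta(a)\theta(v)$ for $a\in F$; $m$ is a multiple of $n$ with $m/n$ invertible in $k$, and $\theta^m=\beta\cdot\mathrm{id}_V$ with $\beta\in k^\times$. $\sigma:F\to F$ is a ring automorphism with $\sigma^2=\mathrm{id}$ (possibly trivial) commuting with $\zeta$. $\epsilon\in\{\pm1\}$, and $\langle\cdot,\cdot\rangle:V\times V\to F$ is a non-degenerate pairing, $F$-linear in the first variable, with $\langle x,y\rangle=\epsilon\sigma(\langle y,x\rangle)$ and $\langle\theta x,\theta y\rangle=c\,\zeta(\langle x,y\rangle)$ for some $c\in(F^\times)^\sigma$ with $\mathrm{Nm}_{F/k}(c)^{m/n}=\beta\sigma(\beta)$. **Groups.** For a $k_0$-algebra $A$ and an $A$-module $M$ of finite dimension over the field $k_0$, $\mathbf{GL}_{A/k_0}(M)$ is the algebraic group over $k_0$ whose $R$-points are the $R\otimes_{k_0}A$-linear automorphisms of $R\otimes_{k_0}M$; $\mathbf{Aut}_{A/k_0}(M,\{\cdot,\cdot\})$ is the subgroup preserving a given $k_0$-bilinear pairing. $H$ is the algebraic group over $k^\sigma$ whose $R$-points are the $R\otimes_{k^\sigma}F$-linear automorphisms of $R\otimes_{k^\sigma}V$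 commuting with $\theta$ and preserving $\langle\cdot,\cdot\rangle$ (it is the fixed group of conjugation by $\theta$ on the Weil restriction to $k^\sigma$ of the isometry group $G$ of $(V,\langle\cdot,\cdot\rangle)$ over $F^\sigma$). $\Xi_{m/n}=\{\xi\in F^\times:\mathrm{Nm}_{F/k}(\xi)^{m/n}=1\}$. For $\xi\in\Xi_{m/n}\cap F^\sigma$, $\mathfrak g(\xi)=\{\varphi\in\mathrm{End}_F(V):\theta\varphi\theta^{-1}=\xi\varphi,\ \langle\varphi x,y\rangle+\langle x,\varphi y\rangle=0\ \forall x,y\}$, a $k^\sigma$-vector space on which $H$ acts by conjugation. **Algebra.** $A_\beta$ is the quotient of the twisted polynomial ring $F\langle\boldsymbol\theta\rangle$ ($\boldsymbol\theta a=\zeta(a)\boldsymbol\theta$ for $a\in F$) by the central element $\boldsymbol\theta^m-\beta$. $V$ is an $A_\beta$-module with $\boldsymbol\theta$ acting as $\theta$. The center of $A_\beta$ is $L_\beta=k[b]\cong k[\mathbf b]/(\mathbf b^{m/n}-\beta)$, $b=\boldsymbol\theta^n$. Write $L_\beta=\prod_{i\in I}L_i$ with $L_i$ fields, $b_i\in L_i$ the image of $b$; then $A_\beta=\prod_{i\in I}A_i$ with $A_i$ central simple over $L_i$. Fix a simple $A_i$-module $S_i$; $D_i=\mathrm{End}_{A_\beta}(S_i)^{\mathrm{opp}}$ is a central division algebra over $L_i$ acting on $S_i$ from the right. $M_i=\mathrm{Hom}_{A_\beta}(S_i,V)$ is a left $D_i$-module, $(dx)(u)=x(ud)$, and $V=\bigoplus_iS_i\otimes_{D_i}M_i$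 via $u\otimes x\mapsto x(u)$. **Quiver.** For an $A_\beta$-module $U$, $U^\xi$ is the $F$-module $U$ with $\boldsymbol\theta$ acting as $\xi\boldsymbol\theta$. $\overline\xi:I\to I$ is the permutation with $S_i^\xi\cong S_{\overline\xi(i)}$; equivalently, the permutation of $I=\mathrm{Spec}\,L_\beta$ induced by the $k$-automorphism $\mu_\xi:b\mapsto\mathrm{Nm}_{F/k}(\xi)b$ of $L_\beta$. $Q_\xi$ is the directed graph with vertex set $I$ and one arrow $i\to\overline\xi(i)$ for each $i\in I$. For $a\in\{c,c\xi^{-1}\}$, $\sigma_a:L_\beta\to L_\beta$ is the ring automorphism that is $\sigma$ on $k$ and sends $b\mapsto\mathrm{Nm}_{F/k}(a)b^{-1}$. The involution $i\mapsto i^\diamondsuit$ on $I$ is defined by $\sigma_c(L_i)=L_{i^\diamondsuit}$; it reverses arrows of $Q_\xi$, sending $e:i\to\overline\xi(i)$ to $e^\diamondsuit:\overline\xi(i)^\diamondsuit\to i^\diamondsuit$. **Pairings on $S_i$.** A pairing $\langle\cdot,\cdot\rangle_i:S_i\times S_{i^\diamondsuit}\to F$ is admissible if it is $F$-linear in the first variable, $(F,\sigma)$-semilinear in the second, and $\langle\boldsymbol\theta u,\boldsymbol\theta v\rangle_i=c\,\zeta(\langle u,v\rangle_i)$. Fix perfect admissible pairings $\langle\cdot,\cdot\rangle_i$ for all $i$ and signs $\epsilon_i$ such that $\langle v,u\rangle_{i^\diamondsuit}=\epsilon_i\sigma(\langle u,v\rangle_i)$, where: $\epsilon_i=1$ if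 $i\ne i^\diamondsuit$; if $i=i^\diamondsuit$, $\epsilon_i=1$ whenever a perfect admissible pairing with $\langle v,u\rangle_i=\sigma\langle u,v\rangle_i$ exists, and otherwise $\epsilon_i=-1$ (in which case all admissible pairings satisfy $\langle v,u\rangle_i=-\sigma\langle u,v\rangle_i$). **Pairings on $M_i$.** $\{\cdot,\cdot\}'_i:M_i\times M_{i^\diamondsuit}\to D_i$ is the unique pairing with $\langle u\otimes x,v\otimes y\rangle=\langle u\{x,y\}'_i,v\rangle_i$ for all $u\in S_i,v\in S_{i^\diamondsuit}$, and $\{x,y\}_i=\mathrm{Trd}_{D_i/L_i}\{x,y\}'_i\in L_i$. For $g\in\mathrm{Aut}_{D_i}(M_i)$, $g^*\in\mathrm{Aut}_{D_{i^\diamondsuit}}(M_{i^\diamondsuit})$ is defined by $\{gx,y\}_i=\{x,g^*y\}_i$; $g\mapsto g^{*,-1}$ gives $\mathbf{GL}_{D_i/k^\sigma}(M_i)\cong\mathbf{GL}_{D_{i^\diamondsuit}/k^\sigma}(M_{i^\diamondsuit})$. **Choice of $\eta_e$.** For each arrow $e:i\to\overline\xi(i)$ fix an $A_\beta$-isomorphism $\eta_e:S_i^\xi\to S_{\overline\xi(i)}$ and a sign $\epsilon_e$ such that $\sigma\langle v,\eta_e(u)\rangle_{\overline\xi(i)^\diamondsuit}=\epsilon_e\langle u,\eta_{e^\diamondsuit}(v)\rangle_i$ for all $u\in S_i$, $v\in S_{\overline\xi(i)^\diamondsuit}$, where: $\epsilon_e=1$ if $e\ne e^\diamondsuit$; if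 $e=e^\diamondsuit$ then $\epsilon_e=1$ whenever an $\eta_e$ with $\langle u,\eta_e(v)\rangle_i=\sigma\langle v,\eta_e(u)\rangle_i$ exists, and otherwise $\epsilon_e=-1$. $\eta_e^\flat:D_i\to D_{\overline\xi(i)}$ is the ring isomorphism with $\eta_e(ud)=\eta_e(u)\eta_e^\flat(d)$. For an arrow $e:i\to i^\diamondsuit$ fixed by $(-)^\diamondsuit$ and $\epsilon'\in\{\pm1\}$, $\mathfrak h^{\epsilon'}(M_i,M_{i^\diamondsuit})$ is the set of additive maps $\varphi:M_i\to M_{i^\diamondsuit}$ with $\varphi(dx)=\eta_e^\flat(d)\varphi(x)$ and $\{y,\varphi(x)\}_i=\epsilon'\sigma_{c\xi^{-1}}(\{x,\varphi(y)\}_i)$ for all $d\in D_i$, $x,y\in M_i$. **Decomposition by components.** Elements of $\mathbf{GL}_{A_\beta/k}(V)$ correspond to families $(g_i)_{i\in I}$, $g_i\in\mathbf{GL}_{D_i/k}(M_i)$, by $g(u\otimes x)=u\otimes g_i(x)$; elements $\varphi\in\mathrm{Hom}_{A_\beta}(V^\xi,V)$ correspond to families $(\varphi_e)$ over arrows $e:i\to\overline\xi(i)$, $\varphi_e\in\mathrm{Hom}_{D_i}(M_i,M_{\overline\xi(i)})$ ($D_i$ acting on the target via $\eta_e^\flat$), by $\varphi(u\otimes x)=\eta_e(u)\otimes\varphi_e(x)$. $\underline\Pi$ is the set of $(-)^\diamondsuit$-orbits on the set of connected components of $Q_\xi$ (each component is a directed cycle); for $\alpha\in\underline\Pi$, $Q_\xi^\alpha$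 is the union of the components in $\alpha$; $H^\alpha\subset H$ is the subgroup with $g_i=\mathrm{id}$ for $i\notin Q_\xi^\alpha$ and $\mathfrak g(\xi)^\alpha\subset\mathfrak g(\xi)$ the subspace with $\varphi_e=0$ for $e\notin Q_\xi^\alpha$. **Shapes of $Q_\xi^\alpha$.** (CC-$\ell$), $\ell\ge1$: two disjoint directed cycles $1\to2\to\cdots\to\ell\to1$ and $\ell^\diamondsuit\to(\ell-1)^\diamondsuit\to\cdots\to1^\diamondsuit\to\ell^\diamondsuit$, exchanged by $(-)^\diamondsuit$. (VV-$\ell$), $\ell\ge1$: one directed cycle with $2\ell$ vertices $0\to1\to\cdots\to\ell\to(\ell-1)^\diamondsuit\to\cdots\to1^\diamondsuit\to0$, with $0=0^\diamondsuit$, $\ell=\ell^\diamondsuit$ the only fixed vertices and no fixed arrow. (VE-$\ell$), $\ell\ge0$: one directed cycle with $2\ell+1$ vertices $0\to1\to\cdots\to\ell\to\ell^\diamondsuit\to\cdots\to1^\diamondsuit\to0$, with $0=0^\diamondsuit$ the only fixed vertex and $e:\ell\to\ell^\diamondsuit$ the only fixed arrow. (EE-$\ell$), $\ell\ge1$: one directed cycle with $2\ell$ vertices $1\to\cdots\to\ell\to\ell^\diamondsuit\to\cdots\to1^\diamondsuit\to1$, no fixed vertex, and exactly two fixed arrows $e:1^\diamondsuit\to1$ and $e':\ell\to\ell^\diamondsuit$. *)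

(* Defs.v *)
From HB Require Import structures.
From mathcomp Require Import all_boot all_order all_fingroup all_algebra.
From mathcomp Require Import all_field.
From mathcomp Require Import boolp classical_sets.

Set Implicit Arguments.
Unset Strict Implicit.
Unset Printing Implicit Defensive.

Import GRing.Theory passmx.
Local Open Scope ring_scope.

(* Conventions.
   - k0 is the fixed field of the involution of k; k is a finite extension of
     k0 (of degree at most 2). F, its modules, the D_i, the M_i and the L_i are
     finite-dimensional over k0, and every additive map that is linear over F,
     semilinear over zeta or sigma, or linear over some D_i is k0-linear, so
     that these maps live in 'Hom spaces over k0.
   - Pairings S_i x S_{dia i}, M_i x M_{dia i} and maps S_i -> S_{xibar i} are
     families indexed by two vertices i and j, of which only the members with
     j = dia i, resp. j = xibar i, matter. This avoids casts along
     dia (dia i) = i.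
   - Signs are elements of k0. *)

(* The subspace of the vectors satisfying P (0 if they form no subspace). *)
Definition vspace_of (K : fieldType) (T : vectType K) (P : T -> Prop) :
    {vspace T} :=
  xget 0%VS [set U : {vspace T} | forall x, x \in U <-> P x]%classic.

Lemma vspace_ofP (K : fieldType) (T : vectType K) (P : T -> Prop) :
  P 0 -> (forall (a : K) (x y : T), P x -> P y -> P (a *: x + y)) ->
  forall x, x \in vspace_of P <-> P x.
Proof.
move=> P0 PD.
suff exU : exists U : {vspace T}, forall x, x \in U <-> P x.
  exact: (@xgetPex _ 0%VS
    [set U : {vspace T} | forall x, x \in U <-> P x]%classic exU).
pose good (U : {vspace T}) := forall x, x \in U -> P x.
have [U [gU maxU]] :
    exists U : {vspace T}, good U /\ forall W, good W -> (\dim W <= \dim U)%N.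
  pose Q (d : nat) := `[< exists U : {vspace T}, good U /\ \dim U = d >].
  have exQ : exists d, Q d.
    exists 0%N; apply/asboolP; exists 0%VS; rewrite dimv0; split=> // x.
    by rewrite memv0 => /eqP->.
  have ubQ d : Q d -> (d <= \dim {: T})%N.
    by move=> /asboolP[U [_ <-]]; exact/dimvS/subvf.
  case: (ex_maxnP exQ ubQ) => d /asboolP[U [gU dU]] maxd.
  by exists U; split=> // W gW; rewrite dU; apply/maxd/asboolP; exists W.
exists U => x; split=> [/gU //|Px].
have gW : good (U + <[x]>)%VS.
  move=> y /memv_addP[u uU [w /vlineP[a ->] ->]].
  by rewrite addrC; apply: PD => //; apply: gU.
have /eqP-> : U == (U + <[x]>)%VS by rewrite eqEdim addvSl maxU.
by rewrite memvE addvSr.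
Qed.

Section BaseChange.
Variables (k0 : fieldType) (R : comAlgType k0).

(* R (x)_{k0} M is 'cV[R]_(\dim {:M}), in the coordinates of the basis
   vbasis {:M} of M; tens1 x is 1 (x) x. *)
Definition tens1 (M : vectType k0) (x : M) : 'cV[R]_(\dim {:M}) :=
  (map_mx (in_alg R) (rVof (vbasis {:M}) x))^T.

(* The matrix of id_R (x) f. *)
Definition tensf (M N : vectType k0) (f : 'Hom(M, N)) :
    'M[R]_(\dim {:N}, \dim {:M}) :=
  (map_mx (in_alg R) (mxof (vbasis {:M}) (vbasis {:N}) f))^T.

(* The R-linear extension to R (x) M of a k0-linear map f from M to an
   R-module. *)
Definition lin_ext (M : vectType k0) (N : lmodType R) (f : M -> N)
    (u : 'cV[R]_(\dim {:M})) : N :=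
  \sum_s u s 0 *: f (vbasis {:M})`_s.

(* The R-bilinear extension of a k0-bilinear pairing. *)
Definition pairing_ext (M N P : vectType k0) (B : M -> N -> P)
    (u : 'cV[R]_(\dim {:M})) (v : 'cV[R]_(\dim {:N})) :
    'cV[R]_(\dim {:P}) :=
  lin_ext (fun x => lin_ext (fun y => tens1 (B x y)) v) u.

Definition is_inverse_mx n (g h : 'M[R]_n) := g *m h = 1%:M /\ h *m g = 1%:M.

(* R-points of GL_{A/k0}(M), A acting on M through act; R (x) A-linearity
   amounts to R-linearity and commutation with 1 (x) a for a in A. *)
Definition GL_points (A : Type) (M : vectType k0) (act : A -> 'End(M))
    (g : 'M[R]_(\dim {:M})) : Prop :=
  (exists h, is_inverse_mx g h) /\
  forall a, g *m tensf (act a) = tensf (act a) *m g.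

Definition preserves (M P : vectType k0) (B : M -> M -> P)
    (g : 'M[R]_(\dim {:M})) : Prop :=
  forall u v, pairing_ext B (g *m u) (g *m v) = pairing_ext B u v.

(* gc = g^{*,-1}, where {g x, y} = {x, g^* y}. *)
Definition contragredient (M N P : vectType k0) (B : M -> N -> P)
    (g : 'M[R]_(\dim {:M})) (gc : 'M[R]_(\dim {:N})) : Prop :=
  exists2 gs : 'M[R]_(\dim {:N}),
    (forall u v, pairing_ext B (g *m u) v = pairing_ext B u (gs *m v))
    & is_inverse_mx gs gc.

Lemma tensfE (M N : vectType k0) (f : 'Hom(M, N)) x :
  tensf f *m tens1 x = tens1 (f x).
Proof.
rewrite /tensf /tens1 -trmx_mul -map_mxM; congr (map_mx _ _)^T.
by rewrite mul_mxof rVofK ?vbasisP.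
Qed.

Lemma lin_extE (M N : vectType k0) (f : 'Hom(M, N)) u :
  lin_ext (fun x => tens1 (f x)) u = tensf f *m u.
Proof.
rewrite /lin_ext {2}(matrix_sum_delta u) mulmx_sumr; apply: eq_bigr => s _.
rewrite big_ord1 -scalemxAr; congr (_ *: _).
rewrite -tensfE; congr (_ *m _).
by rewrite /tens1 rVofE ?vbasisP // map_delta_mx trmx_delta.
Qed.

End BaseChange.

(* F is a product of finite separable field extensions of k. *)
Definition finite_separable (k : fieldType) (F : nzRingType) (iota : k -> F) :
    Prop :=
  exists (J : finType) (E : J -> fieldExtType k)
         (pr : forall j, {rmorphism F -> E j}),
    [/\ forall j, separable 1 {: E j},
        forall j x, pr j (iota x) = x%:A
      & forall y : (forall j, E j), exists! a, forall j, pr j a = y j].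

Record cyclic_algebra (k0 : fieldType) (k : fieldExtType k0)
    (sigk : {rmorphism k -> k}) (n : nat) := CyclicAlgebra {
  cyc_alg :> falgType k0;
  cyc_iota : {lrmorphism k -> cyc_alg};
  zeta : {rmorphism cyc_alg -> cyc_alg};
  sigma : {rmorphism cyc_alg -> cyc_alg};
  char_neq2 : (2%:R : k) != 0;
  sigkK : involutive sigk;
  sigk_fixed : forall x, sigk x = x <-> x \in 1%VS;
  cyc_comm : forall a b : cyc_alg, a * b = b * a;
  cyc_separable : finite_separable cyc_iota;
  n_gt0 : (0 < n)%N;
  zeta_order : forall j, (forall a, iter j zeta a = a) <-> (n %| j)%N;
  zeta_fixed : forall a, zeta a = a <-> exists x, a = cyc_iota x;
  sigmaK : involutive sigma;
  sigma_zeta : forall a, sigma (zeta a) = zeta (sigma a);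
  sigma_iota : forall x, sigma (cyc_iota x) = cyc_iota (sigk x)
}.

Section Polarized.
Variables (k0 : fieldType) (k : fieldExtType k0) (sigk : {rmorphism k -> k}).
Variables (n m : nat) (beta : k) (F : cyclic_algebra sigk n).

Local Notation iota := (cyc_iota F).

(* Nm_{F/k}(a), as an element of k. *)
Definition Nm (a : F) : k :=
  xget 0 [set x : k | iota x = \prod_(j < n) iter j (zeta F) a]%classic.

Record theta_module := ThetaModule {
  tm_space :> vectType k0;
  tm_act : F -> 'End(tm_space);
  theta : 'End(tm_space)
}.

(* A module over A_beta = F<theta> / (theta^m - beta) that is finitely
   generated (over F or over k0): an F-module with a zeta-semilinear operator
   theta such that theta^m = beta. *)
Definition is_Abeta_module (U : theta_module) : Prop :=
  [/\ forall u : U, tm_act U 1 u = u,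
      forall a b (u : U), tm_act U (a + b) u = tm_act U a u + tm_act U b u,
      forall a b (u : U), tm_act U (a * b) u = tm_act U a (tm_act U b u),
      forall (x : k0) (u : U), tm_act U x%:A u = x *: u
    & (forall a (u : U),
         theta U (tm_act U a u) = tm_act U (zeta F a) (theta U u)) /\
      (forall u : U, iter m (theta U) u = tm_act U (iota beta) u)].

(* U^xi *)
Definition twist (xi : F) (U : theta_module) : theta_module :=
  @ThetaModule U (tm_act U) (tm_act U xi \o theta U)%VF.

Definition Abeta_hom (U W : theta_module) (f : 'Hom(U, W)) : Prop :=
  (forall a u, f (tm_act U a u) = tm_act W a (f u)) /\
  (forall u, f (theta U u) = theta W (f u)).

Definition Abeta_iso (U W : theta_module) (f : 'Hom(U, W)) : Prop :=
  Abeta_hom f /\ bijective f.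

Definition Abeta_simple (U : theta_module) : Prop :=
  [/\ is_Abeta_module U, (exists u : U, u != 0)
    & forall W : {vspace U},
        (forall a u, u \in W -> tm_act U a u \in W) ->
        (forall u, u \in W -> theta U u \in W) ->
        W = 0%VS \/ W = {:U}%VS].

(* The center L_beta = k[b], b = theta^n, of A_beta. *)
Definition Lbeta : comUnitAlgType k :=
  {poly %/ ('X^(m %/ n) - beta%:P : {poly k})}.

Definition b_elt : Lbeta := 'qX.

(* The polynomial q(b) acting on U. *)
Definition center_act (U : theta_module) (q : Lbeta) : 'End(U) :=
  let p : {poly k} :=
    polyn (q : {poly %/ ('X^(m %/ n) - beta%:P : {poly k})}) in
  linfun (fun u : U =>
    \sum_(j < size p) tm_act U (iota p`_j) (iter (n * j) (theta U) u)).

(* sigma_a : sigma on k, and b |-> Nm(a) b^-1. *)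
Definition sigma_ (a : F) (q : Lbeta) : Lbeta :=
  let p : {poly k} :=
    polyn (q : {poly %/ ('X^(m %/ n) - beta%:P : {poly k})}) in
  (map_poly (fun x => (sigk x)%:A : Lbeta) p).[Nm a *: b_elt^-1].

Section Pairings.
Variables (U W : theta_module) (B : U -> W -> F).

Definition F_linear_l : Prop :=
  (forall u u' w, B (u + u') w = B u w + B u' w) /\
  (forall a u w, B (tm_act U a u) w = a * B u w).

Definition sigma_linear_r : Prop :=
  (forall u w w', B u (w + w') = B u w + B u w') /\
  (forall a u w, B u (tm_act W a w) = sigma F a * B u w).

Definition theta_similitude (c : F) : Prop :=
  forall u w, B (theta U u) (theta W w) = c * zeta F (B u w).

Definition admissible (c : F) : Prop :=
  [/\ F_linear_l, sigma_linear_r & theta_similitude c].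

(* Each side identifies with the (semi)linear dual of the other. *)
Definition perfect : Prop :=
  (forall f : W -> F,
     (forall w w', f (w + w') = f w + f w') ->
     (forall a w, f (tm_act W a w) = sigma F a * f w) ->
     exists! u, forall w, B u w = f w) /\
  (forall f : U -> F,
     (forall u u', f (u + u') = f u + f u') ->
     (forall a u, f (tm_act U a u) = a * f u) ->
     exists! w, forall u, B u w = f u).

End Pairings.

Record polarized_space := PolarizedSpace {
  pol_mod :> theta_module;
  vform : pol_mod -> pol_mod -> F;
  eps : k0;
  pol_c : F;
  n_dvd_m : (n %| m)%N;
  mn_inv : ((m %/ n)%:R : k) != 0;
  beta_neq0 : beta != 0;
  pol_modP : is_Abeta_module pol_mod;
  eps_sign : eps = 1 \/ eps = -1;
  vform_linear : F_linear_l vform;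
  vform_sym : forall x y, vform x y = eps *: sigma F (vform y x);
  vform_nondeg : forall x, (forall y, vform x y = 0) -> x = 0;
  vform_theta : theta_similitude vform pol_c;
  pol_c_unit : pol_c \is a GRing.unit;
  pol_c_fixed : sigma F pol_c = pol_c;
  pol_c_norm : Nm pol_c ^+ (m %/ n) = beta * sigk beta
}.

(* Membership in Xi_{m/n}, intersected with F^sigma. *)
Definition in_Xi_sigma (xi : F) : Prop :=
  [/\ xi \is a GRing.unit, Nm xi ^+ (m %/ n) = 1 & sigma F xi = xi].

Variables (V : polarized_space) (xi : F).

(* The vertices I with the factors L_i of L_beta, the simple modules S_i, the
   permutation xibar and the involution dia; eta i (xibar i) is eta_e for the
   arrow e : i -> xibar i, and an arrow is designated by its source. *)
Record quiver := Quiver {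
  vert :> finType;
  Lfac : vert -> fieldExtType k0;
  prL : forall i, {rmorphism Lbeta -> Lfac i};
  inL : forall i, Lfac i -> Lbeta;
  Smod : vert -> theta_module;
  xibar : {perm vert};
  dia : vert -> vert;
  eta : forall i j, 'Hom(Smod i, Smod j);
  prL_k0 : forall i (x : k0), prL i (x%:A : k)%:A = x%:A;
  inLK : forall i (y : Lfac i), prL i (inL y) = y;
  prL_inL : forall i j (y : Lfac i), j != i -> prL j (inL y) = 0;
  Lbeta_prod : forall q, q = \sum_i inL (prL i q);
  Smod_simple : forall i, Abeta_simple (Smod i);
  Smod_Lfac : forall i q, prL i q = 0 -> forall u, center_act (Smod i) q u = 0;
  eta_iso : forall i,
    @Abeta_iso (twist xi (Smod i)) (Smod (xibar i)) (eta i (xibar i));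
  (* sigma_c(L_i) = L_{dia i} *)
  diaP : forall i q,
    (exists y : Lfac (dia i), q = inL y) <->
    (exists y : Lfac i, q = sigma_ (pol_c V) (inL y))
}.

Section Quiver.
Variable Q : quiver.
Local Notation S := Smod.
Implicit Types i j : Q.

(* Pi: the orbits of dia on the set of connected components, the latter being
   given by their sets of vertices; Q_xi^alpha has vertex set cover alpha. *)
Definition Q_adj : rel Q := [rel i j | (j == xibar Q i) || (i == xibar Q j)].
Definition components : {set {set Q}} :=
  equivalence_partition (connect Q_adj) [set: Q].
Definition Pi_orbits : {set {set {set Q}}} :=
  [set [set C; [set dia i | i in C]] | C : {set Q} in components].

Definition Dspace i : {vspace 'End(S i)} :=
  vspace_of (fun f : 'End(S i) => Abeta_hom f).
Definition D i : vectType k0 := subvs_of (Dspace i).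

Lemma Dspace_mem i f : f \in Dspace i <-> Abeta_hom f.
Proof.
apply: vspace_ofP => [|a x y [xF xT] [yF yT]]; first by split=> *;
  rewrite !lfunE /= ?linear0.
by split=> *; rewrite !lfunE /= !lfunE /= ?xF ?yF ?xT ?yT linearP.
Qed.

Definition Mspace i : {vspace 'Hom(S i, V)} :=
  vspace_of (fun f : 'Hom(S i, V) => Abeta_hom f).
Lemma Mspace_mem i f : f \in Mspace i <-> Abeta_hom f.
Proof.
apply: vspace_ofP => [|a x y [xF xT] [yF yT]]; first by split=> *;
  rewrite !lfunE /= ?linear0.
by split=> *; rewrite !lfunE /= !lfunE /= ?xF ?yF ?xT ?yT linearP.
Qed.

Definition M i : vectType k0 := subvs_of (Mspace i).

Definition Dval i (d : D i) : 'End(S i) := vsval (d : subvs_of (Dspace i)).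
Definition Mval i (x : M i) : 'Hom(S i, V) := vsval (x : subvs_of (Mspace i)).
Definition Dproj i (f : 'End(S i)) : D i := vsproj (Dspace i) f.
Definition Mproj i (f : 'Hom(S i, V)) : M i := vsproj (Mspace i) f.

(* u d = d(u), so the product of D_i is opposite to the composition. *)
Definition Dmul i (d d' : D i) : D i := Dproj (Dval d' \o Dval d)%VF.

(* (d x)(u) = x(u d) *)
Definition Dact i (d : D i) : 'End(M i) :=
  linfun (fun x : M i => Mproj (Mval x \o Dval d)%VF).

(* x |-> u (x) x, i.e. x |-> x(u), from M_i to V. *)
Definition ev i (u : S i) : 'Hom(M i, V) := linfun (fun x : M i => Mval x u).

(* eta_e^flat : D_i -> D_j, with eta_e(u d) = eta_e(u) eta_e^flat(d). *)
Definition flat i j (d : D i) : D j :=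
  Dproj (eta i j \o (Dval d \o (eta i j)^-1))%VF.

Lemma Dact_val i (d : D i) (x : M i) (u : S i) :
  Mval (Dact d x) u = Mval x (Dval d u).
Proof.
have lin : linear (fun x : M i => Mproj (Mval x \o Dval d)%VF).
  move=> a y z; rewrite /Mproj /Mval -linearP; congr vsproj.
  by apply/lfunP=> w; do !rewrite !lfunE /=.
pose f : {linear M i -> M i} := HB.pack (fun x => Mproj (Mval x \o Dval d)%VF)
  (GRing.isLinear.Build k0 (M i) (M i) _ _ lin).
rewrite /Dact (lfunE f) /= /Mval /Mproj vsprojK ?lfunE //.
have /Dspace_mem[dF dT] := subvsP (d : subvs_of (Dspace i)).
have /Mspace_mem[xF xT] := subvsP (x : subvs_of (Mspace i)).
by apply/Mspace_mem; split=> *; rewrite !lfunE /= /Dval ?dF ?dT ?xF ?xT.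
Qed.

Lemma evE i (u : S i) (x : M i) : ev u x = Mval x u.
Proof.
have lin : linear (fun x : M i => Mval x u).
  by move=> a y z; rewrite /Mval linearP !lfunE /= lfunE.
pose f : {linear M i -> V} := HB.pack (fun x : M i => Mval x u)
  (GRing.isLinear.Build k0 (M i) V _ _ lin).
by rewrite /ev (lfunE f).
Qed.

Lemma flatP i (d : D i) (u : S i) (j := xibar Q i) :
  eta i j (Dval d u) = Dval (flat j d) (eta i j u).
Proof.
have [[eF eT] bij] := eta_iso i; rewrite -/j in eF eT bij.
have inj : lker (eta i j) == 0%VS by apply/lker0P/bij_inj.
have [g gK Kg] := bij.
have Vg w : (eta i j)^-1%VF w = g w.
  by rewrite -{1}(Kg w) lker0_lfunK.
have /Dspace_mem[dF dT] := subvsP (d : subvs_of (Dspace i)).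
rewrite /flat /Dval /Dproj vsprojK; first by rewrite !lfunE /= lfunE /= Vg gK.
apply/Dspace_mem; split=> [a w|w]; rewrite !lfunE /= !lfunE /= !Vg.
  rewrite -[w]Kg -eF !gK dF; exact: eF.
by rewrite -[w]Kg -eT !gK /= lfunE /= dF dT -eT /= lfunE.
Qed.

(* tr is the reduced trace of D_i over L_i: the trace in a representation
   D_i -> M_r(E) over an extension E of L_i, with dim_{L_i} D_i = r^2. *)
Definition is_reduced_trace i (tr : D i -> Lfac i) : Prop :=
  exists (E : fieldType) (incl : {rmorphism Lfac i -> E}) (r : nat)
         (rho : D i -> 'M[E]_r),
    [/\ forall d d', rho (d + d') = rho d + rho d',
        forall d d', rho (Dmul d d') = rho d *m rho d',
        forall q, rho (Dproj (center_act (S i) q)) = (incl (prL i q))%:M,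
        \dim (Dspace i) = (r ^ 2 * \dim {: Lfac i})%N
      & forall d, incl (tr d) = \tr (rho d)].

Record quiver_pairings := QuiverPairings {
  spair : forall i j : Q, S i -> S j -> F;
  eps_v : Q -> k0;
  eps_a : Q -> k0;
  mpairD : forall i j, M i -> M j -> D i;
  Trd : forall i, D i -> Lfac i;
  spair_admissible : forall i, admissible (@spair i (dia i)) (pol_c V);
  spair_perfect : forall i, perfect (@spair i (dia i));
  spair_sym : forall i (u : S i) (v : S (dia i)),
    spair v u = eps_v i *: sigma F (spair u v);
  eps_v_neq : forall i : Q, dia i <> i -> eps_v i = 1;
  eps_v_eq : forall i : Q, dia i = i ->
    let sym_exists := exists B : S i -> S i -> F,
      [/\ admissible B (pol_c V), perfect B
        & forall u v, B v u = sigma F (B u v)] in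
    (sym_exists -> eps_v i = 1) /\ (~ sym_exists -> eps_v i = -1);
  (* The arrow opposite to e : i -> xibar i is
     dia (xibar i) -> dia i = xibar (dia (xibar i)). *)
  eta_sym : forall i (u : S i) (v : S (dia (xibar Q i))),
    sigma F (spair v (eta i (xibar Q i) u)) =
    eps_a i *: spair u (eta (dia (xibar Q i)) (dia i) v);
  eps_a_neq : forall i : Q, dia (xibar Q i) <> i -> eps_a i = 1;
  eps_a_eq : forall i : Q, dia (xibar Q i) = i ->
    let sym_exists := exists f : 'Hom(S i, S (xibar Q i)),
      @Abeta_iso (twist xi (S i)) (S (xibar Q i)) f /\
      (forall u v : S i, spair u (f v) = sigma F (spair v (f u))) in
    (sym_exists -> eps_a i = 1) /\ (~ sym_exists -> eps_a i = -1);
  mpairDP : forall i (x : M i) (y : M (dia i)) (u : S i) (v : S (dia i)),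
    vform (Mval x u) (Mval y v) = spair (Dval (mpairD x y) u) v;
  TrdP : forall i, is_reduced_trace (@Trd i)
}.

Variable P : quiver_pairings.

(* {x, y}_i, when j = dia i. *)
Definition mpair i j (x : M i) (y : M j) : Lfac i := Trd P (mpairD P x y).

(* Hom_{D_i}(M_i, M_j), M_j being viewed as a D_i-module via eta_e^flat. *)
Definition is_Dhom i j (psi : 'Hom(M i, M j)) : Prop :=
  forall d x, psi (Dact d x) = Dact (flat j d) (psi x).

(* h^{s}(M_i, M_{dia i}) for a fixed arrow e : i -> xibar i = dia i; in this
   case sigma_{c xi^-1} maps L_i, viewed in L_beta, to itself. *)
Definition in_h (s : k0) i (psi : 'Hom(M i, M (xibar Q i))) : Prop :=
  is_Dhom psi /\
  forall x y : M i,
    mpair y (psi x) =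
    s *: prL i (sigma_ (pol_c V / xi) (inL (mpair x (psi y)))).

Definition H_points (R : comAlgType k0) (g : 'M[R]_(\dim {:V})) : Prop :=
  [/\ GL_points (tm_act V) g,
      g *m tensf R (theta V) = tensf R (theta V) *m g
    & preserves (vform (p:=V)) g].

(* theta phi theta^-1 = xi phi, written as theta phi = xi phi theta. *)
Definition g_xi : {vspace 'End(V)} :=
  vspace_of (fun phi : 'End(V) =>
    [/\ forall a x, phi (tm_act V a x) = tm_act V a (phi x),
        forall x, theta V (phi x) = tm_act V xi (phi (theta V x))
      & forall x y : V, vform (phi x) y + vform x (phi y) = 0]).

Lemma g_xi_mem (phi : 'End(V)) :
  phi \in g_xi <->
  [/\ forall a x, phi (tm_act V a x) = tm_act V a (phi x),
      forall x, theta V (phi x) = tm_act V xi (phi (theta V x))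
    & forall x y : V, vform (phi x) y + vform x (phi y) = 0].
Proof.
have [BD BF] := vform_linear V.
have [_ _ _ actZ _] := pol_modP V.
have BZ (a : k0) (x y : V) : vform (a *: x) y = a *: vform x y.
  by rewrite -actZ BF mulr_algl.
have [B0l B0r] : (forall y : V, vform 0 y = 0) * (forall x : V, vform x 0 = 0).
  have B0 y : vform (0 : V) y = 0 by rewrite -(scale0r 0) BZ scale0r.
  by split=> // x; rewrite vform_sym B0 rmorph0 scaler0.
have sigZ (a : k0) (z : F) : sigma F (a *: z) = a *: sigma F z.
  have sa : sigma F a%:A = a%:A.
    rewrite -(rmorph_alg (iota : {lrmorphism k -> F})) sigma_iota.
    congr (iota _); apply/(sigk_fixed F).
    by apply/vlineP; exists a.
  by rewrite -mulr_algl rmorphM sa mulr_algl.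
have BZr (a : k0) (x y : V) : vform x (a *: y) = a *: vform x y.
  by rewrite vform_sym BZ sigZ scalerA mulrC -scalerA -vform_sym.
have BDr (x y z : V) : vform x (y + z) = vform x y + vform x z.
  by rewrite vform_sym BD rmorphD scalerDr -!vform_sym.
apply: vspace_ofP => [|a f g [fF fT fB] [gF gT gB]].
  by split=> *; rewrite !lfunE /= ?linear0 // B0l B0r addr0.
split=> [b x|x|x y]; rewrite !lfunE /= !lfunE /= ?linearP ?linearD ?linearZ /=.
- by rewrite fF gF.
- by rewrite fT gT.
by rewrite BD BDr BZ BZr addrACA -scalerDr fB gB scaler0 addr0.
Qed.

(* g (u (x) x) = u (x) g_i(x) for u in S_i and x in R (x) M_i. *)
Definition is_vertex_component (R : comAlgType k0) i
    (g : 'M[R]_(\dim {:V})) (gi : 'M[R]_(\dim {:M i})) : Prop :=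
  forall u : S i, g *m tensf R (ev u) = tensf R (ev u) *m gi.

(* phi (u (x) x) = eta_e(u) (x) phi_e(x) for e : i -> xibar i. *)
Definition is_arrow_component i (phi : 'End(V))
    (phie : 'Hom(M i, M (xibar Q i))) : Prop :=
  forall (u : S i) (x : M i),
    phi (ev u x) = ev (eta i (xibar Q i) u) (phie x).

Local Notation EndV R := 'M[R]_(\dim {:V}).
Local Notation EndM R i := 'M[R]_(\dim {:M i}).

Section Component.
Variable alpha : {set {set Q}}.

Definition H_alpha (R : comAlgType k0) (g : EndV R) : Prop :=
  H_points g /\
  forall i, i \notin finset.cover alpha ->
    is_vertex_component g (1%:M : EndM R i).

Definition g_alpha : {vspace 'End(V)} :=
  vspace_of (fun phi : 'End(V) => phi \in g_xi /\
    forall i, i \notin finset.cover alpha -> @is_arrow_component i phi 0).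

(* The data of a description:
     dV   a set of vertices, each contributing GL_{D_i}(M_i) to H^alpha,
     dAut the subset of those (with dia i = i) contributing
          Aut_{D_i}(M_i, {,}_i) instead,
     dHom the arrows e : i -> xibar i contributing Hom_{D_i}(M_i, M_{xibar i}),
     dOut the fixed arrows i -> dia i with i in dV, and
     dIn  the fixed arrows dia j -> j with j in dV, both contributing
          h^{- eps eps_e} with the contragredient action on the dia side.
   Families over I stand for families over these subsets. *)
Variables (dV dAut dHom dOut dIn : {set Q}).

Definition model_group (R : comAlgType k0)
    (g : forall i : Q, EndM R i) : Prop :=
  forall i, i \in dV ->
    GL_points (@Dact i) (g i) /\ (i \in dAut -> preserves (@mpair i i) (g i)).

Definition model_space (psi : forall i : Q, 'Hom(M i, M (xibar Q i))) : Prop :=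
  (forall i, i \in dHom -> is_Dhom (psi i)) /\
  (forall i, i \in dOut :|: dIn -> in_h (- (eps V * eps_a P i)) (psi i)).

(* On R-points, g . X = Y in the summand indexed by the arrow i. *)
Definition model_action (R : comAlgType k0)
    (g : forall i : Q, EndM R i)
    i (X Y : 'M[R]_(\dim {:M (xibar Q i)}, \dim {:M i})) : Prop :=
  [/\ i \in dHom -> Y *m g i = g (xibar Q i) *m X,
      i \in dOut -> exists2 gc,
        contragredient (@mpair i (xibar Q i)) (g i) gc & Y *m g i = gc *m X
    & i \in dIn -> exists2 gc,
        contragredient (@mpair (xibar Q i) i) (g (xibar Q i)) gc
        & Y *m gc = g (xibar Q i) *m X].

(* Phi is an isomorphism of H^alpha onto the model group, as group functors on
   commutative k0-algebras. *)
Definition is_group_iso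
    (Phi : forall (R : comAlgType k0) (g : EndV R) (i : Q),
       EndM R i) : Prop :=
  [/\ forall (R : comAlgType k0) (g : EndV R),
        H_alpha g -> model_group (Phi R g),
      forall (R : comAlgType k0) (g h : EndV R), H_alpha g -> H_alpha h ->
        forall i, i \in dV -> Phi R (g *m h) i = Phi R g i *m Phi R h i,
      forall (R : comAlgType k0) (g h : EndV R), H_alpha g -> H_alpha h ->
        (forall i, i \in dV -> Phi R g i = Phi R h i) -> g = h,
      forall (R : comAlgType k0) (g' : forall i : Q, EndM R i),
        model_group g' ->
        exists2 g, H_alpha g & forall i, i \in dV -> Phi R g i = g' i
    & forall (R R' : comAlgType k0) (f : {lrmorphism R -> R'}) (g : EndV R),
        H_alpha g -> forall i, i \in dV ->
        Phi R' (map_mx f g) i = map_mx f (Phi R g i)].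

Definition is_space_iso
    (Lam : forall i : Q,
       'Hom(subvs_of g_alpha, 'Hom(M i, M (xibar Q i)))) : Prop :=
  [/\ forall phi, model_space (fun i => Lam i phi),
      forall phi psi,
        (forall i, i \in dHom :|: dOut :|: dIn -> Lam i phi = Lam i psi) ->
        phi = psi
    & forall psi, model_space psi ->
        exists phi, forall i, i \in dHom :|: dOut :|: dIn -> Lam i phi = psi i].

(* h X h^-1 = Y in R (x) g(xi)^alpha if and only if Phi(h) . Lam(X) = Lam(Y). *)
Definition is_equivariant
    (Phi : forall (R : comAlgType k0) (g : EndV R) (i : Q),
       EndM R i)
    (Lam : forall i : Q,
       'Hom(subvs_of g_alpha, 'Hom(M i, M (xibar Q i)))) : Prop :=
  forall (R : comAlgType k0) (h : EndV R)
         (X Y : 'cV[R]_(\dim {: subvs_of g_alpha})),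
    H_alpha h ->
    let inEnd := lin_ext (fun phi : subvs_of g_alpha => tensf R (vsval phi)) in
    let LamR i := lin_ext (fun phi => tensf R (Lam i phi)) in
    inEnd Y *m h = h *m inEnd X <->
    forall i, model_action (Phi R h) (LamR i X) (LamR i Y).

Definition pair_described : Prop :=
  exists Phi Lam,
    [/\ is_group_iso Phi, is_space_iso Lam & is_equivariant Phi Lam].

End Component.

(* The product map from the H^alpha to H is an isomorphism: the H^alpha commute
   with each other and every element of H is uniquely a product of elements of
   the H^alpha. *)
Definition H_is_product : Prop :=
  forall R : comAlgType k0,
    [/\ forall (alpha alpha' : {set {set Q}}) (g h : EndV R),
          alpha \in Pi_orbits -> alpha' \in Pi_orbits -> alpha != alpha' ->
          H_alpha alpha g -> H_alpha alpha' h -> g *m h = h *m g,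
        forall fam : {set {set Q}} -> EndV R,
          (forall alpha, alpha \in Pi_orbits -> H_alpha alpha (fam alpha)) ->
          H_points (\big[mulmx/1%:M]_(alpha in Pi_orbits) fam alpha)
      & forall h : EndV R, H_points h ->
          exists fam : {set {set Q}} -> EndV R,
            [/\ forall alpha, alpha \in Pi_orbits ->
                  H_alpha alpha (fam alpha),
                h = \big[mulmx/1%:M]_(alpha in Pi_orbits) fam alpha
              & forall fam' : {set {set Q}} -> EndV R,
                  (forall alpha, alpha \in Pi_orbits ->
                     H_alpha alpha (fam' alpha)) ->
                  h = \big[mulmx/1%:M]_(alpha in Pi_orbits) fam' alpha ->
                  forall alpha, alpha \in Pi_orbits ->
                    fam' alpha = fam alpha]].

Definition g_xi_is_sum : Prop :=
  g_xi = (\sum_(alpha in Pi_orbits) g_alpha alpha)%VS /\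
  directv (\sum_(alpha in Pi_orbits) g_alpha alpha).

Section Shapes.
Variables (alpha : {set {set Q}}) (l : nat) (v : nat -> Q).

(* The shapes label half of the vertices by v, the others by dia (v i). *)
(* v a, ..., v (b - 1) *)
Definition labels (a b : nat) : seq Q := [seq v t | t <- index_iota a b].
(* dia (v (b - 1)), ..., dia (v a) *)
Definition dia_labels (a b : nat) : seq Q := rev [seq dia i | i <- labels a b].
Definition label_set (a b : nat) : {set Q} := [set i in labels a b].

Definition is_CC : Prop :=
  [/\ (0 < l)%N, uniq (labels 1 l.+1 ++ dia_labels 1 l.+1),
      fcycle (xibar Q) (labels 1 l.+1), fcycle (xibar Q) (dia_labels 1 l.+1)
    & finset.cover alpha =i labels 1 l.+1 ++ dia_labels 1 l.+1].

(* Uniqueness of the vertices entails that there are no other fixed vertices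
   and no other fixed arrows than the ones named in each of these shapes. *)
Definition is_cycle_shape (s : seq Q) : Prop :=
  [/\ uniq s, fcycle (xibar Q) s & finset.cover alpha =i s].

Definition is_VV : Prop :=
  [/\ (0 < l)%N, is_cycle_shape (labels 0 l.+1 ++ dia_labels 1 l),
      dia (v 0%N) = v 0%N & dia (v l) = v l].

Definition is_VE : Prop :=
  is_cycle_shape (labels 0 l.+1 ++ dia_labels 1 l.+1) /\ dia (v 0%N) = v 0%N.

Definition is_EE : Prop :=
  (0 < l)%N /\ is_cycle_shape (labels 1 l.+1 ++ dia_labels 1 l.+1).

End Shapes.

End Quiver.
End Polarized.

(* An isomorphism of directed graphs compatible with the involutions; as each
   vertex i is the source of exactly one arrow, it is given on the vertices. *)
Definition quiver_isomorphic (k0 : fieldType) (k : fieldExtType k0)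
    (sigk : {rmorphism k -> k}) (n m : nat) (beta : k)
    (F F' : cyclic_algebra sigk n)
    (V : polarized_space m beta F) (V' : polarized_space m beta F')
    (xi : F) (xi' : F') (Q : quiver V xi) (Q' : quiver V' xi') : Prop :=
  exists f : Q -> Q',
    [/\ bijective f, forall i, f (xibar Q i) = xibar Q' (f i)
      & forall i, f (dia i) = dia (f i)].

(* Main.v *)
From HB Require Import structures.
From mathcomp Require Import all_boot all_order all_fingroup all_algebra.
From mathcomp Require Import all_field.
From mathcomp Require Import boolp zify ring.
From mathcomp Require classical_sets.
Require Import Defs.

Set Implicit Arguments.
Unset Strict Implicit.
Unset Printing Implicit Defensive.

Import GRing.Theory passmx.
Local Open Scope ring_scope.

(* The graph: the kernels of the projections L_beta -> L_i determine the
   vertices, and xibar and dia are read off on them from mu_xi and sigma_c,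
   which involve only Nm(xi) and Nm(c).

   A_beta is a separable algebra: averaging over a separability idempotent
   turns k0-linear maps into A_beta-linear ones. This gives the decomposition
   of V into the images of the maps ev u : M_i -> V, the double centralizer
   theorem for S_i and, over R, the components of the R-points of H. The form
   pairs the i-th part of V with the dia i-th one only, so the component of an
   isometry at dia i is determined by the one at i, and it is free unless
   i = dia i; likewise for the arrows i and dia (xibar i) of an element of
   g(xi). One lifts components from half of the quiver by taking adjoints.

   At a fixed arrow the antisymmetry of phi is an identity in D_i, of the form
   {x, psi y}' = s tau({y, psi x}') for an involution tau of D_i lying over
   sigma_{c xi^-1}. It is equivalent to its reduced trace since Trd o tau =
   sigma_{c xi^-1} o Trd and the trace form is nondegenerate. Both facts hold
   for any trace coming from a representation of degree r over an extension of
   L_i: it has a nonzero value, and it is unique because char_poly^r is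
   intrinsic. *)

(** Two obstacles shape the argument. An R-point of H is only a matrix commuting with operators
    defined over k0, so the commutant is computed over k0 by averaging and extended by linearity,
    and nondegeneracy passes to R through joint injectivity of families of k0-linear maps rather
    than through determinants. Likewise a reduced trace is known only through some representation
    over some extension of L_i, and the characteristic may divide its degree r. The trace of a
    multiplication operator on D_i is r times the reduced trace and may vanish identically, which is
    why characteristic polynomials replace it. Composing a representation with tau and transposing
    gives another one, whose structure map is twisted by sigma_{c xi^-1}; comparing the two traces
    is what makes Trd compatible with tau. The invertibility of 2 and of m / n is what allows an
    explicit separability idempotent. All uses of Schur's lemma go through the central idempotents
    of L_beta: a homomorphism between S_i and S_j with i != j is killed by them. *)

Lemma lfun_linfun (K : fieldType) (T W : vectType K) (f : T -> W) :
  linear f -> forall x, linfun f x = f x.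
Proof.
move=> fL x.
pose g : {linear T -> W} := HB.pack f (GRing.isLinear.Build K T W _ _ fL).
exact: (lfunE g).
Qed.

(** * Extension of scalars *)

Section Tens.
Variables (k0 : fieldType) (R : comAlgType k0).
Implicit Types M N P : vectType k0.

Lemma tens1_lin M (a : k0) (x y : M) :
  tens1 R (a *: x + y) = a%:A *: tens1 R x + tens1 R y.
Proof.
rewrite /tens1 linearP map_mxD map_mxZ /=.
by apply/matrixP=> i j; rewrite !mxE.
Qed.

Lemma tens10 M : tens1 R (0 : M) = 0.
Proof. by rewrite /tens1 linear0 map_mx0 trmx0. Qed.

Lemma tens1D M (x y : M) : tens1 R (x + y) = tens1 R x + tens1 R y.
Proof. by rewrite -{1}[x]scale1r tens1_lin !scale1r. Qed.

Lemma tens1_sum M I (r : seq I) (Q : pred I) (f : I -> M) :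
  tens1 R (\sum_(i <- r | Q i) f i) = \sum_(i <- r | Q i) tens1 R (f i).
Proof. exact: (big_morph _ (@tens1D M) (@tens10 M)). Qed.

Lemma tensf_lin M N (a : k0) (f g : 'Hom(M, N)) :
  tensf R (a *: f + g) = a%:A *: tensf R f + tensf R g.
Proof.
rewrite /tensf linearP map_mxD map_mxZ /=.
by apply/matrixP=> i j; rewrite !mxE.
Qed.

Lemma tensf0 M N : tensf R (0 : 'Hom(M, N)) = 0.
Proof. by rewrite /tensf linear0 map_mx0 trmx0. Qed.

Lemma tensfD M N (f g : 'Hom(M, N)) : tensf R (f + g) = tensf R f + tensf R g.
Proof. by rewrite -{1}[f]scale1r tensf_lin !scale1r. Qed.

Lemma tensf_sum M N I (r : seq I) (Q : pred I) (f : I -> 'Hom(M, N)) :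
  tensf R (\sum_(i <- r | Q i) f i) = \sum_(i <- r | Q i) tensf R (f i).
Proof. exact: (big_morph _ (@tensfD M N) (@tensf0 M N)). Qed.

Lemma tens1_col M (u : 'cV[R]_(\dim {:M})) :
  u = \sum_s u s 0 *: tens1 R (vbasis {:M})`_s.
Proof.
rewrite {1}(matrix_sum_delta u); apply: eq_bigr => s _.
by rewrite big_ord1 /tens1 rVofE ?vbasisP // map_delta_mx trmx_delta.
Qed.

Lemma tens_mx_ext M n (g h : 'M[R]_(n, \dim {:M})) :
  (forall x, g *m tens1 R x = h *m tens1 R x) -> g = h.
Proof.
move=> gh; suff gu (u : 'cV_(\dim {:M})) : g *m u = h *m u.
  apply/matrixP=> i j; have /matrixP/(_ i 0) := gu (delta_mx j 0).
  by rewrite -!colE !mxE.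
rewrite (tens1_col u) !mulmx_sumr; apply: eq_bigr => s _.
by rewrite -!scalemxAr gh.
Qed.

Lemma tensf_comp M N P (g : 'Hom(N, P)) (f : 'Hom(M, N)) :
  tensf R (g \o f)%VF = tensf R g *m tensf R f.
Proof.
by apply: tens_mx_ext => x; rewrite -mulmxA !tensfE lfunE.
Qed.

Lemma tensf1 M : tensf R (\1%VF : 'End(M)) = 1%:M.
Proof. by apply: tens_mx_ext => x; rewrite tensfE lfunE mul1mx. Qed.

Section LinExt.
Variables (M : vectType k0) (N : lmodType R).
Implicit Types (f : M -> N) (u : 'cV[R]_(\dim {:M})).

Lemma lin_ext_lin f (a : R) u v :
  lin_ext f (a *: u + v) = a *: lin_ext f u + lin_ext f v.
Proof.
rewrite /lin_ext scaler_sumr -big_split; apply: eq_bigr => s _ /=.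
by rewrite !mxE scalerDl scalerA.
Qed.

Lemma lin_ext_tens1 f :
  (forall (a : k0) x y, f (a *: x + y) = a%:A *: f x + f y) ->
  forall x, lin_ext f (tens1 R x) = f x.
Proof.
move=> fL x.
have f0 : f 0 = 0.
  by have := fL (-1) 0 0; rewrite scaler0 addr0 scaleN1r scaleN1r addNr.
have fD y z : f (y + z) = f y + f z.
  by rewrite -{1}[y]scale1r fL !scale1r.
have fZ a y : f (a *: y) = a%:A *: f y by rewrite -[a *: y]addr0 fL f0 addr0.
rewrite /lin_ext {2}(coord_vbasis (memvf x)) (big_morph _ fD f0).
by apply: eq_bigr => s _; rewrite fZ /tens1 !mxE.
Qed.

Lemma eq_lin_ext f g u : f =1 g -> lin_ext f u = lin_ext g u.
Proof. by move=> fg; apply: eq_bigr => s _; rewrite fg. Qed.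

End LinExt.

Definition bilin M N P (B : M -> N -> P) :=
  (forall y, linear (B^~ y)) /\ (forall x, linear (B x)).

Section PairingExt.
Variables (M N P : vectType k0) (B : M -> N -> P).

Lemma pairing_extE u v :
  pairing_ext (R := R) B u v =
  \sum_s \sum_t (u s 0 * v t 0) *:
     tens1 R (B (vbasis {:M})`_s (vbasis {:N})`_t).
Proof.
rewrite /pairing_ext /lin_ext; apply: eq_bigr => s _.
by rewrite scaler_sumr; apply: eq_bigr => t _; rewrite scalerA.
Qed.

Lemma pairing_ext_linl a u u' v :
  pairing_ext (R := R) B (a *: u + u') v =
  a *: pairing_ext B u v + pairing_ext B u' v.
Proof. exact: lin_ext_lin. Qed.

Lemma pairing_ext_linr a u v v' :
  pairing_ext (R := R) B u (a *: v + v') =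
  a *: pairing_ext B u v + pairing_ext B u v'.
Proof.
rewrite !pairing_extE scaler_sumr -big_split; apply: eq_bigr => s _ /=.
rewrite scaler_sumr -big_split; apply: eq_bigr => t _ /=.
by rewrite !mxE mulrDr scalerDl scalerA mulrCA.
Qed.

Lemma pairing_ext0l v : pairing_ext (R := R) B 0 v = 0.
Proof. by apply: big1 => s _; rewrite mxE scale0r. Qed.

Lemma pairing_ext0r u : pairing_ext (R := R) B u 0 = 0.
Proof.
by rewrite pairing_extE; apply: big1 => s _; apply: big1 => t _;
  rewrite mxE mulr0 scale0r.
Qed.

Lemma pairing_extDl u u' v :
  pairing_ext (R := R) B (u + u') v = pairing_ext B u v + pairing_ext B u' v.
Proof. by rewrite -{1}[u]scale1r pairing_ext_linl scale1r. Qed.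

Lemma pairing_extDr u v v' :
  pairing_ext (R := R) B u (v + v') = pairing_ext B u v + pairing_ext B u v'.
Proof. by rewrite -{1}[v]scale1r pairing_ext_linr scale1r. Qed.

Lemma pairing_extZl a u v :
  pairing_ext (R := R) B (a *: u) v = a *: pairing_ext B u v.
Proof. by rewrite -[a *: u]addr0 pairing_ext_linl pairing_ext0l addr0. Qed.

Lemma pairing_extZr a u v :
  pairing_ext (R := R) B u (a *: v) = a *: pairing_ext B u v.
Proof. by rewrite -[a *: v]addr0 pairing_ext_linr pairing_ext0r addr0. Qed.

Lemma pairing_extNl u v :
  pairing_ext (R := R) B (- u) v = - pairing_ext B u v.
Proof. by rewrite -scaleN1r pairing_extZl scaleN1r. Qed.

Lemma pairing_extNr u v :
  pairing_ext (R := R) B u (- v) = - pairing_ext B u v.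
Proof. by rewrite -scaleN1r pairing_extZr scaleN1r. Qed.

Lemma pairing_ext_suml I (r : seq I) (Q : pred I) f v :
  pairing_ext (R := R) B (\sum_(i <- r | Q i) f i) v =
  \sum_(i <- r | Q i) pairing_ext B (f i) v.
Proof.
by rewrite (big_morph (fun u => pairing_ext B u v)
  (fun u u' => pairing_extDl u u' v) (pairing_ext0l v)).
Qed.

Lemma pairing_ext_sumr I (r : seq I) (Q : pred I) u f :
  pairing_ext (R := R) B u (\sum_(i <- r | Q i) f i) =
  \sum_(i <- r | Q i) pairing_ext B u (f i).
Proof.
by rewrite (big_morph (fun v => pairing_ext B u v)
  (fun v v' => pairing_extDr u v v') (pairing_ext0r u)).
Qed.

Lemma pairing_ext_tens1 x y :
  bilin B -> pairing_ext (R := R) B (tens1 R x) (tens1 R y) = tens1 R (B x y).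
Proof.
move=> [Bl Br]; rewrite /pairing_ext.
rewrite (@eq_lin_ext _ _ _ (fun x' => tens1 R (B x' y))) => [|x'].
  by rewrite lin_ext_tens1 // => a x1 x2; rewrite Bl tens1_lin.
by rewrite lin_ext_tens1 // => a y1 y2; rewrite Br tens1_lin.
Qed.

End PairingExt.

Lemma tensf_pairing_ext M N P (B : M -> N -> P) P' (f : 'Hom(P, P')) u v :
  tensf R f *m pairing_ext B u v = pairing_ext (fun x y => f (B x y)) u v.
Proof.
rewrite (pairing_extE B) (pairing_extE (fun x y => f (B x y))) mulmx_sumr.
apply: eq_bigr => s _; rewrite mulmx_sumr; apply: eq_bigr => t _.
by rewrite -scalemxAr tensfE.
Qed.

Lemma pairing_ext_swap M N P (B : M -> N -> P) u v :
  pairing_ext (R := R) (fun y x => B x y) v u = pairing_ext B u v.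
Proof.
rewrite !pairing_extE [LHS]exchange_big; apply: eq_bigr => s _.
by apply: eq_bigr => t _; rewrite mulrC.
Qed.

Lemma eq_pairing_ext M N P (B B' : M -> N -> P) u v :
  B =2 B' -> pairing_ext (R := R) B u v = pairing_ext B' u v.
Proof.
move=> BB; rewrite !pairing_extE; apply: eq_bigr => s _; apply: eq_bigr => t _.
by rewrite BB.
Qed.

Lemma tens_bilin_ext M N p (f g : 'cV[R]_(\dim {:M}) -> 'cV[R]_(\dim {:N}) -> 'cV[R]_p) :
  (forall v, linear (f^~ v)) -> (forall u, linear (f u)) ->
  (forall v, linear (g^~ v)) -> (forall u, linear (g u)) ->
  (forall x y, f (tens1 R x) (tens1 R y) = g (tens1 R x) (tens1 R y)) ->
  f =2 g.
Proof.
move=> fl fr gl gr fg u v.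
have sumE m' (h : 'cV[R]_m' -> 'cV[R]_p) (hL : linear h) I (r : seq I) (c : I -> R) w :
    h (\sum_(i <- r) c i *: w i) = \sum_(i <- r) c i *: h (w i).
  have h0 : h 0 = 0.
    by have := hL (-1) 0 0; rewrite scaler0 addr0 scaleN1r addNr.
  elim: r => [|i r IH]; first by rewrite !big_nil.
  by rewrite !big_cons hL IH.
rewrite (tens1_col u) (tens1_col v).
rewrite (sumE _ _ (fl _)) (sumE _ _ (gl _)); apply: eq_bigr => s _.
congr (_ *: _); rewrite (sumE _ _ (fr _)) (sumE _ _ (gr _)).
by apply: eq_bigr => t _; rewrite fg.
Qed.

Lemma pairing_ext_comp M M' N N' P (B : M -> N -> P) (f : 'Hom(M', M))
    (h : 'Hom(N', N)) u v : bilin B ->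
  pairing_ext (R := R) B (tensf R f *m u) (tensf R h *m v) =
  pairing_ext (fun x y => B (f x) (h y)) u v.
Proof.
move=> [Bl Br].
apply: (@tens_bilin_ext _ _ _
  (fun u v => pairing_ext B (tensf R f *m u) (tensf R h *m v))
  (pairing_ext (fun x y => B (f x) (h y)))).
- by move=> v' a u' u''; rewrite mulmxDr -scalemxAr pairing_ext_linl.
- by move=> u' a v' v''; rewrite mulmxDr -scalemxAr pairing_ext_linr.
- by move=> v' a u' u''; rewrite pairing_ext_linl.
- by move=> u' a v' v''; rewrite pairing_ext_linr.
move=> x y; rewrite !tensfE !pairing_ext_tens1 //.
by split=> [y'|x'] a x1 x2; rewrite linearP ?Bl ?Br.
Qed.

Lemma pairing_ext_compl M M' N P (B : M -> N -> P) (f : 'Hom(M', M)) u v :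
  bilin B ->
  pairing_ext (R := R) B (tensf R f *m u) v =
  pairing_ext (fun x y => B (f x) y) u v.
Proof.
move=> Bb; rewrite -{1}[v]mul1mx -tensf1 pairing_ext_comp //.
by apply: eq_pairing_ext => x y; rewrite lfunE.
Qed.

Lemma pairing_ext_compr M N N' P (B : M -> N -> P) (h : 'Hom(N', N)) u v :
  bilin B ->
  pairing_ext (R := R) B u (tensf R h *m v) =
  pairing_ext (fun x y => B x (h y)) u v.
Proof.
move=> Bb; rewrite -{1}[u]mul1mx -tensf1 pairing_ext_comp //.
by apply: eq_pairing_ext => x y; rewrite lfunE.
Qed.

(* The rows over k0 that annihilate w form a subspace; a proper one would be
   annihilated by some x != 0, against joint injectivity over k0. *)
Lemma tens_joint_inj (T : Type) M N (kap : T -> 'Hom(M, N)) :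
  (forall x, (forall a, kap a x = 0) -> x = 0) ->
  forall w : 'cV[R]_(\dim {:M}), (forall a, tensf R (kap a) *m w = 0) -> w = 0.
Proof.
move=> kinj w kw.
pose Pr (r : 'rV[k0]_(\dim {:M})) := map_mx (in_alg R) r *m w = 0.
have UP : forall r, r \in vspace_of Pr <-> Pr r.
  apply: vspace_ofP => [|a r s]; rewrite /Pr; first by rewrite map_mx0 mul0mx.
  move=> r0 s0; rewrite map_mxD map_mxZ /= mulmxDl s0 addr0.
  by rewrite -scalemxAl r0 scaler0.
set U := vspace_of Pr in UP.
pose G : 'M[k0]_(\dim U, \dim {:M}) := \matrix_i ((vbasis U)`_i).
have inU r : r \in U -> exists c, r = c *m G.
  move=> /coord_vbasis rE; exists (\row_i coord (vbasis U) i r).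
  rewrite {1}rE mulmx_sum_row; apply: eq_bigr => i _.
  by rewrite mxE rowK.
have GM a : exists C, (mxof (vbasis {:M}) (vbasis {:N}) (kap a))^T = C *m G.
  have rU i : row i (mxof (vbasis {:M}) (vbasis {:N}) (kap a))^T \in U.
    apply/UP; rewrite /Pr map_row -row_mul -map_trmx.
    by have := kw a; rewrite /tensf => ->; rewrite row0.
  have /fin_all_exists[c cE] i := inU _ (rU i).
  exists (\matrix_i c i); apply/row_matrixP=> i.
  by rewrite row_mul rowK -cE.
(* A column of [cokermx G] holds the coordinates of a vector killed by every [kap a], since the rows
   of the matrix of [kap a] lie in [U]. Hence it is 0, and the rows in [U] span everything,
   including those of the identity. *)
have coker0 : cokermx G = 0.
  apply/matrixP=> s t; rewrite [RHS]mxE.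
  pose c := col t (cokermx G).
  suff x0 : vecof (vbasis {:M}) c^T = 0.
    have : rVof (vbasis {:M}) (vecof (vbasis {:M}) c^T) = 0 by rewrite x0 linear0.
    rewrite vecofK ?vbasisP // => /matrixP/(_ 0 s).
    by rewrite !mxE.
  apply: kinj => a; apply: (can_inj (rVofK (vbasisP {:N}))).
  rewrite linear0 -mul_mxof; have [C CE] := GM a.
  rewrite -[LHS]trmxK trmx_mul trmxK CE -mulmxA /c colE (mulmxA G) mulmx_coker.
  by rewrite mul0mx mulmx0 trmx0.
have /submxP[A AE] : (1%:M <= G)%MS by rewrite sub1mx -cokermx_eq0 coker0.
have Gw : map_mx (in_alg R) G *m w = 0.
  apply/row_matrixP=> i; rewrite row_mul row0 -map_row rowK.
  by apply/UP/vbasis_mem/mem_nth; rewrite size_tuple.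
by rewrite -[w]mul1mx -(map_mx1 (in_alg R)) AE map_mxM -mulmxA Gw mulmx0.
Qed.

End Tens.

(** * The cyclic algebra F *)

(* Dedekind: a shortest relation, multiplied by chi a - chi i a, gets shorter. *)
Lemma characters_independent (A : nzRingType) (E : fieldType) (n : nat)
    (chi : 'I_n -> A -> E) (c : 'I_n -> E) :
  (forall i, chi i 1 = 1) -> (forall i a b, chi i (a * b) = chi i a * chi i b) ->
  (forall i j, i != j -> exists a, chi i a != chi j a) ->
  (forall a, \sum_i c i * chi i a = 0) -> forall i, c i = 0.
Proof.
move=> chi1 chiM chiD; have [N] := ubnP #|[set i | c i != 0]|.
elim: N c => // N IH c leN rel i; have [//|ci0] := eqVneq (c i) 0.
have [j /andP[ji cj0]|c0] := pickP [pred j | (j != i) && (c j != 0)]; last first.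
  have := rel 1; rewrite (bigD1 i) //= big1 ?addr0 ?chi1 ?mulr1 // => j ji.
  by have := c0 j; rewrite /= ji /= => /negbFE/eqP->; rewrite mul0r.
have [a chia] := chiD _ _ ji.
suff /(_ j)/eqP cj : forall l, c l * (chi l a - chi i a) = 0.
  by move: cj; rewrite mulf_eq0 (negPf cj0) subr_eq0 (negPf chia).
apply: IH => [|b].
  rewrite -ltnS; apply: leq_trans leN; rewrite ltnS; apply: proper_card.
  apply/properP; split; last by exists i; rewrite !inE ?subrr ?mulr0 ?eqxx.
  by apply/subsetP=> l; rewrite !inE; apply: contra_neq => ->; rewrite mul0r.
transitivity (\sum_l c l * chi l (a * b) - chi i a * \sum_l c l * chi l b).
  rewrite mulr_sumr -sumrB.
  apply: eq_bigr => l _.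
  by rewrite chiM mulrBr mulrBl !mulrA [chi i a * c l]mulrC.
by rewrite !rel mulr0 subrr.
Qed.

Section Cyc.
Variables (k0 : fieldType) (k : fieldExtType k0) (sigk : {rmorphism k -> k}).
Variables (n : nat) (F : cyclic_algebra sigk n).
Local Notation iota := (cyc_iota F).
Implicit Types (a b : F) (x y : k).

Lemma iota_inj : injective iota.
Proof. exact: fmorph_inj. Qed.

Lemma iota_alg (c : k0) : iota c%:A = c%:A.
Proof. exact: rmorph_alg. Qed.

Lemma zeta_iota x : zeta F (iota x) = iota x.
Proof. by apply/zeta_fixed; exists x. Qed.

Lemma sigk_alg (c : k0) : sigk c%:A = c%:A.
Proof. by apply/(sigk_fixed F)/vlineP; exists c. Qed.

Lemma sigma_alg (c : k0) : sigma F c%:A = c%:A.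
Proof. by rewrite -iota_alg sigma_iota sigk_alg. Qed.

Lemma sigmaZ (c : k0) a : sigma F (c *: a) = c *: sigma F a.
Proof. by rewrite -mulr_algl rmorphM sigma_alg mulr_algl. Qed.

Definition zt (j : nat) (a : F) : F := iter j (zeta F) a.

Lemma zt_is_zmod_morphism j : zmod_morphism (zt j).
Proof. by move=> a b; elim: j => //= j ->; rewrite rmorphB. Qed.
Lemma zt_is_monoid_morphism j : monoid_morphism (zt j).
Proof.
split; first by elim: j => //= j ->; rewrite rmorph1.
by move=> a b; elim: j => //= j ->; rewrite rmorphM.
Qed.
HB.instance Definition _ j :=
  GRing.isZmodMorphism.Build F F (zt j) (zt_is_zmod_morphism j).
HB.instance Definition _ j :=
  GRing.isMonoidMorphism.Build F F (zt j) (zt_is_monoid_morphism j).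

Lemma ztD i j a : zt (i + j) a = zt i (zt j a).
Proof. by rewrite /zt iterD. Qed.

Lemma ztn a : zt n a = a.
Proof. exact: (proj2 (zeta_order F n) (dvdnn n)). Qed.

Lemma zt_dvd j a : (n %| j)%N -> zt j a = a.
Proof. by move=> nj; exact: (proj2 (zeta_order F j) nj). Qed.

Lemma zt_iota j x : zt j (iota x) = iota x.
Proof. by elim: j => //= j ->; rewrite zeta_iota. Qed.

Lemma zt_alg j (c : k0) : zt j c%:A = c%:A.
Proof. by rewrite -iota_alg zt_iota. Qed.

Lemma ztZ j (c : k0) a : zt j (c *: a) = c *: zt j a.
Proof. by rewrite -mulr_algl rmorphM /= zt_alg mulr_algl. Qed.

Lemma sigma_zt j a : sigma F (zt j a) = zt j (sigma F a).
Proof. by elim: j => //= j <-; rewrite sigma_zeta. Qed.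

Lemma zeta_prod a : zeta F (\prod_(j < n) zt j a) = \prod_(j < n) zt j a.
Proof.
suff h N : (0 < N)%N -> zt N a = a ->
    zeta F (\prod_(j < N) zt j a) = \prod_(j < N) zt j a.
  exact: (h n (n_gt0 F) (ztn a)).
case: N => // N _ aN.
rewrite rmorph_prod big_ord_recr /= [zeta F (zt N a)]aN cyc_comm.
by rewrite big_ord_recl /=; congr (_ * _).
Qed.

Lemma zeta_sum a : zeta F (\sum_(j < n) zt j a) = \sum_(j < n) zt j a.
Proof.
suff h N : (0 < N)%N -> zt N a = a ->
    zeta F (\sum_(j < N) zt j a) = \sum_(j < N) zt j a.
  exact: (h n (n_gt0 F) (ztn a)).
case: N => // N _ aN.
rewrite rmorph_sum big_ord_recr /= [zeta F (zt N a)]aN addrC.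
by rewrite big_ord_recl /=; congr (_ + _).
Qed.

Lemma NmE a : iota (Nm a) = \prod_(j < n) zt j a.
Proof.
have [x xE] : exists x, \prod_(j < n) zt j a = iota x.
  by apply/zeta_fixed/zeta_prod.
exact: (@classical_sets.xgetPex _ 0 (fun x : k => iota x = _) (ex_intro _ x (esym xE))).
Qed.

Definition Tr a : k := classical_sets.xget 0 (fun x : k => iota x = \sum_(j < n) zt j a).

Lemma TrE a : iota (Tr a) = \sum_(j < n) zt j a.
Proof.
have [x xE] : exists x, \sum_(j < n) zt j a = iota x.
  by apply/zeta_fixed/zeta_sum.
exact: (@classical_sets.xgetPex _ 0 (fun x : k => iota x = _) (ex_intro _ x (esym xE))).
Qed.

Lemma TrD a b : Tr (a + b) = Tr a + Tr b.
Proof.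
apply: iota_inj; rewrite rmorphD /= !TrE -big_split.
by apply: eq_bigr => j _; rewrite rmorphD.
Qed.

Lemma TrZ x a : Tr (iota x * a) = x * Tr a.
Proof.
apply: iota_inj; rewrite rmorphM /= !TrE mulr_sumr.
by apply: eq_bigr => j _; rewrite rmorphM /= zt_iota.
Qed.

Lemma NmM a b : Nm (a * b) = Nm a * Nm b.
Proof.
apply: iota_inj; rewrite rmorphM /= !NmE.
suff h N : \prod_(j < N) zt j (a * b) =
    (\prod_(j < N) zt j a) * (\prod_(j < N) zt j b) by exact: h.
elim: N => [|N IH]; first by rewrite !big_ord0 mulr1.
rewrite !big_ord_recr /= IH rmorphM !mulrA; congr (_ * _).
by rewrite -!mulrA; congr (_ * _); rewrite cyc_comm.
Qed.

Lemma Nm1 : Nm (1 : F) = 1.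
Proof.
by apply: iota_inj; rewrite NmE rmorph1 big1 // => j _; rewrite rmorph1.
Qed.

Lemma Nm_neq0 a : a \is a GRing.unit -> Nm a != 0.
Proof.
move=> aU; apply/eqP=> Na0; have := Nm1; rewrite -(mulrV aU) NmM Na0 mul0r.
by move/esym/eqP; rewrite oner_eq0.
Qed.

Lemma NmV a : a \is a GRing.unit -> Nm a^-1 = (Nm a)^-1.
Proof.
move=> aU; apply: (mulfI (Nm_neq0 aU)).
by rewrite -NmM mulrV // Nm1 mulfV ?Nm_neq0.
Qed.

Lemma galois_system : exists (T : finType) (x y : T -> F),
  forall t, (t < n)%N -> \sum_i x i * zt t (y i) = (t == 0%N)%:R.
Proof.
have [J [E [pr [_ prk prE]]]] := cyc_separable F.
have pr_eq a b : (forall j, pr j a = pr j b) -> a = b.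
  move=> ab; have [c [_ cU]] := prE (fun j => pr j b).
  by rewrite -(cU a) // (cU b).
have lift j (v : E j) : exists a, pr j a = v /\ forall i, i != j -> pr i a = 0.
  have [a [aE _]] := prE (dfwith (fun i => 0 : E i) v).
  by exists a; split=> [|i ij]; rewrite aE ?dfwith_in // dfwith_out // eq_sym.
have sep j (t1 t2 : 'I_n) : t1 != t2 -> exists a, pr j (zt t1 a) != pr j (zt t2 a).
  wlog lt12 : t1 t2 / (t1 < t2)%N => [hw ne|ne].
    have [/hw/(_ ne)//|/hw h|e] := ltngtP t1 t2.
      by have [|a] := h; [rewrite eq_sym | exists a; rewrite eq_sym].
    by move/val_inj: e ne => ->; rewrite eqxx.
  apply: contrapT => nex.
  have eq12 a : pr j (zt t1 a) = pr j (zt t2 a).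
    by apply: contrapT => /eqP ab; apply: nex; exists a.
  pose d := (t2 - t1)%N; have [e [ej ei]] := lift j 1.
  have zd a : zt d a = a.
    apply/eqP; rewrite -subr_eq0; set u := _ - a.
    have pu t : pr j (zt t u) = 0.
      have := eq12 (zt (n - t1 + t) a); rewrite -!ztD.
      have -> : (t1 + (n - t1 + t) = t + n)%N by move: (ltn_ord t1); lia.
      have -> : (t2 + (n - t1 + t) = t + (d + n))%N.
        by rewrite /d; move: (ltn_ord t1) lt12; lia.
      by rewrite /u !ztD ztn !rmorphB => ->; rewrite subrr.
    (* The product of the translates of [1 - e] is invariant, hence a scalar, and its component at j
       is 0, so it vanishes: [zeta] permutes the factors transitively. But [u] is killed by all
       translates of [e], so it equals [u * s]. *)
    pose s := \prod_(t < n) (zt t (1 - e)).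
    have us : u * s = u.
      rewrite /s; elim/big_rec: _ => [|t b _ IH]; first by rewrite mulr1.
      suff ue : u * zt t e = 0 by rewrite mulrA rmorphB rmorph1 mulrBr mulr1 ue subr0.
      have -> : u = zt t (zt (n - t) u) by rewrite -ztD subnKC ?ztn // ltnW.
      rewrite -rmorphM -(rmorph0 (zt t)); congr (zt t _).
      apply: pr_eq => i; rewrite rmorphM rmorph0.
      by have [->|/ei->] := eqVneq i j; rewrite ?pu ?mul0r ?mulr0.
    have [z sE] : exists z, s = iota z by apply/zeta_fixed/zeta_prod.
    have z0 : z = 0.
      apply: (fmorph_inj (in_alg (E j))); rewrite rmorph0 /= -(prk j) -sE.
      rewrite /s rmorph_prod; move: (n_gt0 F) => n0.
      rewrite (bigD1 (Ordinal n0)) //= rmorphB rmorph1 ej subrr mul0r //.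
    by rewrite -us sE z0 rmorph0 mulr0.
  have : (n %| d)%N by exact: (proj1 (zeta_order F d) zd).
  rewrite gtnNdvd ?subn_gt0 //.
  by rewrite (leq_ltn_trans _ (ltn_ord t2)) // leq_subr.
have sys j : exists e (x : 'I_(\dim {:F}) -> F),
    (pr j e = 1 /\ forall i, i != j -> pr i e = 0) /\
    forall t, (t < n)%N ->
      \sum_s x s * zt t (vbasis {:F})`_s = (t == 0%N)%:R * e.
  (* The rows are the values of the n characters on a basis of F. Their independence gives a right
     inverse [X], and its column at t = 0 is the required family, lifted to F with support in the
     factor j. *)
  pose Mx := \matrix_(t < n, s < \dim {:F}) pr j (zt t (vbasis {:F})`_s).
  have /row_freeP[X XE] : row_free Mx.
    apply: inj_row_free => v vM; apply/rowP=> t; rewrite [RHS]mxE.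
    apply: (@characters_independent F _ _ (fun t a => pr j (zt t a)) (v 0)).
    - by move=> i; rewrite !rmorph1.
    - by move=> i a b; rewrite !rmorphM.
    - exact: sep.
    move=> a; rewrite (coord_vbasis (memvf a)).
    under eq_bigr => i _.
      rewrite !rmorph_sum mulr_sumr.
      under eq_bigr => s _.
        rewrite /= ztZ -mulr_algl -iota_alg rmorphM prk mulrCA.
      over.
    over.
    rewrite exchange_big big1 //= => s _; rewrite -mulr_sumr.
    move/rowP/(_ s): vM; rewrite !mxE.
    by under eq_bigr => i _ do rewrite mxE; move=> ->; rewrite mulr0.
  have [e eP] := lift j 1; exists e.
  have /fin_all_exists[x xP] s := lift j (X s (Ordinal (n_gt0 F))).
  exists x; split=> // t tn; apply: pr_eq => i.
  rewrite rmorphM rmorph_nat rmorph_sum.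
  have [->|ij] := eqVneq i j; last first.
    by rewrite eP.2 // mulr0 big1 // => s _; rewrite rmorphM (xP s).2 // mul0r.
  have /matrixP/(_ (Ordinal tn) (Ordinal (n_gt0 F))) := XE.
  rewrite eP.1 !mxE mulr1 => <-; apply: eq_bigr => s _.
  by rewrite rmorphM (xP s).1 !mxE mulrC.
have /fin_all_exists[e eP'] := sys.
have /fin_all_exists[x eP] := eP'.
exists (J * 'I_(\dim {:F}))%type, (fun i : J * 'I_(\dim {:F}) => x i.1 i.2),
  (fun i : J * 'I_(\dim {:F}) => (vbasis {:F})`_i.2).
move=> t tn.
rewrite -(pair_big predT predT (fun j s => x j s * zt t (vbasis {:F})`_s)) /=.
rewrite (eq_bigr (fun j => (t == 0%N)%:R * e j)); last by move=> j _; rewrite (eP j).2.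
rewrite -mulr_sumr; suff -> : \sum_j e j = 1 by rewrite mulr1.
apply: pr_eq => i; rewrite rmorph1 rmorph_sum (bigD1 i) //= (eP i).1.1.
rewrite big1 ?addr0 // => j ji; have [[_ ->]//] := eP j.
by rewrite eq_sym.
Qed.

(** Expanding the trace and exchanging the sums makes the Galois system isolate the term j = 0: the
    families [x] and [y] are dual for the trace form of F over k. *)
Lemma trace_dual : exists (T : finType) (x y : T -> F),
  (forall t, (t < n)%N -> \sum_i x i * zt t (y i) = (t == 0%N)%:R) /\
  forall c, \sum_i x i * iota (Tr (y i * c)) = c.
Proof.
have [T [x [y xy]]] := galois_system; exists T, x, y; split=> // c.
transitivity (\sum_(j < n) (\sum_i x i * zt j (y i)) * zt j c).
  under eq_bigr => i _ do rewrite TrE mulr_sumr.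
  rewrite exchange_big; apply: eq_bigr => j _; rewrite mulr_suml.
  by apply: eq_bigr => i _; rewrite rmorphM mulrA.
under eq_bigr => j _ do rewrite xy //.
rewrite (bigD1 (Ordinal (n_gt0 F))) //= mul1r big1 ?addr0 // => j j0.
by rewrite (_ : (j == 0%N :> nat) = false) ?mul0r //; apply/negbTE.
Qed.

Lemma Tr_nondeg c : (forall a, Tr (a * c) = 0) -> c = 0.
Proof.
move=> Tc; have [T [x [y [_ xy]]]] := trace_dual.
by rewrite -(xy c) big1 // => i _; rewrite Tc rmorph0 mulr0.
Qed.

Lemma trace_one : exists t : F, Tr t = 1.
Proof.
have [[a Ta]|Tr0] := pselect (exists a, Tr a <> 0).
  exists (iota (Tr a)^-1 * a); rewrite TrZ mulVf //; exact/eqP.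
have /eqP : (1 : F) = 0.
  apply: Tr_nondeg => a; apply: contrapT => Ta; apply: Tr0; exists a.
  by rewrite mulr1 in Ta.
by rewrite oner_eq0.
Qed.

(** A k0-linear form on F whose kernel contains no nonzero ideal, namely one coordinate of the
    trace. It reduces dualities over F, which need not be a field, to dimension counts over k0. *)
Lemma frobenius_form : exists lam : 'Hom(F, k0^o),
  forall c, (forall a, lam (a * c) = 0) -> c = 0.
Proof.
have k1 : (0 < \dim {:k})%N.
  by rewrite lt0n dimv_eq0; apply/eqP=> k00; have /eqP := memvf (1 : k);
     rewrite k00 memv0 oner_eq0.
pose i0 := Ordinal k1; pose kap (x : k) : k0^o := coord (vbasis {:k}) i0 x.
have lamL : linear (fun a : F => kap (Tr a)).
  move=> c a b; rewrite /kap TrD -mulr_algl -iota_alg TrZ mulr_algl.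
  by rewrite linearP.
exists (linfun (fun a : F => kap (Tr a))) => c c0.
apply: Tr_nondeg => a; apply/eqP/negPn/negP => Ta.
pose z := (vbasis {:k})`_i0.
have := c0 (iota (z / Tr (a * c)) * a).
rewrite lfun_linfun // -mulrA TrZ divfK // /kap /z coord_free ?eqxx.
  by move/eqP; rewrite oner_eq0.
exact/basis_free/vbasisP.
Qed.

(** An element [d] with [sigk d = - d] exists unless [sigk] is trivial, in which case k = k0 and
    [d = 1]. Both cases are thus covered by the same formulas. *)
Lemma k_quadratic : exists d : k, [/\ d != 0, exists c : k0, d * d = c%:A
  & forall x, exists a b : k0, x = a%:A + b%:A * d].
Proof.
have fixedE x : sigk x = x -> exists a : k0, x = a%:A.
  by move/(sigk_fixed F)/vlineP.
have two0 := char_neq2 F.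
have [[x sx]|sid] := pselect (exists x, sigk x <> x); last first.
  exists 1; split; [exact: oner_neq0 | by exists 1; rewrite scale1r mulr1 |].
  move=> x; have [|a ->] := fixedE x.
    by apply: contrapT => sx; apply: sid; exists x.
  by exists a, 0; rewrite scale0r mul0r addr0.
pose d := x - sigk x; have sd : sigk d = - d.
  by rewrite rmorphB (sigkK F) opprB.
have d0 : d != 0 by rewrite subr_eq0 eq_sym; apply/eqP.
exists d; split=> // [|y].
  by apply: fixedE; rewrite rmorphM sd mulrNN.
have [|a aE] := fixedE ((y + sigk y) / 2%:R).
  by rewrite fmorph_div rmorph_nat rmorphD (sigkK F) addrC.
have [|b bE] := fixedE ((y - sigk y) / 2%:R / d).
  rewrite !fmorph_div rmorph_nat rmorphB (sigkK F) sd invrN mulrN.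
  by rewrite -mulNr -mulNr opprB.
exists a, b; rewrite -aE -bE divfK // -mulrDl addrACA subrr addr0 -mulr2n.
by rewrite -[y *+ 2]mulr_natr mulfK.
Qed.

End Cyc.

(** * Modules over A_beta *)

Section Modules.
Variables (k0 : fieldType) (k : fieldExtType k0) (sigk : {rmorphism k -> k}).
Variables (n m : nat) (beta : k) (F : cyclic_algebra sigk n).
Local Notation iota := (cyc_iota F).
Local Notation isA := (is_Abeta_module m beta).
Implicit Types (a b : F) (x y : k).

Section OneModule.
Variables (U : theta_module F) (AU : isA U).
Implicit Types (u : U).

Lemma act1 u : tm_act U 1 u = u. Proof. by case: AU. Qed.
Lemma actD a b u : tm_act U (a + b) u = tm_act U a u + tm_act U b u.
Proof. by case: AU. Qed.
Lemma actM a b u : tm_act U (a * b) u = tm_act U a (tm_act U b u).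
Proof. by case: AU. Qed.
Lemma actA (c : k0) u : tm_act U c%:A u = c *: u.
Proof. by case: AU. Qed.
Lemma theta_act a u : theta U (tm_act U a u) = tm_act U (zeta F a) (theta U u).
Proof. by case: AU => _ _ _ _ []. Qed.
Lemma theta_m u : iter m (theta U) u = tm_act U (iota beta) u.
Proof. by case: AU => _ _ _ _ []. Qed.

Lemma act0 u : tm_act U 0 u = 0.
Proof. by apply: (addrI (tm_act U 0 u)); rewrite -actD !addr0. Qed.
Lemma actN a u : tm_act U (- a) u = - tm_act U a u.
Proof. by apply: (addrI (tm_act U a u)); rewrite -actD !subrr act0. Qed.
Lemma actC a b u : tm_act U a (tm_act U b u) = tm_act U b (tm_act U a u).
Proof. by rewrite -!actM cyc_comm. Qed.
Lemma act_sum I (r : seq I) (Q : pred I) (f : I -> F) u :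
  tm_act U (\sum_(i <- r | Q i) f i) u = \sum_(i <- r | Q i) tm_act U (f i) u.
Proof. exact: (big_morph (fun a => tm_act U a u) (fun a b => actD a b u) (act0 u)). Qed.

Lemma act_unitVK a u : a \is a GRing.unit -> tm_act U a^-1 (tm_act U a u) = u.
Proof. by move=> aU; rewrite -actM mulVr ?act1. Qed.

Lemma iter_theta_act j a u :
  iter j (theta U) (tm_act U a u) = tm_act U (zt j a) (iter j (theta U) u).
Proof. by elim: j => //= j ->; rewrite theta_act. Qed.

Lemma iter_theta_linear j : linear (iter j (theta U)).
Proof. by move=> c u v; elim: j => //= j ->; rewrite linearP. Qed.

Lemma iter_theta0 j : iter j (theta U) 0 = 0.
Proof. by elim: j => //= j ->; rewrite linear0. Qed.

Lemma iter_thetaD j u v :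
  iter j (theta U) (u + v) = iter j (theta U) u + iter j (theta U) v.
Proof. by rewrite -{1}[u]scale1r iter_theta_linear scale1r. Qed.

Lemma iter_theta_sum j I (r : seq I) (Q : pred I) (f : I -> U) :
  iter j (theta U) (\sum_(i <- r | Q i) f i) =
  \sum_(i <- r | Q i) iter j (theta U) (f i).
Proof. exact: (big_morph _ (iter_thetaD j) (iter_theta0 j)). Qed.

(** A pair (a, j) stands for the monomial a theta^j. The ring A_beta is not constructed; its
    elements appear only through such operators and through polynomials. *)
Definition op (w : F * nat) : 'End(U) :=
  (tm_act U w.1 \o linfun (iter w.2 (theta U)))%VF.

Lemma opE w u : op w u = tm_act U w.1 (iter w.2 (theta U) u).
Proof. by rewrite lfunE /= lfun_linfun //; apply: iter_theta_linear. Qed.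

End OneModule.

Definition avg (s : seq ((F * nat) * (F * nat))) (U W : theta_module F)
    (p : 'Hom(U, W)) : 'Hom(U, W) :=
  (\sum_(w <- s) (op W w.1 \o (p \o op U w.2)))%VF.

Implicit Types (U W : theta_module F).
Hypotheses (Hnm : (n %| m)%N) (Hinv : ((m %/ n)%:R : k) != 0)
  (Hb : beta != 0).

Lemma m_gt0 : (0 < m)%N.
Proof.
by rewrite lt0n; apply: contraNneq Hinv => ->; rewrite div0n.
Qed.

Lemma sum_zt a : \sum_(j < m) zt j a = iota ((m %/ n)%:R * Tr a).
Proof.
rewrite rmorphM rmorph_nat /= TrE mulr_natl.
suff h q : \sum_(j < q * n) zt j a = (\sum_(j < n) zt j a) *+ q.
  by rewrite -h divnK.
elim: q => [|q IH]; first by rewrite mul0n big_ord0.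
rewrite mulrSr -IH mulSn addnC big_split_ord /=; congr (_ + _).
by apply: eq_bigr => j _; rewrite addnC ztD (zt_dvd a (dvdn_mull q (dvdnn n))).
Qed.

(* A_beta is a separable algebra: the average of a k0-linear map p over a
   separability idempotent, which combines k / k0, F / k and the powers of
   theta twisted by an element t of trace 1. *)
Lemma separability : exists s : seq ((F * nat) * (F * nat)),
  (forall U W : theta_module F, isA U -> isA W ->
     forall p : 'Hom(U, W), Abeta_hom (avg s p)) /\
  (forall U : theta_module F, isA U ->
     forall u : U, \sum_(w <- s) op U w.1 (op U w.2 u) = u).
Proof.
have [T [x [y [xy0 xy]]]] := trace_dual F.
have [t Tt] := trace_one F.
have [d [d0 [c dd] kd]] := k_quadratic F.
have two0 := char_neq2 F.
(* Half of 1 (x) 1 + d (x) d^-1, a separability idempotent of k over k0; for d = 1 it reduces to 1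
   (x) 1. *)
pose e (b : bool) : k := if b then 2%:R^-1 * d else 2%:R^-1.
pose e' (b : bool) : k := if b then d^-1 else 1.
(* The exponents j and m - j replace j and - j, so that theta^j theta^(m-j) contributes [beta]; the
   m translates of [t] add up to m / n times its trace 1. [kap] removes both factors. *)
pose kap := ((m %/ n)%:R * beta)^-1.
pose w (i : T * bool * 'I_m) : (F * nat) * (F * nat) :=
  ((iota kap * zt i.2 (t * x i.1.1 * iota (e i.1.2)), i.2 : nat),
   (iota (e' i.1.2) * y i.1.1, (m - i.2)%N)).
have xyC a : \sum_i x i * iota (Tr (y i * a)) = a by exact: xy.
exists [seq w i | i <- enum {: T * bool * 'I_m}].
pose Pk (U W : theta_module F) (p : 'Hom(U, W)) (u : U) : W :=
  \sum_b tm_act W (iota (e b)) (p (tm_act U (iota (e' b)) u)).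
pose P (U W : theta_module F) (p : 'Hom(U, W)) (u : U) : W :=
  tm_act W t (\sum_i tm_act W (x i) (Pk U W p (tm_act U (y i) u))).
have sumE (U W : theta_module F) (p : 'Hom(U, W)) u : isA U -> isA W ->
    \sum_(v <- [seq w i | i <- enum {: T * bool * 'I_m}])
      op W v.1 (p (op U v.2 u)) =
    tm_act W (iota kap) (\sum_(j < m)
      iter j (theta W) (P U W p (iter (m - j) (theta U) u))).
  move=> AU AW; rewrite big_map big_enum /=.
  rewrite linear_sum /=.
  rewrite -(pair_big predT predT (fun (i : T * bool) (j : 'I_m) => op W (w (i, j)).1 (p (op U (w (i, j)).2 u)))) /=.
  rewrite exchange_big; apply: eq_bigr => j _ /=.
  rewrite -(pair_big predT predT (fun (i : T) (b : bool) => op W (w ((i, b), j)).1 (p (op U (w ((i, b), j)).2 u)))) /=.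
  rewrite /P linear_sum iter_theta_sum linear_sum; apply: eq_bigr => i _ /=.
  rewrite /Pk !linear_sum iter_theta_sum linear_sum; apply: eq_bigr => b _ /=.
  rewrite !opE /=.
  by rewrite (actM AU) -!(actM AW) (iter_theta_act AW) -(actM AW).
have PkL (U W : theta_module F) (p : 'Hom(U, W)) z u : isA U -> isA W ->
    Pk U W p (tm_act U (iota z) u) = tm_act W (iota z) (Pk U W p u).
  move=> AU AW.
  have PkA (a : k0) v :
      Pk U W p (tm_act U (iota a%:A) v) = tm_act W (iota a%:A) (Pk U W p v).
    rewrite !iota_alg (actA AU) (actA AW) /Pk scaler_sumr.
    by apply: eq_bigr => b _; rewrite !linearZ.
  have Pkd v : Pk U W p (tm_act U (iota d) v) = tm_act W (iota d) (Pk U W p v).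
    rewrite /Pk !big_bool /= rmorph1 !(act1 AU) -(actM AU) -rmorphM mulVf //.
    rewrite rmorph1 (act1 AU) linearD /= addrC -!(actM AW) -!rmorphM /=.
    rewrite [d * (_ * d)]mulrCA dd (mulrC d); congr (_ + _).
    rewrite rmorphM /= (actM AW) iota_alg (actA AW) -linearZ -(actA AU) -iota_alg.
    by rewrite -(actM AU) -rmorphM -dd mulfK.
  have PkD v v' : Pk U W p (v + v') = Pk U W p v + Pk U W p v'.
    by rewrite /Pk -big_split; apply: eq_bigr => b _; rewrite !linearD.
  have [a [b ->]] := kd z.
  rewrite !rmorphD !rmorphM /= !(actD AU) !(actD AW) !(actM AU) !(actM AW) PkD.
  by rewrite !PkA Pkd.
have PF U W (p : 'Hom(U, W)) a u : isA U -> isA W ->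
    P U W p (tm_act U a u) = tm_act W a (P U W p u).
  move=> AU AW; rewrite /P (actC AW); congr (tm_act W t _).
  have PkD I (r : seq I) (f : I -> U) :
      Pk U W p (\sum_(i <- r) f i) = \sum_(i <- r) Pk U W p (f i).
    rewrite /Pk exchange_big; apply: eq_bigr => b _.
    by rewrite !linear_sum.
  have yE b v : Pk U W p (tm_act U b v) =
      \sum_l tm_act W (iota (Tr (y l * b))) (Pk U W p (tm_act U (x l) v)).
    rewrite -{1}(xyC b) (act_sum AU) PkD; apply: eq_bigr => l _.
    by rewrite cyc_comm (actM AU) PkL.
  (* Expanding through the trace form exchanges the two dual families and releases [b]; the case b =
     1 then exchanges them back. *)
  have swap b : \sum_i tm_act W (x i) (Pk U W p (tm_act U (y i) (tm_act U b u))) =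
      tm_act W b (\sum_l tm_act W (y l) (Pk U W p (tm_act U (x l) u))).
    under eq_bigr => i _ do rewrite -(actM AU) yE linear_sum.
    rewrite exchange_big linear_sum; apply: eq_bigr => l _ /=.
    under eq_bigr => i _ do rewrite -(actM AW) (cyc_comm (y l)) -mulrA.
    by rewrite -(act_sum AW) xyC (actM AW).
  by have := swap 1; rewrite (act1 AU) (act1 AW) swap => ->.
split=> [U W AU AW p|U AU u]; last first.
  transitivity (\sum_(v <- [seq w i | i <- enum {: T * bool * 'I_m}])
      op U v.1 ((\1%VF : 'End(U)) (op U v.2 u))).
    by apply: eq_bigr => v _; rewrite id_lfunE.
  rewrite sumE //.
  have P1 v : P U U \1%VF v = tm_act U t v.
    congr (tm_act U t _).
    have Pk1 z : Pk U U \1%VF z = z.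
      rewrite /Pk big_bool /= !id_lfunE -!(actM AU) -!rmorphM /= mulfK //.
      rewrite mulr1 -(actD AU) -rmorphD -mulr2n -[_ *+ 2]mulr_natr mulVf //.
      by rewrite rmorph1 (act1 AU).
    under eq_bigr => i _ do rewrite Pk1 -(actM AU).
    rewrite -(act_sum AU) -[RHS](act1 AU); congr (tm_act U _ v).
    rewrite -[RHS](xy0 0%N (n_gt0 F)).
    by apply: eq_bigr.
  rewrite (eq_bigr (fun j : 'I_m => tm_act U (zt j t * iota beta) u)); last first.
    move=> j _; rewrite P1 (iter_theta_act AU) (actM AU) -(theta_m AU).
    by congr (tm_act U _ _); rewrite -iterD subnKC // ltnW.
  rewrite -(act_sum AU) -mulr_suml sum_zt Tt mulr1 -(actM AU) -!rmorphM /=.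
  by rewrite mulVf ?rmorph1 ?(act1 AU) // mulf_neq0.
have avgE u : avg [seq w i | i <- enum {: T * bool * 'I_m}] p u =
    tm_act W (iota kap) (\sum_(j < m)
      iter j (theta W) (P U W p (iter (m - j) (theta U) u))).
  rewrite -sumE // /avg sum_lfunE; apply: eq_bigr => v _.
  by rewrite comp_lfunE comp_lfunE.
split=> [a u|u]; rewrite !avgE.
  rewrite -[RHS](actC AW); congr (tm_act W _ _).
  rewrite linear_sum; apply: eq_bigr => j _ /=.
  rewrite (iter_theta_act AU) (PF _ _ _ _ _ AU AW) (iter_theta_act AW) -ztD.
  rewrite subnKC; last exact: ltnW.
  by rewrite zt_dvd.
rewrite (theta_act AW) zeta_iota; congr (tm_act W _ _).
pose f j := iter j (theta W) (P U W p (iter (m - j) (theta U) (theta U u))).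
transitivity (\sum_(0 <= j < m) f j); first by rewrite big_mkord.
(* The shift of the index trades the term 0 for the term m. They agree since theta^m is the scalar
   [beta] on both modules. *)
transitivity (\sum_(1 <= j < m.+1) f j).
  apply: (addrI (f m)); rewrite addrC -big_nat_recr //= big_nat_recl //=.
  rewrite big_add1 /= addrC [RHS]addrC; congr (_ + _).
  rewrite /f subnn subn0 (theta_m AW) /= -(PF _ _ _ _ _ AU AW) -(theta_m AU).
  by rewrite -iterSr.
rewrite linear_sum big_add1 big_mkord; apply: eq_bigr => j _ /=.
rewrite /f -iterS; congr (iter _ _ (P U W p _)).
by rewrite -iterSr subnS prednK // subn_gt0.
Qed.
End Modules.

Section Outer.
Variables (K : fieldType) (X Y : vectType K).

(* y (x) phi_l, phi_l being the l-th coordinate form. *)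
Definition outer (l : 'I_(\dim {:X})) (y : Y) : 'Hom(X, Y) :=
  linfun (fun x => coord (vbasis {:X}) l x *: y).

Lemma outerE l y x : outer l y x = coord (vbasis {:X}) l x *: y.
Proof.
by rewrite /outer lfun_linfun // => a u v; rewrite linearP scalerDl scalerA.
Qed.

Lemma outer_linear l : linear (outer l).
Proof.
move=> a u v; apply/lfunP=> x; rewrite add_lfunE scale_lfunE !outerE.
by rewrite scalerDr !scalerA mulrC.
Qed.

Lemma outer_sum (f : 'Hom(X, Y)) : f = \sum_l outer l (f (vbasis {:X})`_l).
Proof.
apply/lfunP=> x; rewrite sum_lfunE {1}(coord_vbasis (memvf x)) linear_sum.
by apply: eq_bigr => l _; rewrite outerE linearZ.
Qed.

End Outer.

(** * Action of twisted polynomials and the double centralizer theorem *)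

Section PolyAction.
Variables (k0 : fieldType) (k : fieldExtType k0) (sigk : {rmorphism k -> k}).
Variables (n m : nat) (beta : k) (F : cyclic_algebra sigk n).
Local Notation iota := (cyc_iota F).
Local Notation isA := (is_Abeta_module m beta).
Implicit Types (a b : F) (x y : k) (U W : theta_module F).
Hypotheses (Hnm : (n %| m)%N) (Hinv : ((m %/ n)%:R : k) != 0)
  (Hb : beta != 0).

(** The polynomial [p] stands for a twisted polynomial with coefficients on the left of the powers
    of theta. The product of [{poly F}] is not the twisted one; the two agree for left
    multiplication by constants and right multiplication by powers of ['X], the products occurring
    below. *)
Definition polyact U (p : {poly F}) (u : U) : U :=
  \sum_(j < size p) tm_act U p`_j (iter j (theta U) u).

Definition pact U (p : {poly k}) (u : U) : U :=
  \sum_(j < size p) tm_act U (iota p`_j) (iter (n * j) (theta U) u).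

Lemma iter_theta_surj U j : isA U -> forall u, exists v, u = iter j (theta U) v.
Proof.
move=> AU; elim: j => [|j IH] u; first by exists u.
have [v ->] := IH u.
exists (iter m.-1 (theta U) (tm_act U (iota beta^-1) v)).
rewrite iterSr -iterS (prednK (m_gt0 Hinv)) (theta_m AU) -(actM AU) -rmorphM.
by rewrite mulfV // rmorph1 (act1 AU).
Qed.

Section One.
Variables (U : theta_module F) (AU : isA U).
Implicit Types (u v : U) (p q : {poly F}) (P : {poly k}).

Lemma polyactE p N u : (size p <= N)%N ->
  polyact p u = \sum_(j < N) tm_act U p`_j (iter j (theta U) u).
Proof.
move=> pN; rewrite /polyact (big_ord_widen N (fun j => tm_act U p`_j (iter j (theta U) u))) //.
rewrite big_mkcond; apply: eq_bigr => j _; case: ltnP => // pj.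
by rewrite nth_default // (act0 AU).
Qed.

Lemma pactE P N u : (size P <= N)%N ->
  pact P u = \sum_(j < N) tm_act U (iota P`_j) (iter (n * j) (theta U) u).
Proof.
move=> pN; rewrite /pact (big_ord_widen N (fun j => tm_act U (iota P`_j) (iter (n * j) (theta U) u))) //.
rewrite big_mkcond; apply: eq_bigr => j _; case: ltnP => // pj.
by rewrite nth_default // rmorph0 (act0 AU).
Qed.

Lemma polyactD p q u : polyact (p + q) u = polyact p u + polyact q u.
Proof.
pose N := maxn (size p) (size q).
rewrite !(@polyactE _ N) ?size_polyD ?leq_maxl ?leq_maxr // -big_split.
by apply: eq_bigr => j _; rewrite coefD (actD AU).
Qed.

Lemma pactD P Q u : pact (P + Q) u = pact P u + pact Q u.
Proof.
pose N := maxn (size P) (size Q).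
rewrite !(@pactE _ N) ?size_polyD ?leq_maxl ?leq_maxr // -big_split.
by apply: eq_bigr => j _; rewrite coefD rmorphD (actD AU).
Qed.

Lemma pact0 u : pact 0 u = 0.
Proof. by rewrite /pact size_poly0 big_ord0. Qed.

Lemma polyactCM a p u : polyact (a%:P * p) u = tm_act U a (polyact p u).
Proof.
rewrite !(@polyactE _ (size p)) ?mul_polyC ?size_scale_leq //.
by rewrite linear_sum; apply: eq_bigr => j _; rewrite coefZ (actM AU).
Qed.

Lemma pactCM x P u : pact (x%:P * P) u = tm_act U (iota x) (pact P u).
Proof.
rewrite !(@pactE _ (size P)) ?mul_polyC ?size_scale_leq //.
by rewrite linear_sum; apply: eq_bigr => j _; rewrite coefZ rmorphM (actM AU).
Qed.

Lemma polyactMX p u : polyact (p * 'X) u = polyact p (theta U u).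
Proof.
rewrite (@polyactE _ (size p).+1) ?size_polyMleq //; last first.
  by rewrite (leq_trans (size_polyMleq _ _)) // size_polyX addn2.
rewrite big_ord_recl coefMX eqxx (act0 AU) add0r.
by apply: eq_bigr => j _; rewrite coefMX -iterSr.
Qed.

Lemma pactMX P u : pact (P * 'X) u = pact P (iter n (theta U) u).
Proof.
rewrite (@pactE _ (size P).+1) ?size_polyMleq //; last first.
  by rewrite (leq_trans (size_polyMleq _ _)) // size_polyX addn2.
rewrite big_ord_recl coefMX eqxx rmorph0 (act0 AU) add0r.
by apply: eq_bigr => j _; rewrite coefMX -iterD /= -mulnSr.
Qed.

Lemma polyactMXn p r u : polyact (p * 'X^r) u = polyact p (iter r (theta U) u).
Proof.
elim: r u => [|r IH] u; first by rewrite expr0 mulr1.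
by rewrite exprSr mulrA polyactMX IH -iterSr.
Qed.

Lemma theta_polyact p u :
  theta U (polyact p u) = polyact (map_poly (zeta F) p * 'X) u.
Proof.
rewrite polyactMX [RHS](@polyactE _ (size p)) ?size_poly // linear_sum.
apply: eq_bigr => j _; rewrite /= (theta_act AU) coef_map /=.
by rewrite -iterS iterSr.
Qed.

Lemma pact_linear P : linear (pact P : U -> U).
Proof.
move=> c u v; rewrite /pact scaler_sumr -big_split; apply: eq_bigr => j _ /=.
by rewrite iter_theta_linear linearP.
Qed.

Lemma pactA P a u : pact P (tm_act U a u) = tm_act U a (pact P u).
Proof.
rewrite /pact linear_sum; apply: eq_bigr => j _ /=.
by rewrite (iter_theta_act AU) zt_dvd ?dvdn_mulr // (actC AU).
Qed.

Lemma pactT P u : pact P (theta U u) = theta U (pact P u).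
Proof.
rewrite /pact linear_sum; apply: eq_bigr => j _ /=.
by rewrite (theta_act AU) zeta_iota -iterS -iterSr.
Qed.

Lemma pact_iter P j u : pact P (iter j (theta U) u) = iter j (theta U) (pact P u).
Proof. by elim: j => //= j <-; rewrite pactT. Qed.

Lemma pactC x u : pact x%:P u = tm_act U (iota x) u.
Proof.
by rewrite (@pactE _ 1) ?size_polyC ?leq_b1 // big_ord1 coefC muln0.
Qed.

Lemma pactX u : pact 'X u = iter n (theta U) u.
Proof. by rewrite -['X]mul1r pactMX pactC rmorph1 (act1 AU). Qed.

Lemma pactM P Q u : pact (P * Q) u = pact P (pact Q u).
Proof.
elim/poly_ind: P u => [|P x IH] u; first by rewrite mul0r !pact0.
rewrite mulrDl !pactD pactCM pactC mulrAC !pactMX IH.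
by congr (pact P _ + _); rewrite pact_iter.
Qed.

Lemma pactXn r u : pact 'X^r u = iter (n * r) (theta U) u.
Proof.
elim: r => [|r IH]; first by rewrite expr0 pactC rmorph1 (act1 AU) muln0.
by rewrite exprS pactM IH pactX -iterD mulnS.
Qed.

Lemma pact_relation u : pact ('X^(m %/ n) - beta%:P) u = 0.
Proof.
rewrite pactD pactXn mulnC divnK // (theta_m AU) -polyCN pactC rmorphN.
by rewrite (actN AU) subrr.
Qed.

End One.

Lemma pact_hom U W (f : 'Hom(U, W)) P u :
  Abeta_hom f -> f (pact P u) = pact P (f u).
Proof.
move=> [fF fT]; have fI j v : f (iter j (theta U) v) = iter j (theta W) (f v).
  by elim: j => //= j <-.
by rewrite /pact linear_sum; apply: eq_bigr => j _; rewrite /= fF fI.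
Qed.

(** The terms of degree divisible by n make up the centralizer of F in A_beta, which is generated
    over the center by F. *)
Definition part0 (p : {poly F}) : {poly F} :=
  \poly_(j < size p) (if (n %| j)%N then p`_j else 0).

Lemma sum_dvdn (A : nmodType) (f : nat -> A) N :
  \sum_(j < N * n) (if (n %| j)%N then f j else 0) = \sum_(e < N) f (n * e)%N.
Proof.
have n0 := n_gt0 F; elim: N => [|N IH]; first by rewrite mul0n !big_ord0.
rewrite mulSnr big_split_ord /= IH big_ord_recr /=; congr (_ + _).
rewrite (bigD1 (Ordinal n0)) //= addn0 dvdn_mull // mulnC big1 ?addr0 // => j j0.
by rewrite dvdn_addr ?dvdn_mulr // gtnNdvd // lt0n.
Qed.

Section DualSystems.
Variables (T : finType) (xs ys : T -> F).
Hypothesis xs0 : forall t, (t < n)%N -> \sum_i xs i * zt t (ys i) = (t == 0%N)%:R.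
Hypothesis xsT : forall c : F, \sum_i xs i * iota (Tr (ys i * c)) = c.

(** Moving [ys i] to the left past theta^j turns it into [zt j (ys i)], so the Galois system retains
    exactly the degrees divisible by n. *)
Lemma part0_act U (AU : isA U) p (u : U) :
  \sum_i tm_act U (xs i) (polyact p (tm_act U (ys i) u)) = polyact (part0 p) u.
Proof.
rewrite (polyactE AU (N := size p)) ?size_poly //.
under eq_bigr => i _ do rewrite linear_sum.
rewrite exchange_big; apply: eq_bigr => j _ /=.
have -> : (part0 p)`_j = p`_j * \sum_i xs i * zt j (ys i).
  have zj a : zt j a = zt (j %% n) a.
    by rewrite {1}(divn_eq j n) addnC ztD (zt_dvd _ (dvdn_mull _ (dvdnn n))).
  rewrite coef_poly ltn_ord; under eq_bigr => i _ do rewrite zj.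
  rewrite xs0 ?ltn_mod ?(n_gt0 F) // -/(dvdn n j).
  by case: ifP; rewrite ?mulr1 ?mulr0.
rewrite mulr_sumr (act_sum AU); apply: eq_bigr => i _.
by rewrite (iter_theta_act AU) -!(actM AU) (cyc_comm (xs i)) mulrA.
Qed.

(** Conjugation by powers of theta applies powers of [zeta] to the coefficients, and the sum over n
    conjugates is the trace to k, which lands in the center. Writing theta^(m-r) for theta^-r costs
    the factor [beta]. *)
Lemma part0_trace U (AU : isA U) p (y : F) (u : U) :
  \sum_(r < n) iter r (theta U)
     (tm_act U y (polyact (part0 p) (iter (m - r) (theta U) u))) =
  tm_act U (iota beta) (pact (\poly_(e < size p) Tr (y * p`_(n * e))) u).
Proof.
have n0 := n_gt0 F.
rewrite (pactE AU (N := size p)) ?size_poly // linear_sum /=.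
pose g j := tm_act U (iota (Tr (y * p`_j))) (iter j (theta U) (tm_act U (iota beta) u)).
transitivity (\sum_(e < size p) g (n * e)%N); last first.
  apply: eq_bigr => e _; rewrite /g coef_poly ltn_ord (iter_theta_act AU).
  by rewrite zt_iota (actC AU).
rewrite -sum_dvdn.
have sp : (size p <= size p * n)%N by rewrite leq_pmulr.
under eq_bigr => r _.
  rewrite (polyactE AU (N := size p * n)); last first.
    by rewrite (leq_trans _ sp) ?size_poly.
  rewrite linear_sum iter_theta_sum.
  over.
rewrite exchange_big; apply: eq_bigr => j _ /=.
rewrite /g; case: ifP => nj; last first.
  apply: big1 => r _; rewrite coef_poly nj if_same (act0 AU) linear0.
  exact: iter_theta0.
rewrite TrE (act_sum AU); apply: eq_bigr => r _.
have rm : (r <= m)%N.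
  by rewrite (leq_trans (ltnW (ltn_ord r))) // dvdn_leq // (m_gt0 Hinv).
have -> : (part0 p)`_j = p`_j.
  by rewrite coef_poly nj; case: ltnP => // /leq_sizeP->.
rewrite -(actM AU) [LHS](iter_theta_act AU).
rewrite -(theta_m AU); congr (tm_act U _ _).
by rewrite -!iterD; congr (iter _ _ _); lia.
Qed.

Lemma part0_pact U (AU : isA U) p (u : U) :
  polyact (part0 p) u =
  \sum_i tm_act U (xs i) (pact (\poly_(e < size p) Tr (ys i * p`_(n * e))) u).
Proof.
have sp : (size p <= size p * n)%N by rewrite leq_pmulr ?(n_gt0 F).
rewrite (polyactE AU (N := size p * n)); last first.
  by rewrite (leq_trans _ sp) ?size_poly.
transitivity (\sum_(j < size p * n)
    if (n %| j)%N then tm_act U p`_j (iter j (theta U) u) else 0).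
  apply: eq_bigr => j _; rewrite coef_poly.
  case: (boolP (n %| j)%N) => nj; case: ltnP => pj; rewrite ?(act0 AU) //.
  by rewrite nth_default // (act0 AU).
rewrite (sum_dvdn (fun j => tm_act U p`_j (iter j (theta U) u))).
under [RHS]eq_bigr => i _.
  rewrite (pactE AU (N := size p)) ?size_poly // linear_sum.
  over.
rewrite exchange_big; apply: eq_bigr => e _ /=.
rewrite -{1}(xsT p`_(n * e)) (act_sum AU); apply: eq_bigr => i _.
by rewrite coef_poly ltn_ord (actM AU).
Qed.

End DualSystems.

(* A_beta is generated over its center by F, in a way that lets one express
   the vanishing of an element of A_beta on a module through that of elements
   of the center. *)
Lemma polyact_transfer U W (f : 'End(W)) : isA U -> isA W -> Abeta_hom f ->
  (forall P, (forall u : U, pact P u = 0) -> forall w : W, pact P (f w) = 0) ->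
  forall p, (forall u : U, polyact p u = 0) ->
  forall w : W, polyact p (f w) = 0.
Proof.
move=> AU AW fA PP p pU w.
have fI j v : f (iter j (theta W) v) = iter j (theta W) (f v).
  by case: fA => _ fT; elim: j => //= j <-.
have [T [xs [ys [xs0 xsT]]]] := trace_dual F.
(* A part of degree 0 modulo n is recovered from the central elements obtained by multiplying it by
   the [ys i] and taking traces. These vanish on U because they are sums of sandwiches of [p], hence
   they vanish on the image of [f]. *)
have shift s v : polyact (part0 (p * 'X^s)) (f v) = 0 :> W.
  rewrite (part0_pact xsT AW) big1 // => i _.
  rewrite PP ?linear0 // => u; set P := (X in pact X u).
  have /(congr1 (tm_act U (iota beta^-1))) := part0_trace AU (p * 'X^s) (ys i) u.
  rewrite -(actM AU) -rmorphM mulVf // rmorph1 (act1 AU) => <-.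
  rewrite big1 ?linear0 // => r _; rewrite -(part0_act xs0 AU) big1 ?linear0.
    exact: iter_theta0.
  by move=> l _; rewrite (polyactMXn AU) pU linear0.
have [v ->] := iter_theta_surj n AW w; rewrite fI.
(* Each degree j has exactly one s < n with n dividing s + j, so the n shifted parts, brought back
   to a common shift by theta^n, reassemble [p]. *)
transitivity (\sum_(s < n) polyact (part0 (p * 'X^s)) (iter (n - s) (theta W) (f v))).
  have shiftE (s : 'I_n) : polyact (part0 (p * 'X^s)) (iter (n - s) (theta W) (f v)) =
      \sum_(j < size p) if (n %| s + j)%N then
        tm_act W p`_j (iter j (theta W) (iter n (theta W) (f v))) else 0.
    rewrite (polyactE AW (N := s + size p)); last first.
      rewrite (leq_trans (size_poly _ _)) // (leq_trans (size_polyMleq _ _)) //.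
      by rewrite size_polyXn addnS /= addnC.
    rewrite big_split_ord /= big1 ?add0r => [|j _].
      apply: eq_bigr => j _.
      have cE : (p * 'X^s)`_(s + j) = p`_j.
        by rewrite coefMXn ltnNge leq_addr /= addKn.
      rewrite coef_poly cE; case: (boolP (n %| s + j)%N) => nj; last first.
        by rewrite if_same (act0 AW).
      case: ltnP => pj; last first.
        by rewrite -cE (nth_default _ pj) !(act0 AW).
      congr (tm_act W _ _); rewrite -!iterD; congr (iter _ _ _).
      by have := ltn_ord s; lia.
    by rewrite coef_poly coefMXn ltn_ord !if_same (act0 AW).
  rewrite (eq_bigr _ (fun s _ => shiftE s)) exchange_big /polyact.
  apply: eq_bigr => j _ /=.
  have n0 := n_gt0 F.
  have s0P : ((n - j %% n) %% n < n)%N by rewrite ltn_mod.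
  rewrite (bigD1 (Ordinal s0P)) //= big1 ?addr0 => [|s ss0].
    suff -> : (n %| (n - j %% n) %% n + j)%N by [].
    rewrite /dvdn modnDml -modnDmr subnK ?modnn // ltnW // ltn_mod.
    by [].
  case: ifP => // ns; case/negP: ss0; apply/eqP/val_inj => /=.
  have js : (j %% n < n)%N by rewrite ltn_mod.
  have sn := ltn_ord s.
  move: ns; rewrite /dvdn -modnDmr; case: (posnP (j %% n)) => [->|j0].
    by rewrite addn0 subn0 modnn modn_small // => /eqP.
  rewrite (@modn_small (n - _)) ?ltn_subrL ?j0 //; move=> ns.
  have : (n %| s + j %% n)%N by [].
  case/dvdnP => q qE; have q1 : q = 1%N.
    case: q qE => [|[|q]] //; first by lia.
    by rewrite !mulSn; lia.
  by move: qE; rewrite q1 mul1n; lia.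
by rewrite big1 // => s _; rewrite -fI shift.
Qed.

(** A k0-linear projection onto the image [PS] of A_beta in End(U) is turned by averaging, for each
    v, into endomorphisms of U that map the basis vectors to elements of sum v. As z commutes with
    them, z v is obtained by applying them to the images of the basis vectors, which exhibits z as
    an element of [PS]. *)
Lemma double_centralizer U (z : 'End(U)) : isA U -> Abeta_hom z ->
  (forall f : 'End(U), Abeta_hom f -> forall u, z (f u) = f (z u)) ->
  exists P, forall u, z u = pact P u.
Proof.
move=> AU zA zf; have [s [sA s1]] := separability F Hnm Hinv Hb.
pose Pr (f : 'End(U)) := exists p, forall u, f u = polyact p u.
have PSP : forall f, f \in vspace_of Pr <-> Pr f.
  apply: vspace_ofP => [|c f g [p pE] [q qE]].
    by exists 0 => u; rewrite /polyact size_poly0 big_ord0 lfunE.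
  exists (c%:A%:P * p + q) => u.
  by rewrite (polyactD AU) (polyactCM AU) (actA AU) !lfunE /= lfunE /= pE qE.
set PS := vspace_of Pr in PSP.
have opP w f : f \in PS -> (op U w \o f)%VF \in PS.
  case: w => a j /PSP[p pE]; apply/PSP.
  have [q qE] : exists q, forall u, iter j (theta U) (f u) = polyact q u.
    elim: j => [|j [q qE]]; first by exists p.
    exists (map_poly (zeta F) q * 'X) => u /=.
    by rewrite qE (theta_polyact AU).
  by exists (a%:P * q) => u; rewrite comp_lfunE opE /= qE (polyactCM AU).
have opS w : op U w \in PS.
  rewrite -[op U w]comp_lfun1r; apply: opP; apply/PSP; exists 1 => u.
  by rewrite lfunE /= /polyact size_poly1 big_ord1 coef1 (act1 AU).
pose g (f : 'End(U)) : 'End(U) := projv PS f.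
have gS f : g f \in PS by exact: memv_proj.
pose zz : 'End(U) := \sum_l \sum_(w <- s)
  (op U w.1 \o g (outer l (op U w.2 (z (vbasis {:U})`_l))))%VF.
have zzS : zz \in PS by do 2!apply: memv_suml => ? _; apply: opP.
have zE : z = zz.
  apply/lfunP=> v.
  pose h l : 'End(U) := linfun (fun s' : U => g (outer l s') v).
  have hE l s' : h l s' = g (outer l s') v.
    rewrite /h lfun_linfun // => c x y; rewrite outer_linear /g linearP.
    by rewrite add_lfunE scale_lfunE.
  have avgE l s' : avg s (h l) s' =
      \sum_(w <- s) op U w.1 (g (outer l (op U w.2 s')) v).
    rewrite /avg sum_lfunE; apply: eq_bigr => w _.
    by rewrite comp_lfunE comp_lfunE hE.
  have vE : v = \sum_l avg s (h l) (vbasis {:U})`_l.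
    rewrite -{1}(s1 U AU v).
    under [RHS]eq_bigr => l _ do rewrite avgE.
    rewrite exchange_big; apply: eq_bigr => w _.
    rewrite -linear_sum; congr (op U _ _).
    rewrite -sum_lfunE -linear_sum -outer_sum.
    by rewrite /= projv_id.
  rewrite {1}vE linear_sum /zz sum_lfunE; apply: eq_bigr => l _.
  rewrite /= zf; last exact: sA.
  rewrite avgE sum_lfunE; apply: eq_bigr => w _.
  by rewrite comp_lfunE.
have [p pE] : Pr z by apply/PSP; rewrite zE.
have [T [xs [ys [xs0 xsT]]]] := trace_dual F.
have [t Tt] := trace_one F.
have [zF zT] := zA.
(* Sandwiching by the Galois system fixes the F-linear map z and projects [p] onto its part of
   degree 0 modulo n. *)
have z0 u : z u = polyact (part0 p) u.
  rewrite -(part0_act xs0 AU); under eq_bigr => i _ do rewrite -pE zF -(actM AU).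
  rewrite -(act_sum AU) -[LHS](act1 AU); congr (tm_act U _ _).
  by rewrite -[LHS](xs0 0%N (n_gt0 F)); apply: eq_bigr.
(* Similarly z commutes with theta, so averaging it over conjugates weighted by [t], of trace 1,
   fixes it and brings the coefficients into k. *)
exists (\poly_(e < size p) Tr (t * p`_(n * e))) => u.
have /(congr1 (tm_act U (iota beta^-1))) := part0_trace AU p t u.
rewrite -[RHS](actM AU) -rmorphM mulVf // rmorph1 (act1 AU) => <-.
rewrite (eq_bigr (fun r : 'I_n => tm_act U (zt r t) (tm_act U (iota beta) (z u)))).
  rewrite -(act_sum AU) -TrE Tt rmorph1 (act1 AU) -(actM AU) -rmorphM mulVf //.
  by rewrite rmorph1 (act1 AU).
move=> r _; rewrite -z0 -zF.
have zI j v : z (iter j (theta U) v) = iter j (theta U) (z v).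
  by elim: j => //= j <-.
rewrite -zI (iter_theta_act AU) zF -iterD subnKC.
  by rewrite (theta_m AU) zF.
by rewrite (leq_trans (ltnW (ltn_ord r))) // dvdn_leq // (m_gt0 Hinv).
Qed.

End PolyAction.

(** * The center L_beta and its action on modules *)

Section Center.
Variables (k0 : fieldType) (k : fieldExtType k0) (sigk : {rmorphism k -> k}).
Variables (n m : nat) (beta : k) (F : cyclic_algebra sigk n).
Local Notation iota := (cyc_iota F).
Local Notation isA := (is_Abeta_module m beta).
Local Notation Lb := (Lbeta n m beta).
Local Notation h := ('X^(m %/ n) - beta%:P : {poly k}).
Implicit Types (x y : k) (U W : theta_module F) (P : {poly k}) (q : Lb).
Hypotheses (Hnm : (n %| m)%N) (Hinv : ((m %/ n)%:R : k) != 0)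
  (Hb : beta != 0).

Definition LQ P : Lb := in_qpoly h P.

Lemma mn_gt0 : (0 < m %/ n)%N.
Proof. by rewrite lt0n; apply: contraNneq Hinv => ->. Qed.

Lemma mk_monic_h : mk_monic h = h.
Proof.
by rewrite /mk_monic size_XnsubC ?mn_gt0 // ltnS mn_gt0 monicXnsubC ?mn_gt0.
Qed.

Lemma LQD P P' : LQ (P + P') = LQ P + LQ P'.
Proof. exact: in_qpolyD. Qed.
Lemma LQM P P' : LQ (P * P') = LQ P * LQ P'.
Proof. exact: in_qpolyM. Qed.
Lemma LQ1 : LQ 1 = 1.
Proof. exact: in_qpoly1. Qed.
Lemma LQZ x P : LQ (x *: P) = x *: LQ P.
Proof. exact: in_qpolyZ. Qed.
Lemma LQC x : LQ x%:P = x%:A.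
Proof. by rewrite -alg_polyC LQZ LQ1. Qed.
Lemma LQX : LQ 'X = b_elt n m beta.
Proof. by []. Qed.

Lemma LQ_surj q : exists P, q = LQ P.
Proof.
by exists (polyn q); apply/val_inj; rewrite [RHS]in_qpoly_small ?size_mk_monic.
Qed.

Lemma center_actE U q u : isA U -> center_act U q u = pact (polyn q) u :> U.
Proof.
move=> AU; rewrite /center_act lfun_linfun //.
exact: (pact_linear (U := U) (polyn q)).
Qed.

Lemma center_act_LQ U P u : isA U -> center_act U (LQ P) u = pact P u :> U.
Proof.
move=> AU; rewrite center_actE //= mk_monic_h.
have hm : h \is monic by rewrite -mk_monic_h monic_mk_monic.
rewrite [in RHS](Pdiv.RingMonic.rdivp_eq hm P) (pactD AU) (pactM AU).
rewrite (pact_relation Hnm AU).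
set r := Pdiv.CommonRing.rdivp _ _.
have -> : pact r 0 = 0 :> U.
  by rewrite /pact big1 // => j _; rewrite iter_theta0 linear0.
by rewrite add0r.
Qed.

Section One.
Variables (U : theta_module F) (AU : isA U).
Implicit Types u : U.
Local Notation ca := (center_act U : Lb -> 'End(U)).

Lemma cactD q q' u : ca (q + q') u = ca q u + ca q' u.
Proof.
have [P ->] := LQ_surj q; have [P' ->] := LQ_surj q'.
by rewrite -LQD !center_act_LQ // (pactD AU).
Qed.

Lemma cactM q q' u : ca (q * q') u = ca q (ca q' u).
Proof.
have [P ->] := LQ_surj q; have [P' ->] := LQ_surj q'.
by rewrite -LQM !center_act_LQ // (pactM AU).
Qed.

Lemma cact_alg x u : ca x%:A u = tm_act U (iota x) u.
Proof. by rewrite -LQC center_act_LQ // (pactC AU). Qed.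

Lemma cact1 u : ca 1 u = u.
Proof. by rewrite -[1]scale1r cact_alg rmorph1 (act1 AU). Qed.

Lemma cact0 u : ca 0 u = 0.
Proof. by rewrite -[0](scale0r 1) cact_alg rmorph0 (act0 AU). Qed.

Lemma cactN q u : ca (- q) u = - ca q u.
Proof. by apply: (addrI (ca q u)); rewrite -cactD !subrr cact0. Qed.

Lemma cact_sum I (r : seq I) (Q : pred I) (f : I -> Lb) u :
  ca (\sum_(i <- r | Q i) f i) u = \sum_(i <- r | Q i) ca (f i) u.
Proof. exact: (big_morph (fun q => ca q u) (fun a b => cactD a b u) (cact0 u)). Qed.

Lemma cact_b u : ca (b_elt n m beta) u = iter n (theta U) u.
Proof. by rewrite -LQX center_act_LQ // (pactX AU). Qed.

Lemma cact_Ahom q : Abeta_hom (ca q).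
Proof.
have [P ->] := LQ_surj q.
by split=> [a u|u]; rewrite !center_act_LQ // ?(pactA AU) ?(pactT AU).
Qed.

End One.

Lemma cact_hom U W (f : 'Hom(U, W)) q u : isA U -> isA W -> Abeta_hom f ->
  f (center_act U q u) = center_act W q (f u).
Proof.
move=> AU AW fA; have [P ->] := LQ_surj q.
by rewrite !center_act_LQ // pact_hom.
Qed.

Lemma b_expr : b_elt n m beta ^+ (m %/ n) = beta%:A.
Proof.
have LQXn r : LQ 'X^r = b_elt n m beta ^+ r.
  by elim: r => [|r IH]; rewrite ?expr0 ?LQ1 // !exprS LQM IH LQX.
rewrite -LQXn -LQC -[X in LQ X](subrK beta%:P) LQD -[RHS]add0r; congr (_ + _).
apply/val_inj; rewrite /= mk_monic_h.
by apply: Pdiv.RingMonic.rmodpp; rewrite monicXnsubC ?mn_gt0.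
Qed.

Lemma b_unit : b_elt n m beta \is a GRing.unit.
Proof.
apply/unitrPr; exists (beta^-1 *: b_elt n m beta ^+ (m %/ n).-1).
by rewrite -scalerAr -exprS (prednK mn_gt0) b_expr scalerA mulVf // scale1r.
Qed.

End Center.

(** * The quiver *)

Section QuiverBasics.
Variables (k0 : fieldType) (k : fieldExtType k0) (sigk : {rmorphism k -> k}).
Variables (n m : nat) (beta : k) (F : cyclic_algebra sigk n).
Variables (V : polarized_space m beta F) (xi : F) (Q : quiver V xi).
Local Notation iota := (cyc_iota F).
Local Notation isA := (is_Abeta_module m beta).
Local Notation Lb := (Lbeta n m beta).
Local Notation S := (Smod (q0 := Q)).
Implicit Types (i j : Q) (q : Lb).

Let Hnm := n_dvd_m V.
Let Hinv := mn_inv V.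

Lemma AS i : isA (S i).
Proof. by have [] := Smod_simple i. Qed.

Lemma S_neq0 i : exists u : S i, u != 0.
Proof. by have [] := Smod_simple i. Qed.

Definition idem i : Lb := inL (1 : Lfac i).

Lemma prL_idem i j : prL j (idem i) = (i == j)%:R.
Proof.
have [<-|ij] := eqVneq i j; first exact: inLK.
by apply: prL_inL; rewrite eq_sym.
Qed.

Lemma prL_ext q q' : (forall i, prL i q = prL i q') -> q = q'.
Proof.
by move=> qq; rewrite (Lbeta_prod Q q) (Lbeta_prod Q q');
  apply: eq_bigr => i _; rewrite qq.
Qed.

Lemma sum_idem : \sum_i idem i = 1.
Proof.
by rewrite [RHS](Lbeta_prod Q); apply: eq_bigr => i _; rewrite rmorph1.
Qed.

(** The annihilator of S_i in L_beta is exactly the kernel of [prL i]: a lift of the inverse of a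
    nonzero [prL i q] makes q act invertibly on S_i. Vertices can therefore be recognized by their
    action on simple modules. *)
Lemma cactS_eq0 i q : (forall u : S i, center_act (S i) q u = 0) <-> prL i q = 0.
Proof.
split=> [qS|]; last exact: Smod_Lfac.
have [//|q0] := eqVneq (prL i q) 0.
pose q' := inL (prL i q)^-1.
have r0 : prL i (q' * q - 1) = 0.
  by rewrite rmorphB rmorphM inLK mulVf // rmorph1 subrr.
have [u /eqP u0] := S_neq0 i; case: u0.
have := Smod_Lfac r0 u; rewrite (cactD Hnm Hinv (AS i)) (cactM Hnm Hinv (AS i)) qS linear0 add0r.
rewrite (cactN Hnm Hinv (AS i)) (cact1 Hnm Hinv (AS i)) => /eqP.
by rewrite oppr_eq0 => /eqP.
Qed.

Lemma cact_idemS i j (u : S j) :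
  center_act (S j) (idem i) u = if i == j then u else 0.
Proof.
have [->|ij] := eqVneq i j; last first.
  by apply: Smod_Lfac; rewrite prL_idem (negPf ij).
apply/eqP; rewrite -subr_eq0 -{2}[u](cact1 Hnm Hinv (AS j)).
rewrite -(cactN Hnm Hinv (AS j)) -(cactD Hnm Hinv (AS j)); apply/eqP.
by apply: Smod_Lfac; rewrite rmorphB rmorph1 prL_idem eqxx subrr.
Qed.

(* b acts on U^xi as Nm(xi) b does on U *)
Lemma eta_pact i (P : {poly k}) (u : S i) (j := xibar Q i) :
  eta i j (pact (P \Po (Nm xi *: 'X)) u) = pact P (eta i j u).
Proof.
have [[eF eT] _] := eta_iso i; rewrite -/j /= in eF eT.
have eb v : eta i j (tm_act (S i) (iota (Nm xi)) (iter n (theta (S i)) v)) =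
    iter n (theta (S j)) (eta i j v).
  have eN N w : eta i j (tm_act (S i) (\prod_(t < N) zt t xi) (iter N (theta (S i)) w)) =
      iter N (theta (S j)) (eta i j w).
    elim: N => [|N IH]; first by rewrite big_ord0 (act1 (AS i)).
    rewrite !iterS -IH -eT lfunE /= (theta_act (AS i)) -(actM (AS i)).
    rewrite big_ord_recl; congr (eta i j (tm_act _ (_ * _) _)).
    by rewrite rmorph_prod; apply: eq_bigr => t _.
  by rewrite -eN -NmE.
elim/poly_ind: P u => [|P c IH] u.
  by rewrite comp_poly0 !pact0 linear0.
rewrite comp_polyD comp_polyM comp_polyX comp_polyC.
rewrite !(pactD (AS _)) linearD /= (pactM (AS i)) (pactM (AS j)).
rewrite IH -mul_polyC (pactCM (AS _)) (pactX (AS i)) eb (pactX (AS j)).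
rewrite !(pactC (AS _)); congr (_ + _).
exact: eF.
Qed.

(** The isomorphism [eta] transports the action of b up to the scalar Nm(xi), so [xibar] is
    determined by this scalar and the kernels of the projections. *)
Lemma prL_xibar i (P : {poly k}) :
  prL (xibar Q i) (LQ n m beta P) = 0 <->
  prL i (LQ n m beta (P \Po (Nm xi *: 'X))) = 0.
Proof.
have [_ bij] := eta_iso i; have [g gK Kg] := bij.
split=> [/cactS_eq0 h|/cactS_eq0 h]; apply/cactS_eq0 => u.
  rewrite (center_act_LQ Hnm Hinv _ _ (AS i)); apply: (can_inj gK).
  by rewrite eta_pact -(center_act_LQ Hnm Hinv _ _ (AS _)) h linear0.
rewrite -[u]Kg (center_act_LQ Hnm Hinv _ _ (AS _)) -eta_pact.
by rewrite -(center_act_LQ Hnm Hinv _ _ (AS i)) h linear0.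
Qed.

Lemma inL_img i q : (exists y : Lfac i, q = inL y) <->
  (forall j, j != i -> prL j q = 0).
Proof.
split=> [[y ->] j ji|qj]; first exact: prL_inL.
exists (prL i q); rewrite {1}(Lbeta_prod Q q) (bigD1 i) //= big1 ?addr0 //.
move=> j ji; rewrite qj //; apply: prL_ext => l; rewrite rmorph0.
have [->|lj] := eqVneq l j; [exact: inLK | exact: prL_inL].
Qed.

End QuiverBasics.

(** * Comparison of two quivers with the same norms *)

Section QuiverIso.
Variables (k0 : fieldType) (k : fieldExtType k0) (sigk : {rmorphism k -> k}).
Variables (n m : nat) (beta : k) (F F' : cyclic_algebra sigk n).
Variables (V : polarized_space m beta F) (V' : polarized_space m beta F').
Variables (xi : F) (xi' : F') (Q : quiver V xi) (Q' : quiver V' xi').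

(** Both quivers decompose the same ring L_beta, so their vertices are its maximal ideals. Some
    idempotent of the second decomposition is nonzero in L_i, which gives an inclusion of kernels;
    going there and back returns to i, so the inclusion is an equality. *)
Lemma prL_match (i : Q) : exists i' : Q', forall q, prL i q = 0 <-> prL i' q = 0.
Proof.
have half (F1 F2 : cyclic_algebra sigk n) (V1 : polarized_space m beta F1)
    (V2 : polarized_space m beta F2) (xi1 : F1) (xi2 : F2) (Q1 : quiver V1 xi1)
    (Q2 : quiver V2 xi2) (a : Q1) :
    exists a' : Q2, forall q, prL a' q = 0 -> prL a q = 0.
  have [a' a'P] : exists a' : Q2, prL a (idem a') != 0.
    apply: contrapT => nex; have /eqP := rmorph1 (prL a).
    rewrite -(sum_idem Q2) rmorph_sum big1 ?(eq_sym 0) ?oner_eq0 // => a' _.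
    by apply: contrapT => /eqP h; apply: nex; exists a'.
  exists a' => q qa'; have : q * idem a' = 0.
    apply: (prL_ext (Q := Q2)) => l; rewrite rmorphM prL_idem rmorph0.
    by have [<-|] := eqVneq a' l; rewrite ?qa' ?mul0r ?mulr0.
  move/(congr1 (prL a))/eqP; rewrite rmorphM rmorph0 mulf_eq0 (negPf a'P) orbF.
  by move/eqP.
have [i' i'P] := half _ _ _ _ _ _ Q Q' i.
have [j jP] := half _ _ _ _ _ _ Q' Q i'.
suff ji : j = i by subst j; exists i' => q; split; [apply: jP | apply: i'P].
apply/eqP/negPn/negP => ji; have /i'P : prL i' (idem i) = 0.
  by apply: jP; rewrite prL_idem eq_sym (negPf ji).
by rewrite prL_idem eqxx => /eqP; rewrite oner_eq0.
Qed.

Lemma prL_sep (i j : Q) : (forall q, prL i q = 0 -> prL j q = 0) -> i = j.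
Proof.
move=> ij; apply/eqP/negPn/negP => ne; have := ij (idem j).
rewrite !prL_idem eqxx eq_sym (negPf ne) => /(_ erefl)/eqP.
by rewrite oner_eq0.
Qed.

End QuiverIso.

Lemma quiver_iso_of_norms (k0 : fieldType) (k : fieldExtType k0)
    (sigk : {rmorphism k -> k}) (n m : nat) (beta : k)
    (F F' : cyclic_algebra sigk n)
    (V : polarized_space m beta F) (V' : polarized_space m beta F')
    (xi : F) (xi' : F') (Q : quiver V xi) (Q' : quiver V' xi') :
  Nm (pol_c V) = Nm (pol_c V') -> Nm xi = Nm xi' -> quiver_isomorphic Q Q'.
Proof.
move=> Nc Nxi.
have /fin_all_exists[f fP] := prL_match (Q := Q) Q'.
have /fin_all_exists[g gP] := prL_match (Q := Q') Q.
exists f; split.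
- exists g => i; apply: prL_sep => q h.
    by apply/fP/gP.
  by apply/gP/fP.
- move=> i; apply: prL_sep => q /fP; have [P ->] := LQ_surj q.
  by move/prL_xibar/fP => h; apply/prL_xibar; rewrite -Nxi.
move=> i.
have fK : cancel f g by move=> a; apply: prL_sep => q h; apply/fP/gP.
(* The copy of a factor inside L_beta consists of the elements vanishing in all other factors, so it
   too depends only on the kernels; [diaP] can then be compared on both sides. *)
have img (a : Q) q : (exists y : Lfac a, q = inL y) <-> (exists y : Lfac (f a), q = inL y).
  split=> /inL_img h; apply/inL_img => j ja.
    apply/gP/h; apply: contraNneq ja => <-.
    by apply/eqP/prL_sep => q' h'; apply/fP/gP.
  apply/fP/h; apply: contraNneq ja => fja.
  by rewrite -(fK j) fja fK.
have img_inj (a b : Q') : (forall q, (exists y : Lfac a, q = inL y) -> (exists y : Lfac b, q = inL y)) -> a = b.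
  move=> ab; apply/eqP/negPn/negP => ne.
  have [|y yE] := ab (idem a); first by exists 1.
  have := prL_inL y ne; rewrite -yE prL_idem eqxx => /eqP.
  by rewrite oner_eq0.
apply: img_inj => q /img/diaP[y ->]; apply/diaP.
have [|y' y'E] := (img i (inL y)).1; first by exists y.
by exists y'; rewrite /sigma_ -y'E Nc.
Qed.

(** * Components at the vertices and arrows *)

Section VertexComponents.
Variables (k0 : fieldType) (k : fieldExtType k0) (sigk : {rmorphism k -> k}).
Variables (n m : nat) (beta : k) (F : cyclic_algebra sigk n).
Variables (V : polarized_space m beta F) (xi : F) (Q : quiver V xi).
Local Notation isA := (is_Abeta_module m beta).
Local Notation Lb := (Lbeta n m beta).
Local Notation S := (Smod (q0 := Q)).
Implicit Types (i j : Q) (q : Lb).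

Let Hnm := n_dvd_m V.
Let Hinv := mn_inv V.
Let Hb := beta_neq0 V.

Lemma AV : isA V. Proof. exact: pol_modP. Qed.

Lemma Mval_Ahom i (x : M i) : Abeta_hom (Mval x).
Proof. by apply/Mspace_mem; apply: subvsP. Qed.

Lemma Dval_Ahom i (d : D i) : Abeta_hom (Dval d).
Proof. by apply/Dspace_mem; apply: subvsP. Qed.

Lemma MprojK i (f : 'Hom(S i, V)) : Abeta_hom f -> Mval (Mproj f) = f.
Proof. by move=> fA; apply: vsprojK; apply/Mspace_mem. Qed.

Lemma DprojK i (f : 'End(S i)) : Abeta_hom f -> Dval (Dproj f) = f.
Proof. by move=> fA; apply: vsprojK; apply/Dspace_mem. Qed.

Lemma MvalK i (x : M i) : Mproj (Mval x) = x.
Proof. exact: vsvalK. Qed.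

Lemma DvalK i (d : D i) : Dproj (Dval d) = d.
Proof. exact: vsvalK. Qed.

Lemma Mval_linear i : linear (@Mval _ _ _ _ _ _ _ _ _ _ i).
Proof. by move=> c x y; rewrite /Mval linearP. Qed.

Lemma Dval_linear i : linear (@Dval _ _ _ _ _ _ _ _ _ _ i).
Proof. by move=> c x y; rewrite /Dval linearP. Qed.

Lemma Mval_inj i (x y : M i) : (forall u, Mval x u = Mval y u) -> x = y.
Proof. by move=> xy; rewrite -[x]MvalK -[y]MvalK; congr Mproj; apply/lfunP. Qed.

Lemma Dval_inj i (d d' : D i) : (forall u, Dval d u = Dval d' u) -> d = d'.
Proof. by move=> xy; rewrite -[d]DvalK -[d']DvalK; congr Dproj; apply/lfunP. Qed.

Lemma ev_inj i (x y : M i) : (forall u : S i, ev u x = ev u y) -> x = y.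
Proof. by move=> xy; apply: Mval_inj => u; rewrite -!evE. Qed.

Lemma ev_Dval i (d : D i) (u : S i) (x : M i) :
  ev (Dval d u) x = ev u (Dact d x).
Proof. by rewrite !evE Dact_val. Qed.

Lemma act_ev i a (u : S i) (x : M i) : tm_act V a (ev u x) = ev (tm_act (S i) a u) x.
Proof. by have [xF _] := Mval_Ahom x; rewrite !evE xF. Qed.

Lemma theta_ev i (u : S i) (x : M i) : theta V (ev u x) = ev (theta (S i) u) x.
Proof. by have [_ xT] := Mval_Ahom x; rewrite !evE xT. Qed.

Lemma evDl i (u v : S i) x : ev (u + v) x = ev u x + ev v x.
Proof. by rewrite !evE linearD. Qed.

Definition eV i : 'End(V) := center_act V (idem i).

Lemma eV_Ahom i : Abeta_hom (eV i).
Proof. exact: (cact_Ahom Hnm Hinv AV). Qed.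

Lemma eV_ev i j (u : S j) x : eV i (ev u x) = if i == j then ev u x else 0.
Proof.
rewrite /eV evE -(cact_hom Hnm Hinv _ _ (AS j) AV (Mval_Ahom x)) cact_idemS.
by case: eqP => // _; rewrite linear0.
Qed.

Lemma sum_eV v : \sum_i eV i v = v.
Proof.
by rewrite -(cact_sum Hnm Hinv AV) (sum_idem Q) (cact1 Hnm Hinv AV).
Qed.

(** An element of A_beta that kills S_i kills the whole i-th part of V. By [polyact_transfer] only
    central elements need checking, and a central element killing S_i is killed by [idem i]. *)
Lemma polyact_S_eV i p : (forall u : S i, polyact p u = 0) ->
  forall v : V, polyact p (eV i v) = 0.
Proof.
apply: (polyact_transfer Hnm Hinv Hb (AS i) AV (eV_Ahom i)) => P PS v.
rewrite -(center_act_LQ Hnm Hinv _ _ AV) /eV -(cactM Hnm Hinv AV).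
suff -> : LQ n m beta P * idem i = 0 by rewrite (cact0 Hnm Hinv AV).
have P0 : prL i (LQ n m beta P) = 0.
  by apply/cactS_eq0 => u; rewrite (center_act_LQ Hnm Hinv _ _ (AS i)).
apply: (prL_ext (Q := Q)) => j; rewrite rmorphM prL_idem rmorph0.
by have [<-|] := eqVneq i j; rewrite ?P0 ?mul0r ?mulr0.
Qed.

(** The i-th part of V is spanned by images of homomorphisms from S_i. As in the double centralizer
    theorem, these are averages of maps built from a k0-linear projection onto the image of A_beta
    in End(S_i). *)
Lemma generated i (v : V) : exists g : 'I_(\dim {:S i}) -> M i,
  \sum_l Mval (g l) (vbasis {:S i})`_l = eV i v.
Proof.
have [s [sA s1]] := separability F Hnm Hinv Hb.
pose Pr (f : 'End(S i)) := exists p, forall u, f u = polyact p u.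
have PSP : forall f, f \in vspace_of Pr <-> Pr f.
  apply: vspace_ofP => [|c f g [p pE] [q qE]].
    by exists 0 => u; rewrite /polyact size_poly0 big_ord0 lfunE.
  exists (c%:A%:P * p + q) => u.
  rewrite (polyactD (AS i)) (polyactCM (AS i)) (actA (AS i)).
  by rewrite add_lfunE scale_lfunE pE qE.
set PS := vspace_of Pr in PSP.
pose w := eV i v.
(* An element of A_beta acting on S_i as the projection of f is made to act on [w]; the result does
   not depend on the choice of this element by [polyact_S_eV]. *)
pose gam (f : 'End(S i)) : V := classical_sets.xget 0
  (fun z => exists2 p, (forall u, projv PS f u = polyact p u) & z = polyact p w).
have gamP f p : (forall u, projv PS f u = polyact p u) -> gam f = polyact p w.
  move=> pE; rewrite /gam; have [|q qE ->] := @classical_sets.xgetPex _ 0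
    (fun z : V => exists2 p, (forall u, projv PS f u = polyact p u) & z = polyact p w).
    by exists (polyact p w), p.
  apply/eqP; rewrite -subr_eq0; apply/eqP.
  have -> : polyact q w - polyact p w = polyact (q + (-1)%:P * p) w.
    by rewrite (polyactD AV) (polyactCM AV) (actN AV) (act1 AV).
  apply: polyact_S_eV => u.
  by rewrite (polyactD (AS i)) (polyactCM (AS i)) (actN (AS i)) (act1 (AS i)) -qE -pE subrr.
have gamL : linear gam.
  move=> c f g.
  have [p pE] : Pr (projv PS f) by apply/PSP/memv_proj.
  have [q qE] : Pr (projv PS g) by apply/PSP/memv_proj.
  rewrite (gamP _ _ pE) (gamP _ _ qE) (gamP _ (c%:A%:P * p + q)).
    by rewrite (polyactD AV) (polyactCM AV) (actA AV).
  move=> u; rewrite linearP add_lfunE scale_lfunE pE qE.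
  by rewrite (polyactD (AS i)) (polyactCM (AS i)) (actA (AS i)).
pose gamH : 'Hom('End(S i), V) := linfun gam.
have gamE f : gamH f = gam f by rewrite /gamH lfun_linfun.
pose h l : 'Hom(S i, V) := linfun (fun s' : S i => gamH (outer l s')).
have hE l s' : h l s' = gam (outer l s').
  by rewrite /h lfun_linfun ?gamE // => c x y; rewrite outer_linear linearP.
exists (fun l => Mproj (avg s (h l))).
have avE l s' : Mval (Mproj (avg s (h l))) s' =
    \sum_(t <- s) op V t.1 (gamH (outer l (op (S i) t.2 s'))).
  rewrite MprojK; last exact: sA (AS i) AV _.
  rewrite /avg sum_lfunE; apply: eq_bigr => t _.
  by rewrite comp_lfunE comp_lfunE hE -gamE.
under eq_bigr => l _ do rewrite avE.
rewrite exchange_big -[RHS](s1 V AV (eV i v)); apply: eq_bigr => t _.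
rewrite -linear_sum; congr (op V _ _).
rewrite -linear_sum -outer_sum /= gamE (@gamP _ (t.2.1%:P * 'X^(t.2.2))).
  rewrite (polyactCM AV) -['X^_]mul1r (polyactMXn AV) opE; congr (tm_act V _ _).
  by rewrite /polyact size_poly1 big_ord1 coef1 (act1 AV).
have E u : op (S i) t.2 u = polyact (t.2.1%:P * 'X^(t.2.2)) u.
  rewrite (polyactCM (AS i)) -['X^_]mul1r (polyactMXn (AS i)) opE.
  congr (tm_act (S i) _ _).
  by rewrite /polyact size_poly1 big_ord1 coef1 (act1 (AS i)).
move=> u; rewrite projv_id ?E //; apply/PSP.
by exists (t.2.1%:P * 'X^(t.2.2)).
Qed.

(** Coordinates that are only k0-linear are read off from [generated] on a basis of V and then
    averaged. The identity survives because the maps [Mval] and [eV i] are A_beta-linear. *)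
Lemma dual_basis i : exists p : 'I_(\dim {:M i}) -> 'Hom(V, S i),
  (forall a, Abeta_hom (p a)) /\
  forall v, \sum_(a < \dim {:M i}) Mval (vbasis {:M i})`_a (p a v) = eV i v.
Proof.
have [s [sA s1]] := separability F Hnm Hinv Hb.
have /fin_all_exists[g gE] (b : 'I_(\dim {:V})) := generated i (vbasis {:V})`_b.
pose q a : 'Hom(V, S i) := \sum_b outer b
  (\sum_l coord (vbasis {:M i}) a (g b l) *: (vbasis {:S i})`_l).
have qE v : \sum_(a < \dim {:M i}) Mval (vbasis {:M i})`_a (q a v) = eV i v.
  rewrite {2}(coord_vbasis (memvf v)) linear_sum.
  under eq_bigr => a _ do rewrite /q sum_lfunE linear_sum.
  rewrite exchange_big; apply: eq_bigr => b _ /=.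
  rewrite linearZ /= -gE scaler_sumr.
  under eq_bigr => a _ do rewrite outerE linearZ /= linear_sum scaler_sumr.
  rewrite exchange_big; apply: eq_bigr => l _ /=.
  rewrite -scaler_sumr; congr (_ *: _).
  rewrite {2}(coord_vbasis (memvf (g b l))) /Mval linear_sum sum_lfunE.
  by apply: eq_bigr => a _; rewrite !linearZ scale_lfunE.
exists (fun a => avg s (q a)); split=> [a|v]; first exact: sA AV (AS i) _.
rewrite -[RHS](s1 V AV).
under eq_bigr => a _.
  rewrite /avg sum_lfunE linear_sum.
  over.
rewrite exchange_big; apply: eq_bigr => t _ /=.
have [eF eT] := eV_Ahom i.
have opA (f : 'Hom(S i, V)) (fA : Abeta_hom f) w u : f (op (S i) w u) = op V w (f u).
  case: fA => fF fT; rewrite !opE fF; congr (tm_act V _ _).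
  by elim: w.2 => //= r <-.
have -> : op V t.2 (eV i v) = eV i (op V t.2 v).
  rewrite !opE eF; congr (tm_act V _ _).
  by elim: t.2.2 => //= r ->.
rewrite -qE linear_sum; apply: eq_bigr => a _.
by rewrite comp_lfunE comp_lfunE opA //; apply: Mval_Ahom.
Qed.

Definition dualM i : 'I_(\dim {:M i}) -> 'Hom(V, S i) :=
  projT1 (cid (dual_basis i)).

Lemma dualM_Ahom i a : Abeta_hom (@dualM i a).
Proof. by rewrite /dualM; case: cid => p [pA pE] /=. Qed.

Lemma dualME i v : \sum_(a < \dim {:M i}) Mval (vbasis {:M i})`_a (dualM a v) = eV i v.
Proof. by rewrite /dualM; case: cid => p [pA pE] /=. Qed.

Lemma dualM_ev i j (a : 'I_(\dim {:M j})) (u : S i) x : j != i -> dualM a (ev u x) = 0.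
Proof.
move=> ji; rewrite -[ev u x](_ : eV i (ev u x) = _); last by rewrite eV_ev eqxx.
rewrite /eV (cact_hom Hnm Hinv _ _ AV (AS j) (dualM_Ahom a)) cact_idemS.
by rewrite eq_sym (negPf ji).
Qed.

Lemma decomp v : v = \sum_i \sum_(a < \dim {:M i}) ev (dualM a v) (vbasis {:M i})`_a.
Proof.
rewrite -{1}(sum_eV v); apply: eq_bigr => i _; rewrite -dualME.
by apply: eq_bigr => a _; rewrite evE.
Qed.

(** Coefficients over D_i with respect to a k0-basis of M_i. They form a redundant system, but it
    suffices to recover a D_i-linear map from its values on the basis without choosing a
    D_i-basis. *)
Definition dcoef i (x : M i) a : D i := Dproj (dualM a \o Mval x)%VF.

Lemma dcoefE i (x : M i) a u : Dval (dcoef x a) u = dualM a (ev u x).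
Proof.
rewrite /dcoef DprojK; first by rewrite comp_lfunE evE.
have [pF pT] := dualM_Ahom a; have [xF xT] := Mval_Ahom x.
by split=> *; rewrite !comp_lfunE ?xF ?pF ?xT ?pT.
Qed.

Lemma dcoef_sum i (x : M i) : x = \sum_(a < \dim {:M i}) Dact (dcoef x a) (vbasis {:M i})`_a.
Proof.
apply: ev_inj => u; rewrite linear_sum {1}[ev u x]decomp (bigD1 i) //=.
rewrite [X in _ + X]big1 ?addr0 => [|j ji].
  by apply: eq_bigr => a _; rewrite -ev_Dval dcoefE.
by apply: big1 => a _; rewrite dualM_ev // evE linear0.
Qed.

End VertexComponents.

(** * The commutant of A_beta after extension of scalars *)

Section Commutant.
Variables (k0 : fieldType) (k : fieldExtType k0) (sigk : {rmorphism k -> k}).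
Variables (n m : nat) (beta : k) (F : cyclic_algebra sigk n).
Variable R : comAlgType k0.
Local Notation isA := (is_Abeta_module m beta).
Implicit Types (U W : theta_module F).
Hypotheses (Hnm : (n %| m)%N) (Hinv : ((m %/ n)%:R : k) != 0)
  (Hb : beta != 0).

Definition commA U W (g : 'M[R]_(\dim {:W}, \dim {:U})) : Prop :=
  (forall a, g *m tensf R (tm_act U a) = tensf R (tm_act W a) *m g) /\
  g *m tensf R (theta U) = tensf R (theta W) *m g.

Lemma commA_op U W (g : 'M[R]_(\dim {:W}, \dim {:U})) w :
  commA g -> g *m tensf R (op U w) = tensf R (op W w) *m g.
Proof.
move=> [gF gT]; case: w => a j; rewrite /op !tensf_comp /= mulmxA gF -!mulmxA.
congr (_ *m _).
have opS (X : theta_module F) r :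
    linfun (iter r.+1 (theta X)) = (theta X \o linfun (iter r (theta X)))%VF.
  apply/lfunP=> x; rewrite comp_lfunE !lfun_linfun //; exact: iter_theta_linear.
elim: j => [|j IH]; last by rewrite !opS !tensf_comp mulmxA gT -!mulmxA IH.
have op0 (X : theta_module F) : linfun (iter 0 (theta X)) = \1%VF.
  by apply/lfunP=> x; rewrite lfun_linfun ?id_lfunE // => c u v.
by rewrite !op0 !tensf1 mulmx1 mul1mx.
Qed.

Lemma mx_tensf_sum (U W : vectType k0) (g : 'M[R]_(\dim {:W}, \dim {:U})) :
  exists f : 'I_(\dim {:W}) -> 'I_(\dim {:U}) -> 'Hom(U, W),
    g = \sum_a \sum_b g a b *: tensf R (f a b).
Proof.
exists (fun a b => hommx (vbasis {:U}) (vbasis {:W}) (delta_mx b a)).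
rewrite {1}(matrix_sum_delta g); apply: eq_bigr => a _; apply: eq_bigr => b _.
by rewrite /tensf hommxK ?vbasisP // map_delta_mx trmx_delta.
Qed.

(* Averaging shows that the commutant commutes with base change to R. *)
Lemma commA_span U W (g : 'M[R]_(\dim {:W}, \dim {:U})) : isA U -> isA W ->
  commA g ->
  exists (I : finType) (r : I -> R) (f : I -> 'Hom(U, W)),
    (forall i, Abeta_hom (f i)) /\ g = \sum_i r i *: tensf R (f i).
Proof.
move=> AU AW gA; have [s [sA s1]] := separability F Hnm Hinv Hb.
have [f gE] := mx_tensf_sum g.
exists ('I_(\dim {:W}) * 'I_(\dim {:U}))%type, (fun i => g i.1 i.2),
  (fun i => avg s (f i.1 i.2)); split=> [i|]; first exact: sA.
rewrite -(pair_big predT predT (fun a b => g a b *: tensf R (avg s (f a b)))) /=.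
(* The average of g is g itself since g commutes with all operators; expanding g before averaging
   distributes the average over the maps [f a b]. *)
transitivity (\sum_(w <- s) tensf R (op W w.1) *m (g *m tensf R (op U w.2))).
  under eq_bigr => w _ do rewrite commA_op // mulmxA.
  rewrite -mulmx_suml -[LHS]mul1mx; congr (_ *m _).
  rewrite -tensf1; under eq_bigr => w _ do rewrite -tensf_comp.
  rewrite -tensf_sum; congr (tensf R _); apply/lfunP=> u.
  rewrite id_lfunE sum_lfunE -[LHS](s1 W AW); apply: eq_bigr => w _.
  by rewrite comp_lfunE.
under [LHS]eq_bigr => w _.
  rewrite {1}gE mulmx_suml mulmx_sumr.
  under eq_bigr => a _ do rewrite mulmx_suml mulmx_sumr.
  over.
rewrite exchange_big; apply: eq_bigr => a _.
rewrite exchange_big; apply: eq_bigr => b _.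
rewrite /avg tensf_sum scaler_sumr; apply: eq_bigr => w _.
by rewrite !tensf_comp -scalemxAl -scalemxAr.
Qed.

End Commutant.

(** * Components of R-points at the vertices *)

Section RComponents.
Variables (k0 : fieldType) (k : fieldExtType k0) (sigk : {rmorphism k -> k}).
Variables (n m : nat) (beta : k) (F : cyclic_algebra sigk n).
Variables (V : polarized_space m beta F) (xi : F) (Q : quiver V xi).
Local Notation S := (Smod (q0 := Q)).
Implicit Types (i j : Q).

Let Hnm := n_dvd_m V.
Let Hinv := mn_inv V.
Let Hb := beta_neq0 V.

(** The map [outer l v] is not A_beta-linear in general, so [Mproj] is used here as an arbitrary
    k0-linear projection onto M_i. The outcome is a joint left inverse of the maps [ev u], which
    makes them jointly injective over every R. *)
Definition rho i (l : 'I_(\dim {:S i})) : 'Hom(V, M i) :=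
  linfun (fun v : V => Mproj (outer l v)).

Lemma rhoE i l v : @rho i l v = Mproj (outer l v).
Proof.
rewrite /rho lfun_linfun // => c x y.
by rewrite outer_linear /Mproj linearP.
Qed.

Lemma rho_ev i : (\sum_l (@rho i l \o ev (vbasis {:S i})`_l) = \1)%VF.
Proof.
apply/lfunP=> x; rewrite id_lfunE sum_lfunE -[RHS]MvalK (outer_sum (Mval x)).
rewrite /Mproj linear_sum; apply: eq_bigr => l _.
by rewrite comp_lfunE rhoE evE.
Qed.

Definition EndA (f : 'End(V)) i : 'End(M i) :=
  linfun (fun x : M i => Mproj (f \o Mval x)%VF).

Lemma EndA_ev f i (u : S i) x : Abeta_hom f -> f (ev u x) = ev u (EndA f i x).
Proof.
move=> [fF fT]; rewrite !evE /EndA lfun_linfun => [|c y z].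
  rewrite MprojK ?comp_lfunE //; have [xF xT] := Mval_Ahom x.
  by split=> *; rewrite !comp_lfunE ?xF ?xT ?fF ?fT.
by rewrite Mval_linear comp_lfunDr -comp_lfunZr /Mproj linearP.
Qed.

Variable R : comAlgType k0.
Local Notation EndV := 'M[R]_(\dim {:V}).
Local Notation EndM i := 'M[R]_(\dim {:M i}).

(** The formula is R-linear in the entries of g with coefficients from k0, so it is natural in R. It
    is the component of g once g commutes with A_beta. *)
Definition comp (g : EndV) i : EndM i :=
  \sum_l tensf R (rho l) *m g *m tensf R (ev (vbasis {:S i})`_l).

Lemma comp_unique g i (gi : EndM i) : is_vertex_component g gi -> comp g i = gi.
Proof.
move=> gP; rewrite /comp; under eq_bigr => l _ do rewrite -mulmxA gP mulmxA -tensf_comp.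
by rewrite -mulmx_suml -tensf_sum rho_ev tensf1 mul1mx.
Qed.

Lemma tensf_ev_inj i p (w w' : 'M[R]_(\dim {:M i}, p)) :
  (forall u : S i, tensf R (ev u) *m w = tensf R (ev u) *m w') -> w = w'.
Proof.
move=> ww; rewrite -[w]mul1mx -[w']mul1mx -tensf1 -rho_ev tensf_sum !mulmx_suml.
by apply: eq_bigr => l _; rewrite tensf_comp -!mulmxA ww.
Qed.

Lemma tensf_ev_ext p (g h : 'M[R]_(p, \dim {:V})) :
  (forall i (u : S i), g *m tensf R (ev u) = h *m tensf R (ev u)) -> g = h.
Proof.
move=> gh; apply: tens_mx_ext => v; rewrite (decomp Q v) tens1_sum !mulmx_sumr.
apply: eq_bigr => i _; rewrite tens1_sum !mulmx_sumr; apply: eq_bigr => a _.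
by rewrite -tensfE !mulmxA gh.
Qed.

(** By [commA_span], g is an R-combination of A_beta-endomorphisms of V over k0, and these act on
    M_i by composition. *)
Lemma compP g i : commA g -> is_vertex_component g (comp g i).
Proof.
move=> gA; have [I [r [f [fA gE]]]] := commA_span Hnm Hinv Hb (AV V) (AV V) gA.
suff h : is_vertex_component g (\sum_b r b *: tensf R (EndA (f b) i)).
  by rewrite (comp_unique h).
move=> u; rewrite gE mulmx_suml mulmx_sumr; apply: eq_bigr => b _.
rewrite -scalemxAl -scalemxAr -!tensf_comp; congr (_ *: tensf R _).
by apply/lfunP=> x; rewrite !comp_lfunE (EndA_ev _ _ (fA b)).
Qed.

Lemma vcomp_mul g h i (gi hi : EndM i) :
  is_vertex_component g gi -> is_vertex_component h hi ->
  is_vertex_component (g *m h) (gi *m hi).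
Proof. by move=> gP hP u; rewrite -mulmxA hP mulmxA gP mulmxA. Qed.

Lemma vcomp1 i : is_vertex_component (1%:M : EndV) (1%:M : EndM i).
Proof. by move=> u; rewrite mul1mx mulmx1. Qed.

Lemma comp1 i : comp 1%:M i = 1%:M.
Proof. exact/comp_unique/vcomp1. Qed.

Lemma compM g h i : commA g -> commA h -> comp (g *m h) i = comp g i *m comp h i.
Proof. by move=> gA hA; apply/comp_unique/vcomp_mul; apply: compP. Qed.

Lemma commA1 : commA (1%:M : EndV).
Proof. by split=> *; rewrite mul1mx mulmx1. Qed.

Lemma commA_mul (g h : EndV) : commA g -> commA h -> commA (g *m h).
Proof.
move=> [gF gT] [hF hT]; split=> *; rewrite -mulmxA.
  by rewrite hF mulmxA gF mulmxA.
by rewrite hT mulmxA gT mulmxA.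
Qed.

Lemma commA_inv (g h : EndV) : is_inverse_mx g h -> commA g -> commA h.
Proof.
move=> [gh hg] [gF gT].
have E (t : EndV) : g *m t = t *m g -> h *m t = t *m h.
  by move=> gt; rewrite -[h *m t]mulmx1 -gh mulmxA -(mulmxA h) -gt (mulmxA h) hg mul1mx.
by split=> *; apply: E.
Qed.

Lemma comp_inv g h i : is_inverse_mx g h -> commA g ->
  is_inverse_mx (comp g i) (comp h i).
Proof.
move=> gh gA; have hA := commA_inv gh gA; case: gh => gh hg.
by split; rewrite -compM // ?gh ?hg comp1.
Qed.

Lemma comp_Dact g i (d : D i) : commA g ->
  comp g i *m tensf R (Dact d) = tensf R (Dact d) *m comp g i.
Proof.
move=> gA; apply: tensf_ev_inj => u; have gP := compP (i := i) gA.
have evD : (ev u \o Dact d)%VF = ev (Dval d u).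
  by apply/lfunP=> x; rewrite comp_lfunE ev_Dval.
by rewrite !mulmxA -gP -!mulmxA -!tensf_comp evD gP -evD tensf_comp mulmxA.
Qed.

(** Inverse of [comp]: a vector is cut by the dual bases [dualM] and reassembled with the images
    under [c i] of the basis vectors of M_i. Linearity over D_i makes this independent of the
    redundancy of the coefficients. *)
Definition asm (c : forall i, EndM i) : EndV :=
  \sum_i \sum_(a < \dim {:M i})
    lin_ext (fun x : M i => tensf R (Mval x))
      (c i *m tens1 R (vbasis {:M i})`_a) *m tensf R (dualM a).

Lemma lin_ext_Mval i (w : 'cV[R]_(\dim {:M i})) (u : S i) :
  lin_ext (fun x : M i => tensf R (Mval x)) w *m tens1 R u = tensf R (ev u) *m w.
Proof.
rewrite {2}(tens1_col w) /lin_ext mulmx_suml mulmx_sumr.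
apply: eq_bigr => s _; rewrite -scalemxAl -scalemxAr; congr (_ *: _).
by rewrite !tensfE evE.
Qed.

Lemma asmP (c : forall i, EndM i) i :
  (forall d : D i, c i *m tensf R (Dact d) = tensf R (Dact d) *m c i) ->
  is_vertex_component (asm c) (c i).
Proof.
move=> cD u; apply: tens_mx_ext => x; rewrite -!mulmxA tensfE.
rewrite /asm mulmx_suml (bigD1 i) //= [X in _ + X]big1 ?addr0 => [|j ji].
  rewrite mulmx_suml {2}(dcoef_sum x) tens1_sum !mulmx_sumr.
  apply: eq_bigr => a _; rewrite -mulmxA tensfE lin_ext_Mval -dcoefE.
  have evD d : ev (Dval d u) = (ev u \o Dact d)%VF.
    by apply/lfunP=> y; rewrite comp_lfunE ev_Dval.
  by rewrite evD tensf_comp -mulmxA (mulmxA _ (c i)) -cD -mulmxA tensfE.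
rewrite mulmx_suml; apply: big1 => a _.
by rewrite -mulmxA tensfE dualM_ev // tens10 mulmx0.
Qed.

Lemma commA_of_vcomp g (c : forall i, EndM i) :
  (forall i, is_vertex_component g (c i)) -> commA g.
Proof.
move=> gc; split=> [a|]; apply: tensf_ev_ext => i u; rewrite -mulmxA -tensf_comp.
  have -> : (tm_act V a \o ev u)%VF = ev (tm_act (S i) a u).
    by apply/lfunP=> x; rewrite comp_lfunE act_ev.
  rewrite gc -[RHS]mulmxA gc mulmxA -tensf_comp; congr (tensf R _ *m _).
  by apply/lfunP=> x; rewrite comp_lfunE act_ev.
have -> : (theta V \o ev u)%VF = ev (theta (S i) u).
  by apply/lfunP=> x; rewrite comp_lfunE theta_ev.
rewrite gc -[RHS]mulmxA gc mulmxA -tensf_comp; congr (tensf R _ *m _).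
by apply/lfunP=> x; rewrite comp_lfunE theta_ev.
Qed.

End RComponents.

(** * Components of twisted endomorphisms at the arrows *)

Section Arrows.
Variables (k0 : fieldType) (k : fieldExtType k0) (sigk : {rmorphism k -> k}).
Variables (n m : nat) (beta : k) (F : cyclic_algebra sigk n).
Variables (V : polarized_space m beta F) (xi : F) (Q : quiver V xi).
Local Notation S := (Smod (q0 := Q)).
Local Notation xb := (xibar Q).
Implicit Types (i j : Q).

(* Hom_{A_beta}(V^xi, V) *)
Definition twisted (phi : 'End(V)) : Prop :=
  (forall a x, phi (tm_act V a x) = tm_act V a (phi x)) /\
  (forall x, theta V (phi x) = tm_act V xi (phi (theta V x))).

Lemma eta_lker0 i : lker (eta i (xb i)) == 0%VS.
Proof. by have [_ bij] := eta_iso i; apply/lker0P/bij_inj. Qed.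

Lemma etaK i u : (eta i (xb i))^-1%VF (eta i (xb i) u) = u.
Proof. exact: lker0_lfunK (eta_lker0 i) u. Qed.

Lemma etaVK i u : eta i (xb i) ((eta i (xb i))^-1%VF u) = u.
Proof.
by have [_ [g gK Kg]] := eta_iso i; rewrite -[u]Kg etaK.
Qed.

Lemma eta_act i a u : eta i (xb i) (tm_act (S i) a u) = tm_act (S (xb i)) a (eta i (xb i) u).
Proof. by have [[eF _] _] := eta_iso i; apply: eF. Qed.

Lemma eta_theta i u : eta i (xb i) (tm_act (S i) xi (theta (S i) u)) =
  theta (S (xb i)) (eta i (xb i) u).
Proof. by have [[_ eT] _] := eta_iso i; rewrite -eT /= lfunE. Qed.

Definition acomp (phi : 'End(V)) i : 'Hom(M i, M (xb i)) :=
  linfun (fun x : M i => Mproj (phi \o (Mval x \o (eta i (xb i))^-1))%VF).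

Lemma acompE phi i x : acomp phi i x = Mproj (phi \o (Mval x \o (eta i (xb i))^-1))%VF.
Proof.
rewrite /acomp lfun_linfun // => c y z.
rewrite Mval_linear comp_lfunDl -comp_lfunZl comp_lfunDr -comp_lfunZr.
by rewrite /Mproj linearP.
Qed.

Lemma acomp_linear i : linear (acomp ^~ i).
Proof.
move=> c phi psi; apply/lfunP=> x; rewrite add_lfunE scale_lfunE !acompE.
by rewrite comp_lfunDl -comp_lfunZl /Mproj linearP.
Qed.

Lemma acompP phi i : twisted phi -> is_arrow_component phi (acomp phi i).
Proof.
move=> [pF pT] u x; rewrite [RHS]evE acompE MprojK.
  by rewrite !comp_lfunE etaK evE.
have [xF xT] := Mval_Ahom x; split=> [a w|w]; rewrite !comp_lfunE /=.
  by rewrite -{1}[w]etaVK -eta_act etaK xF pF.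
by rewrite -{1}[w]etaVK -eta_theta etaK xF xT pF pT.
Qed.

Lemma acomp_unique phi i psi : is_arrow_component phi psi -> acomp phi i = psi.
Proof.
move=> pP; apply/lfunP=> x; rewrite acompE -[RHS]MvalK; congr Mproj.
apply/lfunP=> w; rewrite !comp_lfunE -[in RHS](etaVK w) -evE pP evE.
by rewrite -evE.
Qed.

Lemma acomp_Dhom phi i : twisted phi -> is_Dhom (acomp phi i).
Proof.
move=> pT d x; have pP := acompP (i := i) pT.
apply: ev_inj => w; rewrite -[w]etaVK; set u := (eta i (xb i))^-1%VF w.
by rewrite -pP -ev_Dval pP flatP ev_Dval.
Qed.

Definition asmA (psi : forall i, 'Hom(M i, M (xb i))) : 'End(V) :=
  \sum_i \sum_(a < \dim {:M i})
    (Mval (psi i (vbasis {:M i})`_a) \o (eta i (xb i) \o dualM a))%VF.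

Lemma asmAP psi i : is_Dhom (psi i) -> is_arrow_component (asmA psi) (psi i).
Proof.
move=> pD u x; rewrite /asmA sum_lfunE (bigD1 i) //= [X in _ + X]big1 ?addr0.
  rewrite {2}(dcoef_sum x) linear_sum linear_sum sum_lfunE; apply: eq_bigr => a _ /=.
  by rewrite !comp_lfunE pD -ev_Dval -flatP dcoefE [RHS]evE.
move=> j ji; rewrite sum_lfunE; apply: big1 => a _.
by rewrite !comp_lfunE dualM_ev // !linear0.
Qed.

Lemma ev_ext (f g : 'End(V)) :
  (forall i (u : S i) x, f (ev u x) = g (ev u x)) -> f = g.
Proof.
move=> fg; apply/lfunP=> v; rewrite (decomp Q v) !linear_sum.
by apply: eq_bigr => i _; rewrite !linear_sum; apply: eq_bigr => a _; apply: fg.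
Qed.

Lemma twisted_of_acomp phi (psi : forall i, 'Hom(M i, M (xb i))) :
  (forall i, is_arrow_component phi (psi i)) -> twisted phi.
Proof.
move=> pP; split=> [a v|v].
  suff /lfunP/(_ v) : (phi \o tm_act V a)%VF = (tm_act V a \o phi)%VF.
    by rewrite !comp_lfunE.
  by apply: ev_ext => i u x; rewrite !comp_lfunE act_ev !pP act_ev eta_act.
suff /lfunP/(_ v) : (theta V \o phi)%VF = (tm_act V xi \o (phi \o theta V))%VF.
  by rewrite !comp_lfunE.
apply: ev_ext => i u x; rewrite !comp_lfunE theta_ev !pP theta_ev act_ev.
by rewrite -eta_theta eta_act.
Qed.

End Arrows.

(** * Pairings *)

Section Pairings.
Variables (k0 : fieldType) (k : fieldExtType k0) (sigk : {rmorphism k -> k}).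
Variables (n m : nat) (beta : k) (F : cyclic_algebra sigk n).
Local Notation isA := (is_Abeta_module m beta).
Local Notation sig := (sigma F).
Implicit Types (U W : theta_module F) (c : F).
Hypotheses (Hnm : (n %| m)%N) (Hinv : ((m %/ n)%:R : k) != 0)
  (Hb : beta != 0).

Lemma perfect_inj_r U W (B : U -> W -> F) w w' : perfect B ->
  F_linear_l B -> sigma_linear_r B ->
  (forall u, B u w = B u w') -> w = w'.
Proof.
move=> [_ Bp] [BD BF] _ ww; have [|//|v [_ vU]] := Bp (fun u => B u w).
  by move=> *; apply: BD.
by rewrite -(vU w) // (vU w').
Qed.

Lemma perfect_inj_l U W (B : U -> W -> F) u u' : perfect B ->
  F_linear_l B -> sigma_linear_r B ->
  (forall w, B u w = B u' w) -> u = u'.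
Proof.
move=> [Bp _] _ [BD BF] uu; have [|//|v [_ vU]] := Bp (fun w => B u w).
  by move=> *; apply: BD.
by rewrite -(vU u) // (vU u').
Qed.

Lemma sigma_linear_r0 U W (B : U -> W -> F) u : sigma_linear_r B -> B u 0 = 0.
Proof. by move=> [_ BF]; rewrite -(linear0 (tm_act W 0)) BF rmorph0 mul0r. Qed.

Lemma perfect_tr U W (B : U -> W -> F) :
  perfect B -> perfect (fun w u => sig (B u w)).
Proof.
move=> [B1 B2]; have sK := @sigmaK _ _ _ _ F; split=> f fD fF.
  have [||w [wE wU]] := B2 (fun u => sig (f u)).
  - by move=> *; rewrite fD rmorphD.
  - by move=> a u; rewrite fF rmorphM sK.
  exists w; split=> [u|w' w'E]; first by rewrite wE sK.
  by apply: wU => u; rewrite -w'E sK.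
have [||w [wE wU]] := B1 (fun u => sig (f u)).
- by move=> *; rewrite fD rmorphD.
- by move=> a u; rewrite fF rmorphM.
exists w; split=> [u|w' w'E]; first by rewrite wE sK.
by apply: wU => u; rewrite -w'E sK.
Qed.

Lemma admissible_tr U W (B : U -> W -> F) c : sig c = c ->
  admissible B c -> admissible (fun w u => sig (B u w)) c.
Proof.
move=> sc [[BlD BlF] [BrD BrF] BT]; have sK := @sigmaK _ _ _ _ F; split; first split.
- by move=> *; rewrite BrD rmorphD.
- by move=> a w u; rewrite BrF rmorphM sK.
- split; first by move=> *; rewrite BlD rmorphD.
  by move=> a w u; rewrite BlF rmorphM.
by move=> w u; rewrite BT rmorphM sc sigma_zeta.
Qed.

Lemma perfect_map U W1 W2 (B1 : U -> W1 -> F) (B2 : U -> W2 -> F) :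
  isA U -> isA W1 -> isA W2 ->
  perfect B1 -> F_linear_l B1 -> sigma_linear_r B1 ->
  F_linear_l B2 -> sigma_linear_r B2 ->
  exists T : 'Hom(W2, W1), (forall u w, B2 u w = B1 u (T w)) /\
    forall a w, T (tm_act W2 a w) = tm_act W1 a (T w).
Proof.
move=> AU AW1 AW2 B1p B1l B1r [B2D B2F] [B2rD B2rF].
have ex w : exists w', forall u, B2 u w = B1 u w'.
  have [_ Bp] := B1p; have [||v [vE _]] := Bp (fun u => B2 u w).
  - by move=> *; apply: B2D.
  - by move=> *; apply: B2F.
  by exists v => u; rewrite vE.
pose T w := projT1 (cid (ex w)).
have TE w u : B2 u w = B1 u (T w) by rewrite /T; case: cid => w' /= ->.
have inj := perfect_inj_r B1p B1l B1r; have [B1rD B1rF] := B1r.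
have TF a w : T (tm_act W2 a w) = tm_act W1 a (T w).
  by apply: inj => u; rewrite -TE B2rF B1rF TE.
have TL : linear T.
  move=> a w w'; apply: inj => u.
  by rewrite -TE B2rD B1rD !TE -(actA AW2) -(actA AW1) TF.
by exists (linfun T); split=> [u w|a w]; rewrite !lfun_linfun.
Qed.

(** Admissible pairings with the same left module and the same similitude factor differ by an
    A_beta-homomorphism of the right modules; compatibility with theta is tested on vectors theta u,
    which exhaust U. A nonzero pairing is thereby turned into a nonzero homomorphism. *)
Lemma perfect_hom U W1 W2 (B1 : U -> W1 -> F) (B2 : U -> W2 -> F) c :
  isA U -> isA W1 -> isA W2 -> perfect B1 -> admissible B1 c ->
  admissible B2 c ->
  exists T : 'Hom(W2, W1), Abeta_hom T /\ forall u w, B2 u w = B1 u (T w).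
Proof.
move=> AU AW1 AW2 B1p [B1l B1r B1T] [B2l B2r B2T].
have [T [TE TF]] := perfect_map AU AW1 AW2 B1p B1l B1r B2l B2r.
exists T; split=> //; split=> // w; apply: (perfect_inj_r B1p) => // u.
have [u' ->] := iter_theta_surj Hinv Hb 1 AU u; rewrite /=.
by rewrite -TE B2T B1T TE.
Qed.

End Pairings.

(** * Orthogonality and the involution, from homomorphisms between simple modules *)

Section QuiverPairings.
Variables (k0 : fieldType) (k : fieldExtType k0) (sigk : {rmorphism k -> k}).
Variables (n m : nat) (beta : k) (F : cyclic_algebra sigk n).
Variables (V : polarized_space m beta F) (xi : F) (Q : quiver V xi).
Variable P : quiver_pairings Q.
Hypothesis xi_unit : xi \is a GRing.unit.
Hypothesis xi_fixed : sigma F xi = xi.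
Local Notation S := (Smod (q0 := Q)).
Local Notation xb := (xibar Q).
Local Notation sig := (sigma F).
Local Notation B := (vform (p := V)).
Implicit Types (i j : Q).

Let Hnm := n_dvd_m V.
Let Hinv := mn_inv V.
Let Hb := beta_neq0 V.

Lemma Ahom_vertex i j (T : 'Hom(S i, S j)) : Abeta_hom T -> i <> j -> T = 0.
Proof.
move=> TA ij; apply/lfunP=> u; rewrite lfunE /=.
have := cact_hom Hnm Hinv (idem i) u (AS i) (AS j) TA.
by rewrite !cact_idemS eqxx; have /eqP/negPf -> := ij.
Qed.

Lemma spair_neq0 i : ~ (forall (u : S i) (v : S (dia i)), spair P u v = 0).
Proof.
move=> s0; have [u /eqP u0] := S_neq0 i; apply: u0.
have [sl sr _] := spair_admissible P i.
apply: (perfect_inj_l (spair_perfect P i) sl sr) => w.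
by rewrite !s0.
Qed.

(** The transposed pairing of S_{dia i} with S_i, compared with the given pairing at dia i, yields a
    nonzero homomorphism from S_i to S_{dia (dia i)}. *)
Lemma diaK i : dia (dia i) = i.
Proof.
apply: contrapT => ne.
have [T [TA TE]] := perfect_hom Hinv Hb (AS _) (AS _) (AS _) (spair_perfect P (dia i))
  (spair_admissible P (dia i))
  (admissible_tr (pol_c_fixed V) (spair_admissible P i)).
apply: (@spair_neq0 i) => u v; rewrite -[LHS](@sigmaK _ _ _ _ F) TE.
rewrite (Ahom_vertex TA) => [|e]; last exact: ne (esym e).
rewrite lfunE /=; have [_ sr _] := spair_admissible P (dia i).
by rewrite (sigma_linear_r0 _ sr) rmorph0.
Qed.

(** The pairing at [xb i], transported by [eta] on the left and its inverse on the right, is still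
    admissible for c: the factors xi^-1 and sigma(xi) cancel. Comparison with the pairing at i gives
    a nonzero homomorphism into S_{dia i}. *)
Lemma xibar_dia i : xb (dia (xb i)) = dia i.
Proof.
apply: contrapT => ne; set j := dia (xb i) in ne *.
have [[sD sF] [srD srF] sT] := spair_admissible P (xb i).
pose B2 (u : S i) (v : S (xb j)) := spair P (eta i (xb i) u) ((eta j (xb j))^-1%VF v).
have B2a : admissible B2 (pol_c V).
  rewrite /B2; split; first split.
  - by move=> *; rewrite linearD sD.
  - by move=> *; rewrite eta_act sF.
  - split; first by move=> *; rewrite linearD srD.
    by move=> a u w; rewrite -[w]etaVK -eta_act !etaK srF.
  move=> u w; rewrite -[w]etaVK -eta_theta !etaK.
  have -> : theta (S i) u = tm_act (S i) xi^-1 (tm_act (S i) xi (theta (S i) u)).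
    by rewrite (act_unitVK (AS i)).
  by rewrite eta_act eta_theta sF srF sT xi_fixed mulrA mulVr // mul1r.
have [T [TA TE]] := perfect_hom Hinv Hb (AS _) (AS _) (AS _) (spair_perfect P i)
  (spair_admissible P i) B2a.
apply: (@spair_neq0 (xb i)) => u v.
have := TE ((eta i (xb i))^-1%VF u) (eta j (xb j) v).
rewrite /B2 etaVK etaK => ->; rewrite (Ahom_vertex TA ne) lfunE /=.
have [_ sr _] := spair_admissible P i.
exact: sigma_linear_r0.
Qed.

Lemma vformDl x y z : B (x + y) z = B x z + B y z.
Proof. by have [BD _] := vform_linear V. Qed.
Lemma vformFl a x y : B (tm_act V a x) y = a * B x y.
Proof. by have [_ BF] := vform_linear V. Qed.
Lemma vformZl (a : k0) x y : B (a *: x) y = a *: B x y.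
Proof. by rewrite -(actA (AV V)) vformFl mulr_algl. Qed.
Lemma vformDr x y z : B x (y + z) = B x y + B x z.
Proof.
by rewrite vform_sym vformDl rmorphD scalerDr -!vform_sym.
Qed.
Lemma vformFr a x y : B x (tm_act V a y) = sig a * B x y.
Proof. by rewrite vform_sym vformFl rmorphM scalerAr -vform_sym. Qed.
Lemma vformZr (a : k0) x y : B x (a *: y) = a *: B x y.
Proof. by rewrite -(actA (AV V)) vformFr sigma_alg mulr_algl. Qed.

Lemma vformBr x y z : B x (y - z) = B x y - B x z.
Proof. by rewrite -[- z]scaleN1r vformDr vformZr scaleN1r. Qed.
Lemma vformBl x y z : B (x - y) z = B x z - B y z.
Proof. by rewrite -[- y]scaleN1r vformDl vformZl scaleN1r. Qed.

Lemma vform_bilin : bilin B.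
Proof.
by split=> [y|x] a u v; rewrite ?vformDl ?vformDr ?vformZl ?vformZr.
Qed.

Lemma vform0l y : B 0 y = 0.
Proof. by rewrite -(scale0r (0 : V)) vformZl scale0r. Qed.
Lemma vform0r x : B x 0 = 0.
Proof. by rewrite -(scale0r (0 : V)) vformZr scale0r. Qed.

Lemma vform_lin_l : F_linear_l B.
Proof. exact: vform_linear. Qed.
Lemma vform_lin_r : sigma_linear_r B.
Proof. by split=> *; rewrite ?vformDr ?vformFr. Qed.

Lemma eps_sq : eps V * eps V = 1.
Proof. by case: (eps_sign V) => ->; rewrite ?mulrNN mulr1. Qed.

Lemma vform_nondeg_r y : (forall x, B x y = 0) -> y = 0.
Proof.
by move=> y0; apply: vform_nondeg => x; rewrite vform_sym y0 rmorph0 scaler0.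
Qed.

Lemma lfun_surj (X Y : vectType k0) (f : 'Hom(X, Y)) :
  injective f -> \dim {:X} = \dim {:Y} -> forall y, exists x, y = f x.
Proof.
move=> fi d y; have k0' : lker f == 0%VS by apply/lker0P.
have : (limg f == fullv)%VS.
  rewrite eqEdim subvf -d -(limg_ker_dim f fullv).
  by rewrite (eqP k0') capv0 dimv0 add0n leqnn.
move/eqP => e; have /memv_imgP[x _ ->] : y \in limg f by rewrite e memvf.
by exists x.
Qed.

(** Followed by the Frobenius form, the pairing embeds V in its k0-dual, and the embedding is onto
    by dimension. Multiplying by arbitrary elements of F then recovers equality of F-valued
    functions from equality of their images under [lam]. *)
Lemma vform_perfect : perfect B.
Proof.
have [lam lam0] := frobenius_form F.
have right (f : V -> F) : (forall u u', f (u + u') = f u + f u') ->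
    (forall a u, f (tm_act V a u) = a * f u) -> exists w, forall u, B u w = f u.
  move=> fD fF.
  have fZ (a : k0) u : f (a *: u) = a *: f u by rewrite -(actA (AV V)) fF mulr_algl.
  pose J0 w : 'Hom(V, k0^o) := linfun (fun u : V => lam (B u w)).
  have J0E w u : J0 w u = lam (B u w).
    by rewrite /J0 lfun_linfun // => a x y; rewrite vformDl vformZl linearP.
  pose J : 'Hom(V, 'Hom(V, k0^o)) := linfun J0.
  have JE w u : J w u = lam (B u w).
    rewrite /J lfun_linfun ?J0E // => a x y; apply/lfunP=> z.
    by rewrite add_lfunE scale_lfunE !J0E vformDr vformZr linearP.
  have Ji : injective J.
    move=> w w' /lfunP ww; apply/eqP; rewrite -subr_eq0; apply/eqP.
    apply: vform_nondeg_r => x; apply: lam0 => a; rewrite -vformFl.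
    have := ww (tm_act V a x); rewrite !JE => /eqP.
    rewrite -subr_eq0 -linearB => /eqP <-; congr (lam _).
    by rewrite vformBr.
  pose ff : 'Hom(V, k0^o) := linfun (fun u : V => lam (f u)).
  have ffE u : ff u = lam (f u).
    by rewrite /ff lfun_linfun // => a x y; rewrite fD fZ linearP.
  have [|w wE] := @lfun_surj _ _ J Ji _ ff.
    rewrite !dimvf /dim /=; exact: esym (muln1 _).
  exists w => u; apply/eqP; rewrite -subr_eq0; apply/eqP; apply: lam0 => a.
  rewrite mulrBr -vformFl -fF linearB /=; apply/eqP; rewrite subr_eq0.
  by rewrite -JE -wE ffE.
split=> f fD fF.
  have [||w wE] := right (fun u => sig (f u)).
  - by move=> *; rewrite fD rmorphD.
  - by move=> a u; rewrite fF rmorphM (@sigmaK _ _ _ _ F).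
  exists (eps V *: w); split=> [u|w' w'E].
    by rewrite vformZl vform_sym scalerA eps_sq scale1r wE (@sigmaK _ _ _ _ F).
  apply/eqP; rewrite -subr_eq0; apply/eqP; apply: vform_nondeg => u.
  rewrite vformBl w'E vformZl vform_sym scalerA.
  by rewrite eps_sq scale1r wE (@sigmaK _ _ _ _ F) subrr.
have [//|//|w wE] := right f; exists w; split=> // w' w'E.
apply/eqP; rewrite -subr_eq0; apply/eqP; apply: vform_nondeg_r => u.
by rewrite vformBr w'E wE subrr.
Qed.

Lemma vform_orth i j (u : S i) x (v : S j) y :
  j <> dia i -> B (ev u x) (ev v y) = 0.
Proof.
move=> ji.
have B2a : admissible (fun (u : S i) (v : S j) => B (ev u x) (ev v y)) (pol_c V).
  split; first by split=> *; rewrite ?evDl ?vformDl // -act_ev vformFl.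
    by split=> *; rewrite ?evDl ?vformDr // -act_ev vformFr.
  by move=> u' v'; rewrite -!theta_ev vform_theta.
have [T [TA TE]] := perfect_hom Hinv Hb (AS _) (AS _) (AS _) (spair_perfect P i)
  (spair_admissible P i) B2a.
rewrite TE (Ahom_vertex TA ji) lfunE /=.
have [_ sr _] := spair_admissible P i.
exact: sigma_linear_r0.
Qed.

Lemma mpairDE i j (x : M i) (y : M j) (u : S i) (v : S j) :
  j = dia i -> B (ev u x) (ev v y) = spair P (Dval (mpairD P x y) u) v.
Proof. by move=> e; subst j; rewrite !evE (mpairDP P). Qed.

Lemma spair_adm i j : j = dia i ->
  admissible (@spair _ _ _ _ _ _ _ _ _ _ P i j) (pol_c V).
Proof. by move=> ->; apply: spair_admissible. Qed.

Lemma spair_perf i j : j = dia i -> perfect (@spair _ _ _ _ _ _ _ _ _ _ P i j).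
Proof. by move=> ->; apply: spair_perfect. Qed.

Lemma spair_injl i j (u u' : S i) : j = dia i ->
  (forall v : S j, spair P u v = spair P u' v) -> u = u'.
Proof.
move=> e; have [sl sr _] := spair_adm e.
exact: perfect_inj_l (spair_perf e) sl sr.
Qed.

Lemma D_adjoint_l i j (d : D j) : j = dia i ->
  exists d' : D i, forall u v, spair P u (Dval d v) = spair P (Dval d' u) v.
Proof.
move=> e; have [[sD sF] [srD srF] sT] := spair_adm e; have [dF dT] := Dval_Ahom d.
have B2a : admissible (fun (u : S i) (v : S j) => spair P u (Dval d v)) (pol_c V).
  split; first by split=> *; rewrite ?sD // sF.
    by split=> *; rewrite ?linearD ?srD // dF srF.
  by move=> u v; rewrite dT sT.
have [T [TA TE]] := perfect_hom Hinv Hb (AS _) (AS _) (AS _) (perfect_tr (spair_perf e))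
  (admissible_tr (pol_c_fixed V) (spair_adm e)) (admissible_tr (pol_c_fixed V) B2a).
exists (Dproj T) => u v; rewrite DprojK //.
by apply: (can_inj (@sigmaK _ _ _ _ F)); apply: TE.
Qed.

Lemma mpairD_bilin i j : j = dia i ->
  bilin (fun (x : M i) (y : M j) => mpairD P x y).
Proof.
move=> e; have [[sD sF] _ _] := spair_adm e.
have sZ (a : k0) (u : S i) (v : S j) :
    spair P (a *: u) v = a *: (spair P u v : F) :> F.
  by rewrite -(actA (AS i)) sF mulr_algl.
split=> [y|x] a x1 x2; apply: Dval_inj => u; apply: (spair_injl e) => v;
  rewrite Dval_linear add_lfunE scale_lfunE sD sZ -!mpairDE //.
  by rewrite linearP vformDl vformZl.
by rewrite linearP vformDr vformZr.
Qed.

Lemma mpairD_Dactl i j (x : M i) (y : M j) (d : D i) : j = dia i ->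
  mpairD P (Dact d x) y = Dmul d (mpairD P x y).
Proof.
move=> e; apply: Dval_inj => u; apply: (spair_injl e) => v.
rewrite -mpairDE // -ev_Dval mpairDE // /Dmul DprojK ?comp_lfunE //.
have [d1 d2] := Dval_Ahom d; have [d3 d4] := Dval_Ahom (mpairD P x y).
by split=> *; rewrite !comp_lfunE ?d1 ?d2 ?d3 ?d4.
Qed.

Lemma DmulE i (d d' : D i) u : Dval (Dmul d d') u = Dval d' (Dval d u).
Proof.
rewrite /Dmul DprojK ?comp_lfunE //.
have [d1 d2] := Dval_Ahom d; have [d3 d4] := Dval_Ahom d'.
by split=> *; rewrite !comp_lfunE ?d1 ?d2 ?d3 ?d4.
Qed.

Lemma mpairD_Dactr i j (x : M i) (y : M j) (d : D j) (d' : D i) : j = dia i ->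
  (forall u v, spair P u (Dval d v) = spair P (Dval d' u) v) ->
  mpairD P x (Dact d y) = Dmul (mpairD P x y) d'.
Proof.
move=> e dd; apply: Dval_inj => u; apply: (spair_injl e) => v.
by rewrite -mpairDE // -ev_Dval mpairDE // dd DmulE.
Qed.

Lemma eps_a_sq i : eps_a P i * eps_a P i = 1.
Proof.
have [e|e] := pselect (dia (xb i) = i); last by rewrite (eps_a_neq P e) mulr1.
have [h1 h2] := eps_a_eq P e.
case: (pselect (exists f : 'Hom(S i, S (xb i)),
   @Abeta_iso _ _ _ _ F (twist xi (S i)) (S (xb i)) f /\
   (forall u v : S i, spair P u (f v) = sig (spair P v (f u))))) => h.
  by rewrite h1 ?mulr1.
by rewrite h2 ?mulrNN ?mulr1.
Qed.

End QuiverPairings.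

(** * Reduced traces *)

Section PowerCharpoly.

Fixpoint bdiag (R : nzRingType) r (A : 'M[R]_r) N : 'M[R]_(N * r) :=
  if N is N'.+1 then block_mx A 0 0 (bdiag A N') : 'M_(r + N' * r) else 0.

Lemma det_bdiag (R : comNzRingType) r (A : 'M[R]_r) N :
  \det (bdiag A N) = \det A ^+ N.
Proof.
elim: N => [|N IH] /=; first by rewrite det_mx00.
by rewrite (@det_ublock _ r (N * r)) IH exprS.
Qed.

Lemma char_poly_bdiag (R : comNzRingType) r (A : 'M[R]_r) N :
  char_poly (bdiag A N) = char_poly A ^+ N.
Proof.
rewrite /char_poly -det_bdiag; congr (\det _).
elim: N => [|N IH] /=; first by apply/matrixP=> [[]].
rewrite -IH /char_poly_mx (@scalar_mx_block _ r (N * r)).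
rewrite (@map_block_mx _ _ _ r (N * r) r (N * r)) !map_mx0.
by rewrite (@opp_block_mx _ r (N * r) r (N * r)) !oppr0 (@add_block_mx _ r (N * r) r (N * r)) !addr0.
Qed.

(** Flattens a family of rows in such a way that right multiplication of each row by A becomes
    multiplication by [bdiag A N]; the recursion follows that of [bdiag]. *)
Fixpoint vecN (R : nzRingType) r N : ('I_N -> 'rV[R]_r) -> 'rV[R]_(N * r) :=
  if N is N'.+1 then fun Y =>
    row_mx (Y ord0) (vecN (fun i : 'I_N' => Y (lift ord0 i))) : 'rV_(r + N' * r)
  else fun=> 0.

Lemma vecN_lin (R : nzRingType) r N (a : R) (Y Z : 'I_N -> 'rV[R]_r) :
  vecN (fun i => a *: Y i + Z i) = a *: vecN Y + vecN Z.
Proof.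
elim: N Y Z => [|N IH] Y Z /=; first by rewrite scaler0 addr0.
by rewrite IH (@scale_row_mx _ 1 r (N * r)) (@add_row_mx _ 1 r (N * r)).
Qed.

Lemma vecN_eq (R : nzRingType) r N (Y Z : 'I_N -> 'rV[R]_r) :
  (forall i, Y i = Z i) -> vecN Y = vecN Z.
Proof. by move=> YZ; congr vecN; apply: funext. Qed.

Lemma vecN_inj (R : nzRingType) r N (Y : 'I_N -> 'rV[R]_r) :
  vecN Y = 0 -> forall i, Y i = 0.
Proof.
elim: N Y => [|N IH] Y /=; first by move=> _ [].
rewrite -(@row_mx0 _ 1 r (N * r)) => /(@eq_row_mx _ 1 r (N * r))[Y0 /IH Yl] i.
by have [j ->|->] := unliftP ord0 i.
Qed.

Lemma vecN_mul (R : nzRingType) r N (Y : 'I_N -> 'rV[R]_r) (A : 'M[R]_r) :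
  vecN (fun i => Y i *m A) = vecN Y *m bdiag A N.
Proof.
elim: N Y => [|N IH] Y /=; first by rewrite mulmx0.
rewrite IH (@mul_row_block _ 1 r (N * r) r (N * r)).
by rewrite !mulmx0 addr0 add0r.
Qed.

Lemma char_poly_similar (E : fieldType) N (A C G : 'M[E]_N) :
  G \in unitmx -> A *m G = G *m C -> char_poly A = char_poly C.
Proof.
move=> GU AG; rewrite /char_poly.
have Gp : map_mx polyC G *m char_poly_mx C = char_poly_mx A *m map_mx polyC G.
  rewrite /char_poly_mx mulmxBr mulmxBl -!map_mxM AG.
  by rewrite scalar_mxC.
have : \det (map_mx polyC G) * \det (char_poly_mx C) =
       \det (char_poly_mx A) * \det (map_mx polyC G) by rewrite -!det_mulmx Gp.
rewrite mulrC => /esym; apply: (@mulIf {poly E}).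
by rewrite det_map_mx polyC_eq0; move: GU; rewrite unitmxE unitfE.
Qed.

(* F = X^N + c X^(N - q) + lower terms *)
Definition leading2 (E : fieldType) (q N : nat) (c : E) (p : {poly E}) :=
  (q <= N)%N /\ exists2 g, p = 'X^N + c *: 'X^(N - q) + g & (size g <= N - q)%N.

(** The two cross terms have the same degree and add up; as q > 0, the product of the two second
    terms falls below them. *)
Lemma leading2M (E : fieldType) q N N' (c c' : E) p p' : (0 < q)%N ->
  leading2 q N c p -> leading2 q N' c' p' -> leading2 q (N + N') (c + c') (p * p').
Proof.
move=> q0 [qN [g -> sg]] [qN' [g' -> sg']]; split; first by lia.
pose A : {poly E} := 'X^N; pose A' : {poly E} := 'X^N'.
pose B : {poly E} := 'X^(N - q); pose B' : {poly E} := 'X^(N' - q).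
have AB : A * B' = B * A' by rewrite /A /A' /B /B' -!exprD; congr ('X^_); lia.
have BA : 'X^(N + N' - q) = B * A' by rewrite /A' /B -exprD; congr ('X^_); lia.
pose h := A * g' + c%:P * (c'%:P * (B * B')) + c%:P * (B * g') + g * A' +
  c'%:P * (g * B') + g * g'.
exists h.
  apply/eqP; rewrite -subr_eq0 -!mul_polyC -/A -/A' -/B -/B' BA exprD -/A -/A' polyCD.
  have -> : (A + c%:P * B + g) * (A' + c'%:P * B' + g') -
     (A * A' + (c%:P + c'%:P) * (B * A') + h) = c'%:P * (A * B' - B * A').
    by rewrite /h; ring.
  by rewrite AB subrr mulr0.
have sM (p1 p2 : {poly E}) (a b K : nat) : (size p1 <= a)%N -> (size p2 <= b)%N ->
    (a + b <= K.+1)%N -> (size (p1 * p2)%R <= K)%N.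
  by move=> s1 s2 ab; rewrite (leq_trans (size_polyMleq _ _)) //; lia.
have sC (x : E) (p1 : {poly E}) K : (size p1 <= K)%N -> (size (x%:P * p1)%R <= K)%N.
  by move=> s1; rewrite mul_polyC (leq_trans (size_scale_leq _ _)).
have sA K : (size ('X^K : {poly E}) <= K.+1)%N by rewrite size_polyXn.
have sD (p1 p2 : {poly E}) K : (size p1 <= K)%N -> (size p2 <= K)%N ->
    (size (p1 + p2)%R <= K)%N.
  by move=> s1 s2; rewrite (leq_trans (size_polyD _ _)) // geq_max s1 s2.
rewrite /h; repeat apply: (sD); repeat apply: (sC).
- by apply: (sM _ _ N.+1 (N' - q)%N); rewrite ?sA //; lia.
- by apply: (sM _ _ (N - q).+1 (N' - q).+1); rewrite ?sA //; lia.
- by apply: (sM _ _ (N - q).+1 (N' - q)%N); rewrite ?sA //; lia.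
- by apply: (sM _ _ (N - q)%N N'.+1); rewrite ?sA //; lia.
- by apply: (sM _ _ (N - q)%N (N' - q).+1); rewrite ?sA //; lia.
- by apply: (sM _ _ (N - q)%N (N' - q)%N); rewrite ?sA //; lia.
Qed.

Lemma leading2X (E : fieldType) q N (c : E) p s : (0 < q)%N -> (0 < s)%N ->
  leading2 q N c p -> leading2 q (N * s) (c *+ s) (p ^+ s).
Proof.
move=> q0; elim: s => // -[|s] IH _ pL; first by rewrite muln1 expr1.
by rewrite mulnS exprS mulrS; apply: leading2M => //; apply: IH.
Qed.

Lemma leading2_coef (E : fieldType) q N (c : E) p : (0 < q)%N ->
  leading2 q N c p -> p`_(N - q) = c.
Proof.
move=> q0 [qN [g -> sg]]; rewrite !coefD coefZ !coefXn eqxx mulr1.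
have -> : (N - q == N)%N = false by lia.
by rewrite add0r (leq_sizeP _ _ sg) ?addr0.
Qed.

Lemma leading2_monic (E : fieldType) r (f : {poly E}) : (0 < r)%N ->
  size f = r.+1 -> f \is monic -> leading2 1 r f`_r.-1 f.
Proof.
move=> r0 sf fm; split=> //; exists (\poly_(j < r.-1) f`_j); last first.
  by rewrite subn1 size_poly.
apply/polyP=> j; rewrite !coefD coefZ !coefXn coef_poly subn1.
have [->|jr] := eqVneq j r.
  have -> : (r == r.-1) = false by lia.
  have -> : (r < r.-1)%N = false by lia.
  by move/monicP: fm; rewrite lead_coefE sf /= => ->; rewrite mulr0 !addr0.
have [->|jr1] := eqVneq j r.-1; first by rewrite ltnn mulr1 addr0 add0r.
rewrite mulr0 !add0r; case: ltnP => // rj.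
by rewrite nth_default // sf; lia.
Qed.

(** Raising to a power q of the characteristic exponent is additive, so only the q-th powers of the
    terms remain and the gap after the leading term becomes q. *)
Lemma leading2_frob (E : fieldType) q N (c : E) p : (0 < q)%N ->
  [pchar E].-nat q -> leading2 1 N c p -> leading2 q (N * q) (c ^+ q) (p ^+ q).
Proof.
move=> q0 qp [N0 [g -> sg]]; split; first by rewrite leq_pmull.
have qp' : [pchar {poly E}].-nat q.
  by rewrite (eq_pnat _ (pchar_poly E)).
exists (g ^+ q).
  rewrite !exprDn_pchar // exprZn -!exprM; congr (_ + _ *: 'X^_ + _).
  by rewrite mulnBl mul1n.
have [->|g0] := eqVneq g 0; first by rewrite expr0n gtn_eqF ?size_poly0.
rewrite (leq_trans (size_poly_exp_leq _ _)) //.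
have : (0 < size g)%N by rewrite lt0n size_poly_eq0.
case: (size g) sg => // s sg _ /=.
have : (s.+1 * q <= (N - 1) * q)%N by rewrite leq_mul2r sg orbT.
by rewrite mulnBl mul1n; lia.
Qed.

(* The trace, i.e. the second coefficient of a monic f of degree r, is
   determined by f ^ r, even if the characteristic divides r: then only its
   power by the p-part of r appears as a coefficient of f ^ r. *)
Lemma power_trace (L E1 E2 : fieldType) (h1 : {rmorphism L -> E1})
    (h2 : {rmorphism L -> E2}) r (G : {poly L}) (f1 : {poly E1}) (f2 : {poly E2})
    (t1 t2 : L) : (0 < r)%N ->
  size f1 = r.+1 -> size f2 = r.+1 -> f1 \is monic -> f2 \is monic ->
  f1 ^+ r = map_poly h1 G -> f2 ^+ r = map_poly h2 G ->
  f1`_r.-1 = h1 t1 -> f2`_r.-1 = h2 t2 -> t1 = t2.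
Proof.
move=> r0 sf1 sf2 mf1 mf2 fG1 fG2 ft1 ft2.
pose q := (r`_[pchar L])%N; pose s := (r`_([pchar L]^'))%N.
have rqs : (r = q * s)%N by rewrite partnC.
have q0 : (0 < q)%N by exact: part_gt0.
have s0 : (0 < s)%N by exact: part_gt0.
(* The second coefficient of f^r, at distance q from the top, is s t^q. It is a coefficient of G,
   hence does not depend on E; since s is prime to the characteristic and Frobenius is injective, it
   determines t. *)
have coefG (E : fieldType) (h : {rmorphism L -> E}) (f : {poly E}) (t : L) : size f = r.+1 ->
    f \is monic -> f ^+ r = map_poly h G -> f`_r.-1 = h t ->
    t ^+ q *+ s = G`_(r * q * s - q).
  move=> sf mf fG ft; have qE : [pchar E].-nat q.
    by rewrite (eq_pnat _ (fmorph_pchar h)) part_pnat.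
  have := leading2X q0 s0 (leading2_frob q0 qE (leading2_monic r0 sf mf)).
  rewrite -exprM -rqs => /(leading2_coef q0).
  by rewrite fG coef_map ft -rmorphXn -rmorphMn => /fmorph_inj.
have tq : t1 ^+ q = t2 ^+ q.
  have /eqP := etrans (coefG _ _ _ _ sf1 mf1 fG1 ft1)
    (esym (coefG _ _ _ _ sf2 mf2 fG2 ft2)).
  rewrite -subr_eq0 -mulrnBl -mulr_natr mulf_eq0 subr_eq0.
  have /negPf -> : s%:R != 0 :> L by rewrite natf_neq0_pchar part_pnat.
  by rewrite orbF => /eqP.
have qL : [pchar L].-nat q by rewrite part_pnat.
have : t2 ^+ q + (t1 - t2) ^+ q = t2 ^+ q.
  by rewrite -(exprDn_pchar _ _ qL) addrC subrK tq.
move/eqP; rewrite -subr_eq0 addrC addKr expf_eq0 q0 subr_eq0.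
by move/eqP.
Qed.

End PowerCharpoly.

(** * Split representations of a central division algebra and their traces *)

Section CentralDivisionAlgebra.
Variables (k0 : fieldType) (D : vectType k0) (L : fieldExtType k0).
Variables (mul : D -> D -> D) (one : D) (io : L -> D).
Hypotheses (mulA : forall x y z, mul x (mul y z) = mul (mul x y) z)
  (mul1d : forall x, mul one x = x) (muld1 : forall x, mul x one = x)
  (mulDl : forall x y z, mul (x + y) z = mul x z + mul y z)
  (mulDr : forall x y z, mul x (y + z) = mul x y + mul x z)
  (ioD : forall a b, io (a + b) = io a + io b)
  (ioM : forall a b, io (a * b) = mul (io a) (io b))
  (io1 : io 1 = one)
  (ioZ : forall (c : k0) d, mul (io c%:A) d = c *: d)
  (ioC : forall a d, mul (io a) d = mul d (io a))
  (one_neq0 : one != 0)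
  (division : forall d, d != 0 -> exists d', mul d' d = one)
  (central : forall d, (forall d', mul d d' = mul d' d) -> exists a, d = io a).

Lemma mul0d x : mul 0 x = 0.
Proof. by apply: (addrI (mul 0 x)); rewrite -mulDl !addr0. Qed.
Lemma muld0 x : mul x 0 = 0.
Proof. by apply: (addrI (mul x 0)); rewrite -mulDr !addr0. Qed.
Lemma mulNd x y : mul (- x) y = - mul x y.
Proof. by apply: (addrI (mul x y)); rewrite -mulDl !subrr mul0d. Qed.
Lemma muldN x y : mul x (- y) = - mul x y.
Proof. by apply: (addrI (mul x y)); rewrite -mulDr !subrr muld0. Qed.
Lemma io0 : io 0 = 0.
Proof. by apply: (addrI (io 0)); rewrite -ioD !addr0. Qed.
Lemma mul_suml I (r : seq I) (Q : pred I) f x :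
  mul (\sum_(i <- r | Q i) f i) x = \sum_(i <- r | Q i) mul (f i) x.
Proof. exact: (big_morph (mul^~ x) (fun a b => mulDl a b x) (mul0d x)). Qed.
Lemma mul_sumr I (r : seq I) (Q : pred I) f x :
  mul x (\sum_(i <- r | Q i) f i) = \sum_(i <- r | Q i) mul x (f i).
Proof. exact: (big_morph (mul x) (mulDr x) (muld0 x)). Qed.

Section Rep.
Variables (E : fieldType) (incl : {rmorphism L -> E}) (r : nat).
Variable rho : D -> 'M[E]_r.
Hypotheses (rhoD : forall d d', rho (d + d') = rho d + rho d')
  (rhoM : forall d d', rho (mul d d') = rho d *m rho d')
  (rho_io : forall a, rho (io a) = (incl a)%:M) (r0 : (0 < r)%N).

Lemma rho0 : rho 0 = 0.
Proof. by rewrite -io0 rho_io rmorph0 raddf0. Qed.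
Lemma rhoN d : rho (- d) = - rho d.
Proof. by apply: (addrI (rho d)); rewrite -rhoD !subrr rho0. Qed.
Lemma rho_sum I (s : seq I) (Q : pred I) f :
  rho (\sum_(i <- s | Q i) f i) = \sum_(i <- s | Q i) rho (f i).
Proof. exact: (big_morph rho rhoD rho0). Qed.

(* A relation with fewest nonzero d, normalized by d = one, is killed by
   commutators, so that its coefficients d are central. *)
Lemma rep_dependent_coefs N (e : 'I_N -> E) (d : 'I_N -> D) :
  \sum_s e s *: rho (d s) = 0 -> (exists s, d s != 0) ->
  exists l : 'I_N -> L, (exists s, d s != 0 /\ l s != 0) /\
    \sum_s e s * incl (l s) = 0.
Proof.
have [K] := ubnP #|[set s | d s != 0]|; elim: K d => // K IH d leK rel [s0 ds0].
have [d0' d0'E] := division ds0.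
pose d' s := mul d0' (d s).
have rel' : \sum_s e s *: rho (d' s) = 0.
  under eq_bigr => s _ do rewrite rhoM scalemxAr.
  by rewrite -mulmx_sumr rel mulmx0.
have [[x [s1 xs1]]|comm] :=
    pselect (exists x s, mul x (d' s) - mul (d' s) x != 0).
  pose d2 s := mul x (d' s) - mul (d' s) x.
  have [|||l [[s [d2s ls]] lE]] := IH d2.
  - rewrite -ltnS; apply: leq_trans leK; rewrite ltnS; apply: proper_card.
    apply/properP; split; last first.
      by exists s0; rewrite !inE ?ds0 // /d2 /d' d0'E mul1d muld1 subrr eqxx.
    apply/subsetP=> s; rewrite !inE; apply: contra_neq => ds.
    by rewrite /d2 /d' ds muld0 mul0d muld0 subrr.
  - have d2E s : e s *: rho (d2 s) =
        rho x *m (e s *: rho (d' s)) - (e s *: rho (d' s)) *m rho x.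
      by rewrite /d2 rhoD rhoN (rhoM x) (rhoM (d' s) x) scalerBr scalemxAr scalemxAl.
    under eq_bigr => s _ do rewrite d2E.
    by rewrite sumrB -mulmx_sumr -mulmx_suml rel' mulmx0 mul0mx subrr.
  - by exists s1.
  exists l; split=> //; exists s; split=> //.
  by apply: contra_neq d2s => ds; rewrite /d2 /d' ds muld0 mul0d muld0 subrr.
have dio s : exists a, d' s = io a.
  apply: central => x; apply/esym/eqP; rewrite -subr_eq0.
  by apply: contrapT => h; apply: comm; exists x, s; apply/negP.
have /fin_all_exists[l lE] := dio; exists l; split.
  exists s0; split=> //; apply: contraNneq one_neq0 => l0.
  by rewrite -d0'E -/(d' s0) lE l0 io0.
move: rel'; under eq_bigr => s _ do rewrite lE rho_io scale_scalar_mx.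
rewrite -(raddf_sum (@scalar_mx E r)) => /matrixP/(_ (Ordinal r0) (Ordinal r0)).
by rewrite !mxE eqxx mulr1n.
Qed.

(** This is the injectivity of E (x)_L D -> M_r(E). A relation over L between the coefficients e
    eliminates one of them, and induction on the number of nonzero coefficients applies. The control
    of the support of l allows the eliminated term to be put back. *)
Lemma rep_dependent N (e : 'I_N -> E) (d : 'I_N -> D) :
  \sum_s e s *: rho (d s) = 0 -> (exists s, e s != 0) ->
  exists l : 'I_N -> L, [/\ exists s, l s != 0, forall s, e s = 0 -> l s = 0
    & \sum_s mul (io (l s)) (d s) = 0].
Proof.
have [K] := ubnP #|[set s | e s != 0]|; elim: K e d => // K IH e d leK rel [s0 es0].
(* Terms with zero coefficient are discarded so that the index [s1] found below satisfies
   [e s1 != 0]; otherwise its elimination would not shorten the relation. *)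
pose d1 s := if e s == 0 then 0 else d s.
have rel1 : \sum_s e s *: rho (d1 s) = 0.
  rewrite -[RHS]rel; apply: eq_bigr => s _; rewrite /d1.
  by case: eqP => // ->; rewrite !scale0r.
have [ex|nex] := pselect (exists s, d1 s != 0); last first.
  exists (fun s => (s == s0)%:R); split.
  - by exists s0; rewrite eqxx oner_neq0.
  - by move=> s es; case: eqP => // ss; rewrite -ss es eqxx in es0.
  apply: big1 => s _; case: eqP => [->|_]; last by rewrite io0 mul0d.
  rewrite io1 mul1d; apply: contrapT => /eqP ds; apply: nex; exists s0.
  by rewrite /d1 (negPf es0).
have [l [[s1 [ds1 ls1]] lE]] := rep_dependent_coefs rel1 ex.
have es1 : e s1 != 0 by apply: contra_neq ds1 => h; rewrite /d1 h eqxx.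
pose a s := l s / l s1.
have e1E : e s1 = - \sum_(s | s != s1) e s * incl (a s).
  have : \sum_s e s * incl (a s) = 0.
    under eq_bigr => s _ do rewrite /a rmorphM mulrA.
    by rewrite -mulr_suml lE mul0r.
  rewrite (bigD1 s1) //= {1}/a divff // rmorph1 mulr1 => /eqP.
  by rewrite addr_eq0 => /eqP.
pose e' s := if s == s1 then 0 else e s.
(* Result of substituting for [e s1] its expression through the other coefficients. *)
pose d' s := d s - mul (io (a s)) (d s1).
have [|||l' [[s2 l's2] l'e l'E]] := IH e' d'.
- rewrite -ltnS; apply: leq_trans leK; rewrite ltnS; apply: proper_card.
  apply/properP; split; last by exists s1; rewrite !inE /e' ?eqxx.
  by apply/subsetP=> s; rewrite !inE /e'; case: ifP; rewrite ?eqxx.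
- rewrite (bigD1 s1) //= {1}/e' eqxx scale0r add0r.
  transitivity (\sum_(s | s != s1) e s *: rho (d s) + e s1 *: rho (d s1)).
    rewrite e1E scaleNr scaler_suml -sumrB; apply: eq_bigr => s ss.
    rewrite /e' (negPf ss) /d' rhoD rhoN rhoM rho_io mul_scalar_mx.
    by rewrite scalerBr scalerA.
  by rewrite addrC -[RHS]rel [RHS](bigD1 s1).
- apply: contrapT => nex'; case/negP: es1; rewrite e1E oppr_eq0.
  rewrite big1 // => s ss; suff -> : e s = 0 by rewrite mul0r.
  apply: contrapT => /eqP es; apply: nex'; exists s.
  by rewrite /e' (negPf ss).
have l's1 : l' s1 = 0 by apply: l'e; rewrite /e' eqxx.
pose b := \sum_(s | s != s1) l' s * a s.
exists (fun s => if s == s1 then - b else l' s); split.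
- by exists s2; case: (s2 =P s1) => [ss|//]; move: l's2; rewrite ss l's1 eqxx.
- move=> s es; case: eqP => [ss|ss]; first by move: es1; rewrite -ss es eqxx.
  by apply: l'e; rewrite /e'; case: eqP.
have ioN x : io (- x) = - io x.
  by apply: (addrI (io x)); rewrite -ioD !subrr io0.
rewrite (bigD1 s1) //= eqxx ioN mulNd.
move: l'E; rewrite (bigD1 s1) //= l's1 io0 mul0d add0r => l'E.
apply/eqP; rewrite addrC subr_eq0; apply/eqP.
rewrite /b (big_morph io ioD io0) mul_suml.
have /eqP := l'E; under eq_bigr => s _ do rewrite /d' mulDr muldN mulA -ioM.
rewrite sumrB subr_eq0 => /eqP <-.
by apply: eq_bigr => s ss; rewrite (negPf ss).
Qed.

End Rep.

Definition free_over_L N (d : 'I_N -> D) :=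
  forall l : 'I_N -> L, \sum_s mul (io (l s)) (d s) = 0 -> forall s, l s = 0.

Lemma combL_linear N (d : 'I_N -> D) :
  linear (fun l : {ffun 'I_N -> L} => \sum_s mul (io (l s)) (d s)).
Proof.
move=> c l l'; rewrite scaler_sumr -big_split; apply: eq_bigr => s _ /=.
by rewrite !ffunE ioD mulDl -mulr_algl ioM -mulA ioZ.
Qed.

Lemma dim_ffunL N : \dim {: {ffun 'I_N -> L}} = (N * \dim {:L})%N.
Proof. by rewrite !dimvf /dim /= card_ord. Qed.

(** D is a vector space over k0 only, so the L-free family is extended one vector at a time: the
    L-combinations of N vectors are the image of a space of k0-dimension N [L : k0], too small to be
    D. *)
Lemma free_exists r : \dim {:D} = (r * \dim {:L})%N ->
  exists d : 'I_r -> D, free_over_L d.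
Proof.
move=> dimD; suff h N : (N <= r)%N -> exists d : 'I_N -> D, free_over_L d by exact: h.
elim: N => [|N IH] Nr; first by exists (fun=> 0) => l _ [].
have [d dfree] := IH (ltnW Nr).
pose f : 'Hom({ffun 'I_N -> L}, D) := linfun (fun l : {ffun 'I_N -> L} => \sum_s mul (io (l s)) (d s)).
have fE l : f l = \sum_s mul (io (l s)) (d s) by rewrite /f lfun_linfun //; apply: combL_linear.
have L0 : (0 < \dim {:L})%N by rewrite lt0n dimv_eq0; apply/eqP=> L0;
   have := memvf (1 : L); rewrite L0 memv0 oner_eq0.
have [x _ xf] : exists2 x, x \in {:D}%VS & x \notin limg f.
  apply/subvPn/negP => /dimvS; rewrite dimD leqNgt => /negP; apply.
  apply: (@leq_ltn_trans (N * \dim {:L})); last by rewrite ltn_pmul2r.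
  by rewrite -dim_ffunL -(limg_ker_dim f fullv) leq_addl.
pose d' (t : 'I_N.+1) := if unlift ord_max t is Some s then d s else x.
have d'max : d' ord_max = x by rewrite /d' unlift_none.
have d'w s : d' (widen_ord (leqnSn N) s) = d s.
  have -> : widen_ord (leqnSn N) s = lift ord_max s.
    by apply: val_inj; rewrite /= /bump leqNgt ltn_ord.
  by rewrite /d' liftK.
exists d' => l; rewrite big_ord_recr /= d'max.
under eq_bigr => s _ do rewrite d'w.
move=> rel; have lm : l ord_max = 0.
  apply: contraNeq xf => lm; apply/memv_imgP.
  exists [ffun s => - (l ord_max)^-1 * l (widen_ord (leqnSn N) s)]; first exact: memvf.
  rewrite fE; under eq_bigr => s _ do rewrite ffunE ioM -mulA.
  rewrite -mul_sumr; move/eqP: rel; rewrite addr_eq0 => /eqP ->.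
  rewrite muldN mulA -ioM mulNr mulVf //.
  have ioN y : io (- y) = - io y.
    by apply: (addrI (io y)); rewrite -ioD !subrr io0.
  by rewrite ioN io1 mulNd mul1d opprK.
move: rel; rewrite lm io0 mul0d addr0 => /dfree lw s.
by have [s' ->|->] := unliftP ord_max s; rewrite ?lm // -(lw s'); congr l;
  apply: val_inj; rewrite /= /bump leqNgt ltn_ord.
Qed.

Lemma free_spans N (d : 'I_N -> D) : free_over_L d ->
  \dim {:D} = (N * \dim {:L})%N ->
  forall x, exists l : 'I_N -> L, x = \sum_s mul (io (l s)) (d s).
Proof.
move=> dfree dimD x.
pose f : 'Hom({ffun 'I_N -> L}, D) := linfun (fun l : {ffun 'I_N -> L} => \sum_s mul (io (l s)) (d s)).
have fE l : f l = \sum_s mul (io (l s)) (d s) by rewrite /f lfun_linfun //; apply: combL_linear.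
have [l l'||l ->] := @lfun_surj _ _ _ f _ _ x.
- move=> /eqP; rewrite -subr_eq0 -linearB /= fE => /eqP/dfree ll.
  by apply/ffunP=> s; apply/eqP; rewrite -subr_eq0; have := ll s; rewrite !ffunE => ->.
- by rewrite dim_ffunL dimD.
by exists l; rewrite fE.
Qed.

Lemma vecN_sum (E : fieldType) r I (s : seq I) (a : I -> E) (X : I -> 'M[E]_r) :
  vecN (fun i => row i (\sum_(t <- s) a t *: X t)) =
  \sum_(t <- s) a t *: vecN (fun i => row i (X t)).
Proof.
elim: s => [|t s IH].
  rewrite big_nil; have h0 N : vecN (fun i : 'I_N => 0 : 'rV[E]_r) = 0.
    by elim: N => [|N IH] //=; rewrite IH (@row_mx0 _ 1 r (N * r)).
  by rewrite big_nil -[RHS](h0 r); apply: vecN_eq => j; rewrite row0.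
rewrite [RHS]big_cons -IH -vecN_lin; apply: vecN_eq => j.
by rewrite big_cons linearD linearZ.
Qed.

Section RepTrace.
Variables (E : fieldType) (incl : {rmorphism L -> E}) (r : nat).
Variable rho : D -> 'M[E]_r.
Hypotheses (rhoD : forall d d', rho (d + d') = rho d + rho d')
  (rhoM : forall d d', rho (mul d d') = rho d *m rho d')
  (rho_io : forall a, rho (io a) = (incl a)%:M) (r0 : (0 < r)%N)
  (dimD : \dim {:D} = (r * r * \dim {:L})%N).

Definition rep_mx (d : 'I_(r * r) -> D) : 'M[E]_(r * r) :=
  \matrix_t vecN (fun i => row i (rho (d t))).

(** The matrices [rho (d t)] form an E-basis of M_r(E): they are independent by [rep_dependent], and
    there are r^2 of them. *)
Lemma rep_mx_unit d : free_over_L d -> rep_mx d \in unitmx.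
Proof.
move=> dfree; rewrite -row_free_unit; apply: inj_row_free => v vG.
have rel : \sum_t v 0 t *: rho (d t) = 0.
  apply/row_matrixP=> i; rewrite row0.
  suff /vecN_inj : vecN (fun i => row i (\sum_t v 0 t *: rho (d t))) = 0 by apply.
  rewrite -[RHS]vG mulmx_sum_row vecN_sum.
  by apply: eq_bigr => t _; rewrite rowK.
apply/rowP=> t; rewrite [RHS]mxE; apply: contrapT => /eqP vt.
have [|l [[s ls] _ lE]] := rep_dependent rhoD rhoM rho_io r0 rel; first by exists t.
by case/eqP: ls; apply: dfree lE s.
Qed.

(* char_poly (rho d) ^ r is the characteristic polynomial of the right
   multiplication by d on D over L. *)
Lemma rep_char_poly d x (A : 'M[L]_(r * r)) : free_over_L d ->
  (forall t, mul (d t) x = \sum_u mul (io (A t u)) (d u)) ->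
  char_poly (rho x) ^+ r = map_poly incl (char_poly A).
Proof.
move=> dfree AE; rewrite -char_poly_bdiag map_char_poly; apply/esym.
apply: (char_poly_similar (rep_mx_unit dfree)); apply/row_matrixP=> t.
rewrite !row_mul rowK -vecN_mul mulmx_sum_row.
have E0 : rho (d t) *m rho x = \sum_u incl (A t u) *: rho (d u).
  rewrite -rhoM AE (rho_sum rhoD rho_io); apply: eq_bigr => u _.
  by rewrite rhoM rho_io mul_scalar_mx.
have -> : vecN (fun i => row i (rho (d t)) *m rho x) =
          vecN (fun i => row i (\sum_u incl (A t u) *: rho (d u))).
  by apply: vecN_eq => i; rewrite -row_mul E0.
by rewrite [RHS]vecN_sum; apply: eq_bigr => u _; rewrite rowK !mxE.
Qed.

(** The values of [rho] span M_r(E) over E, and this space contains an elementary matrix of trace 1.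
    No condition on the characteristic is involved. *)
Lemma rep_trace_neq0 : exists x, \tr (rho x) != 0.
Proof.
have [d dfree] := free_exists dimD.
apply: contrapT => nex; have tr0 x : \tr (rho x) = 0.
  by apply: contrapT => /eqP h; apply: nex; exists x.
have GU := rep_mx_unit dfree.
pose X : 'M[E]_r := delta_mx (Ordinal r0) (Ordinal r0).
pose v := vecN (fun i => row i X) *m invmx (rep_mx d).
suff XE : X = \sum_t v 0 t *: rho (d t).
  have := congr1 mxtrace XE; rewrite raddf_sum big1 => [|t _]; last first.
    by rewrite /= mxtraceZ tr0 mulr0.
  rewrite /mxtrace (bigD1 (Ordinal r0)) //= mxE !eqxx big1 => [|i i0].
    by rewrite addr0 => /eqP; rewrite oner_eq0.
  by rewrite mxE (negPf i0).
apply/row_matrixP=> i; apply/eqP; rewrite -subr_eq0; apply/eqP.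
pose Y := X + (-1) *: \sum_t v 0 t *: rho (d t).
have Y0 : vecN (fun i => row i Y) = 0.
  rewrite -[RHS](subrr (vecN (fun i => row i X))).
  have -> : vecN (fun i => row i Y) = vecN (fun i => (-1) *: row i (\sum_t v 0 t *: rho (d t)) + row i X).
    by apply: vecN_eq => j; rewrite /Y linearD linearZ addrC.
  rewrite vecN_lin vecN_sum scaleN1r addrC; congr (_ - _).
  rewrite -[RHS](mulmxKV GU) -/v mulmx_sum_row.
  by apply: eq_bigr => t _; rewrite rowK.
by have := vecN_inj Y0 i; rewrite /Y linearD scaleN1r linearN.
Qed.

End RepTrace.

(** The characteristic polynomials of both representations have as r-th power the same polynomial
    over L, that of right multiplication by x; [power_trace] compares their second coefficients. *)
Lemma rep_trace_unique (E1 E2 : fieldType) (h1 : {rmorphism L -> E1})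
    (h2 : {rmorphism L -> E2}) r (rho1 : D -> 'M[E1]_r) (rho2 : D -> 'M[E2]_r)
    x (t1 t2 : L) :
  (forall d d', rho1 (d + d') = rho1 d + rho1 d') ->
  (forall d d', rho1 (mul d d') = rho1 d *m rho1 d') ->
  (forall a, rho1 (io a) = (h1 a)%:M) ->
  (forall d d', rho2 (d + d') = rho2 d + rho2 d') ->
  (forall d d', rho2 (mul d d') = rho2 d *m rho2 d') ->
  (forall a, rho2 (io a) = (h2 a)%:M) -> (0 < r)%N ->
  \dim {:D} = (r * r * \dim {:L})%N ->
  h1 t1 = \tr (rho1 x) -> h2 t2 = \tr (rho2 x) -> t1 = t2.
Proof.
move=> D1 M1 I1 D2 M2 I2 r0 dimD tr1 tr2.
have [d dfree] := free_exists dimD.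
have /fin_all_exists[A AE] t := free_spans dfree dimD (mul (d t) x).
pose AM : 'M[L]_(r * r) := \matrix_(t, u) A t u.
have AME t : mul (d t) x = \sum_u mul (io (AM t u)) (d u).
  by rewrite AE; apply: eq_bigr => u _; rewrite mxE.
have f1 := rep_char_poly D1 M1 I1 r0 dfree AME.
have f2 := rep_char_poly D2 M2 I2 r0 dfree AME.
have /oppr_inj // : - t1 = - t2.
apply: (power_trace (r0) _ _ _ _ f1 f2); rewrite ?size_char_poly ?char_poly_monic //.
  by rewrite char_poly_trace // rmorphN tr1.
by rewrite char_poly_trace // rmorphN tr2.
Qed.

End CentralDivisionAlgebra.

(** * The division algebras D_i and their reduced traces *)

Section ReducedTrace.
Variables (k0 : fieldType) (k : fieldExtType k0) (sigk : {rmorphism k -> k}).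
Variables (n m : nat) (beta : k) (F : cyclic_algebra sigk n).
Variables (V : polarized_space m beta F) (xi : F) (Q : quiver V xi).
Local Notation Lb := (Lbeta n m beta).
Local Notation S := (Smod (q0 := Q)).
Implicit Types (i j : Q) (q : Lb).

Let Hnm := n_dvd_m V.
Let Hinv := mn_inv V.
Let Hb := beta_neq0 V.

Definition Done i : D i := Dproj \1%VF.

Lemma DoneE i u : Dval (Done i) u = u.
Proof.
rewrite /Done DprojK ?id_lfunE //.
by split=> *; rewrite !id_lfunE.
Qed.

Definition Dio i (y : Lfac i) : D i := Dproj (center_act (S i) (inL y)).

Lemma cactS_prL i q q' u : prL i q = prL i q' ->
  center_act (S i) q u = center_act (S i) q' u.
Proof.
move=> qq; apply/eqP; rewrite -subr_eq0 -(cactN Hnm Hinv (AS i)).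
rewrite -(cactD Hnm Hinv (AS i)); apply/eqP.
by apply: Smod_Lfac; rewrite rmorphB qq subrr.
Qed.

Lemma Dproj_cactE i q u : Dval (Dproj (center_act (S i) q) : D i) u = center_act (S i) q u.
Proof. by rewrite DprojK //; apply: (cact_Ahom Hnm Hinv (AS i)). Qed.

Lemma DioE i (y : Lfac i) q u : prL i q = y -> Dval (Dio y) u = center_act (S i) q u.
Proof. by move=> qy; rewrite Dproj_cactE; apply: cactS_prL; rewrite inLK. Qed.

Lemma Dproj_cact i q : Dproj (center_act (S i) q) = Dio (prL i q).
Proof. by apply: Dval_inj => u; rewrite Dproj_cactE (DioE (q := q)). Qed.

Lemma Dval0 i u : Dval (0 : D i) u = 0.
Proof. by rewrite /Dval linear0 lfunE. Qed.
Lemma DvalD i (d d' : D i) u : Dval (d + d') u = Dval d u + Dval d' u.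
Proof. by rewrite /Dval linearD add_lfunE. Qed.
Lemma DvalZ i (c : k0) (d : D i) u : Dval (c *: d) u = c *: Dval d u.
Proof. by rewrite /Dval linearZ scale_lfunE. Qed.

Lemma DmulA i (x y z : D i) : Dmul x (Dmul y z) = Dmul (Dmul x y) z.
Proof. by apply: Dval_inj => u; rewrite !DmulE. Qed.
Lemma Dmul1d i (x : D i) : Dmul (Done i) x = x.
Proof. by apply: Dval_inj => u; rewrite !DmulE DoneE. Qed.
Lemma Dmuld1 i (x : D i) : Dmul x (Done i) = x.
Proof. by apply: Dval_inj => u; rewrite !DmulE DoneE. Qed.
Lemma DmulDl i (x y z : D i) : Dmul (x + y) z = Dmul x z + Dmul y z.
Proof. by apply: Dval_inj => u; rewrite !(DmulE, DvalD) linearD. Qed.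
Lemma DmulDr i (x y z : D i) : Dmul x (y + z) = Dmul x y + Dmul x z.
Proof. by apply: Dval_inj => u; rewrite !(DmulE, DvalD). Qed.
Lemma DioD i (a b : Lfac i) : Dio (a + b) = Dio a + Dio b.
Proof.
apply: Dval_inj => u; rewrite DvalD (DioE (q := inL a + inL b)).
  by rewrite (cactD Hnm Hinv (AS i)) !Dproj_cactE.
by rewrite rmorphD !inLK.
Qed.
Lemma DioM i (a b : Lfac i) : Dio (a * b) = Dmul (Dio a) (Dio b).
Proof.
apply: Dval_inj => u; rewrite DmulE (DioE (q := inL b * inL a)).
  by rewrite (cactM Hnm Hinv (AS i)) !Dproj_cactE.
by rewrite rmorphM !inLK mulrC.
Qed.
Lemma Dio1 i : Dio (1 : Lfac i) = Done i.
Proof.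
apply: Dval_inj => u; rewrite DoneE (DioE (q := 1)) ?rmorph1 //.
by rewrite (cact1 Hnm Hinv (AS i)).
Qed.
Lemma DioZ i (c : k0) (d : D i) : Dmul (Dio c%:A) d = c *: d.
Proof.
apply: Dval_inj => u; rewrite DmulE DvalZ (DioE (q := (c%:A : k)%:A)) ?prL_k0 //.
by rewrite (cact_alg Hnm Hinv (AS i)) iota_alg (actA (AS i)) linearZ.
Qed.
Lemma DioC i (a : Lfac i) d : Dmul (Dio a) d = Dmul d (Dio a).
Proof.
apply: Dval_inj => u; rewrite !DmulE !Dproj_cactE.
exact: (cact_hom Hnm Hinv _ _ (AS i) (AS i) (Dval_Ahom d)).
Qed.

Lemma Done_neq0 i : Done i != 0.
Proof.
have [u u0] := S_neq0 i; apply: contraNneq u0 => d0.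
by rewrite -(DoneE u) d0 Dval0.
Qed.

Lemma D_division i (d : D i) : d != 0 -> exists d' : D i, Dmul d' d = Done i.
Proof.
move=> d0; have [dF dT] := Dval_Ahom d; have [_ _ simp] := Smod_simple i.
have ker0 : lker (Dval d) = 0%VS.
  have [|||kf] := simp (lker (Dval d)).
  - by move=> a u; rewrite !memv_ker dF => /eqP->; rewrite linear0.
  - by move=> u; rewrite !memv_ker dT => /eqP->; rewrite linear0.
  - by [].
  case/eqP: d0; apply: Dval_inj => u; rewrite Dval0; apply/eqP.
  by rewrite -memv_ker kf memvf.
have inj : lker (Dval d) == 0%VS by apply/eqP.
have K : cancel (Dval d) (Dval d)^-1%VF by move=> u; apply: lker0_lfunK.
have VK u : Dval d ((Dval d)^-1%VF u) = u.
  have [v ->] := @lfun_surj _ _ _ (Dval d) (can_inj K) erefl u.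
  by rewrite K.
exists (Dproj (Dval d)^-1%VF); apply: Dval_inj => u.
rewrite DmulE DoneE DprojK ?VK //.
by split=> [a w|w]; apply: (can_inj K); rewrite ?dF ?dT !VK.
Qed.

(** A central d is an A_beta-linear endomorphism of S_i commuting with all others, so the double
    centralizer theorem makes it a polynomial in b. *)
Lemma D_central i (d : D i) : (forall d', Dmul d d' = Dmul d' d) ->
  exists a, d = Dio a.
Proof.
move=> dC; have [|P PE] := double_centralizer Hnm Hinv Hb (AS i) (Dval_Ahom d).
  move=> f fA u; have /(congr1 (fun x => Dval x u)) := dC (Dproj f).
  by rewrite !DmulE DprojK.
exists (prL i (LQ n m beta P)); apply: Dval_inj => u.
by rewrite PE (DioE (q := LQ n m beta P)) // (center_act_LQ Hnm Hinv _ _ (AS i)).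
Qed.

Lemma dim_D i : \dim {:D i} = \dim (Dspace i).
Proof. by rewrite dimvf. Qed.

Lemma rank_gt0 i r : \dim (Dspace i) = (r ^ 2 * \dim {:Lfac i})%N -> (0 < r)%N.
Proof.
case: r => // h; have := memvf (Done i).
have /eqP := dim_D i; rewrite h dimv_eq0 => /eqP->.
by rewrite memv0 (negPf (Done_neq0 i)).
Qed.

Lemma reduced_trace_unique i (tr1 tr2 : D i -> Lfac i) :
  is_reduced_trace tr1 -> is_reduced_trace tr2 -> tr1 =1 tr2.
Proof.
move=> [E1 [h1 [r1 [rho1 [rD1 rM1 rI1 d1 t1]]]]].
move=> [E2 [h2 [r2 [rho2 [rD2 rM2 rI2 d2 t2]]]]] x.
have r10 := rank_gt0 d1.
have L0 : (0 < \dim {:Lfac i})%N.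
  by rewrite lt0n dimv_eq0; apply/eqP=> L0; have := memvf (1 : Lfac i);
    rewrite L0 memv0 oner_eq0.
have r12 : r1 = r2.
  apply/eqP; rewrite -(@eqn_exp2r _ _ 2) // -(eqn_pmul2r L0).
  by rewrite -d1 -d2.
subst r2; have dD : \dim {:D i} = (r1 * r1 * \dim {:Lfac i})%N.
  by rewrite dim_D d1 mulnn.
apply: (rep_trace_unique (@DmulA i) (@Dmul1d i) (@Dmuld1 i) (@DmulDl i) (@DmulDr i)
  (@DioD i) (@DioM i) (@Dio1 i) (@DioZ i) (@Done_neq0 i) (@D_division i)
  (@D_central i) rD1 rM1 _ rD2 rM2 _ r10 dD (t1 x) (t2 x)).
  by move=> a; rewrite /Dio rI1 inLK.
by move=> a; rewrite /Dio rI2 inLK.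
Qed.

Section Properties.
Variables (i : Q) (tr : D i -> Lfac i).
Hypothesis trP : is_reduced_trace tr.

Lemma trD d d' : tr (d + d') = tr d + tr d'.
Proof.
have [E [h [r [rho [rD rM rI _ tE]]]]] := trP.
by apply: (fmorph_inj h); rewrite rmorphD /= !tE rD raddfD.
Qed.

Lemma trL y d : tr (Dmul (Dio y) d) = y * tr d.
Proof.
have [E [h [r [rho [rD rM rI _ tE]]]]] := trP.
by apply: (fmorph_inj h); rewrite rmorphM /= !tE rM rI inLK mul_scalar_mx mxtraceZ.
Qed.

Lemma tr_linear : linear tr.
Proof. by move=> c d d'; rewrite trD -DioZ trL mulr_algl. Qed.

Lemma tr0 : tr 0 = 0.
Proof. by apply: (addrI (tr 0)); rewrite -trD !addr0. Qed.

(** A nonzero d' is invertible, so its left multiples fill D_i, on which the trace is not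
    identically zero. *)
Lemma tr_nondeg d' : (forall d, tr (Dmul d d') = 0) -> d' = 0.
Proof.
move=> d'0; apply: contrapT => /eqP d'n0.
have [E [h [r [rho [rD rM rI dd tE]]]]] := trP.
have r0 := rank_gt0 dd.
have dD : \dim {:D i} = (r * r * \dim {:Lfac i})%N by rewrite dim_D dd mulnn.
have [x] := rep_trace_neq0 (@DmulA i) (@Dmul1d i) (@Dmuld1 i) (@DmulDl i) (@DmulDr i)
  (@DioD i) (@DioM i) (@Dio1 i) (@DioZ i) (@Done_neq0 i) (@D_division i)
  (@D_central i) rD rM (fun a => etrans (rI (inL a)) (congr1 (fun y => (h y)%:M) (inLK a))) r0 dD.
rewrite -tE; have [e eE] := D_division d'n0.
by rewrite -(Dmuld1 x) -eE DmulA d'0 rmorph0 eqxx.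
Qed.

End Properties.
End ReducedTrace.

(** * Fixed arrows *)

Section FixedArrows.
Variables (k0 : fieldType) (k : fieldExtType k0) (sigk : {rmorphism k -> k}).
Variables (n m : nat) (beta : k) (F : cyclic_algebra sigk n).
Variables (V : polarized_space m beta F) (xi : F) (Q : quiver V xi).
Variable P : quiver_pairings Q.
Hypothesis xi_unit : xi \is a GRing.unit.
Hypothesis xi_fixed : sigma F xi = xi.
Local Notation iota := (cyc_iota F).
Local Notation Lb := (Lbeta n m beta).
Local Notation S := (Smod (q0 := Q)).
Local Notation xb := (xibar Q).
Local Notation sig := (sigma F).
Local Notation B := (vform (p := V)).
Local Notation c := (pol_c V).
Implicit Types (i j : Q).

Let Hnm := n_dvd_m V.
Let Hinv := mn_inv V.
Let Hb := beta_neq0 V.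

Variable i : Q.
Hypothesis fixed_arrow : dia (xb i) = i.
Local Notation eta_ := (eta i (xb i)).

Lemma xb_dia : xb i = dia i.
Proof. by rewrite -{2}fixed_arrow (diaK P). Qed.

Lemma eta_symE i1 j1 l1 (u : S i1) (v : S j1) : j1 = dia (xb i1) -> l1 = dia i1 ->
  sig (spair P v (eta i1 (xb i1) u)) = eps_a P i1 *: spair P u (eta j1 l1 v).
Proof. by move=> e1 e2; subst j1 l1; apply: eta_sym. Qed.

Lemma eta_symi (u v : S i) :
  sig (spair P v (eta_ u)) = eps_a P i *: spair P u (eta_ v).
Proof. by apply: eta_symE; [rewrite fixed_arrow | exact: xb_dia]. Qed.

Lemma spair_eta_inj (u u' : S i) :
  (forall v, spair P u (eta_ v) = spair P u' (eta_ v)) -> u = u'.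
Proof.
move=> uu; apply: (spair_injl (P := P) xb_dia) => w.
by rewrite -[w]etaVK uu.
Qed.

Lemma tau_ex (d : D i) : exists d' : D i,
  forall u v, spair P u (eta_ (Dval d v)) = spair P (Dval d' u) (eta_ v).
Proof.
have [d' d'E] := D_adjoint_l P (flat (xb i) d) xb_dia.
by exists d' => u v; rewrite flatP d'E.
Qed.

(** The adjoint involution of the form [spair P u (eta_ v)] on S_i. This form exists because the
    arrow is fixed, and it is symmetric up to sigma and the sign [eps_a P i], whence [tauK]. *)
Definition tau (d : D i) : D i := projT1 (cid (tau_ex d)).

Lemma tauE d u v : spair P u (eta_ (Dval d v)) = spair P (Dval (tau d) u) (eta_ v).
Proof. by rewrite /tau; case: cid => /= d' ->. Qed.

Lemma tau_uniq d d' :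
  (forall u v, spair P u (eta_ (Dval d v)) = spair P (Dval d' u) (eta_ v)) -> tau d = d'.
Proof.
move=> h; apply: Dval_inj => u; apply: spair_eta_inj => v.
by rewrite -tauE h.
Qed.

Lemma spair_lin_l : F_linear_l (@spair _ _ _ _ _ _ _ _ _ _ P i (xb i)).
Proof. by have [] := spair_adm P xb_dia. Qed.
Lemma spair_lin_r : sigma_linear_r (@spair _ _ _ _ _ _ _ _ _ _ P i (xb i)).
Proof. by have [] := spair_adm P xb_dia. Qed.

Lemma tauD d d' : tau (d + d') = tau d + tau d'.
Proof.
have [sD _] := spair_lin_l; have [srD _] := spair_lin_r.
by apply: tau_uniq => u v; rewrite !DvalD linearD srD sD !tauE.
Qed.

Lemma tauM d d' : tau (Dmul d d') = Dmul (tau d') (tau d).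
Proof. by apply: tau_uniq => u v; rewrite !DmulE !tauE. Qed.

Lemma tauK d : tau (tau d) = d.
Proof.
apply: tau_uniq => u v; have := congr1 sig (tauE d v u).
rewrite !eta_symi => /(congr1 (fun z => eps_a P i *: z)).
by rewrite !scalerA eps_a_sq !scale1r => ->.
Qed.

Lemma sig_Nm a : sig a = a -> sig (iota (Nm a)) = iota (Nm a).
Proof.
move=> sa; rewrite NmE rmorph_prod; apply: eq_bigr => t _.
by rewrite /= sigma_zt sa.
Qed.

Lemma spair_iter (j : nat) u v : spair P (iter j (theta (S i)) u) (iter j (theta (S (xb i))) v) =
  (\prod_(t < j) zt t c) * zt j (spair P u v).
Proof.
have [_ _ sT] := spair_adm P xb_dia.
elim: j => [|j IH]; first by rewrite big_ord0 mul1r.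
rewrite !iterS sT IH rmorphM mulrA big_ord_recl; congr (_ * _ * _).
by rewrite rmorph_prod; apply: eq_bigr => t _.
Qed.

(** The image of b under sigma_{c xi^-1}. *)
Let y := Nm (c / xi) *: (b_elt n m beta)^-1 : Lb.

Lemma eta_b v : eta_ (iter n (theta (S i)) v) =
  tm_act _ (iota (Nm xi)^-1) (iter n (theta _) (eta_ v)).
Proof.
have := eta_pact (Q := Q) (i := i) 'X v.
rewrite /= comp_polyX -mul_polyC (pactCM (AS i)) (pactX (AS i)) (pactX (AS (xb i))) => <-.
rewrite eta_act -(actM (AS _)) -rmorphM mulVf ?Nm_neq0 // rmorph1.
by rewrite (act1 (AS _)).
Qed.

(** The norm of c comes from the similitude property applied n times, and the inverse norm of xi
    from moving theta^n across [eta]. So the adjoint of b for the form defining [tau] is its image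
    under sigma_{c xi^-1}. *)
Lemma y_adjoint (u v : S i) : spair P u (eta_ (iter n (theta (S i)) v)) =
  spair P (center_act (S i) y u) (eta_ v).
Proof.
have [_ sF] := spair_lin_l; have [_ srF] := spair_lin_r.
have [u' ->] := iter_theta_surj Hinv Hb n (AS i) u.
rewrite eta_b srF spair_iter ztn -NmE -(cact_b Hnm Hinv (AS i)).
rewrite -(cactM Hnm Hinv (AS i)) /y -scalerAl mulVr; last exact: b_unit.
rewrite (cact_alg Hnm Hinv (AS i)) sF mulrA; congr (_ * _).
rewrite NmM -NmV // sig_Nm; last by rewrite rmorphV //= xi_fixed.
by rewrite rmorphM cyc_comm.
Qed.

Lemma y_adjoint_iter (t : nat) (u v : S i) :
  spair P u (eta_ (iter (n * t) (theta (S i)) v)) =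
  spair P (center_act (S i) (y ^+ t) u) (eta_ v).
Proof.
elim: t u => [|t IH] u; first by rewrite muln0 expr0 (cact1 Hnm Hinv (AS i)).
by rewrite mulnS iterD y_adjoint IH exprSr (cactM Hnm Hinv (AS i)).
Qed.

Lemma center_adjoint (q : Lb) (u v : S i) :
  spair P u (eta_ (center_act (S i) q v)) =
  spair P (center_act (S i) (sigma_ (c / xi) q) u) (eta_ v).
Proof.
have [sD sF] := spair_lin_l; have [srD srF] := spair_lin_r.
have s0 (w : S (xb i)) : spair P (0 : S i) w = 0 by rewrite -(act0 (AS i) 0) sF mul0r.
rewrite (center_actE _ _ (AS i)) /sigma_; set p := polyn q.
set f := (fun x => (sigk x)%:A).
have f0 : f 0 = 0 by rewrite /f rmorph0 scale0r.
rewrite (horner_coef_wide _ (n := size p)) ?size_poly //.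
under [in RHS]eq_bigr => t _ do rewrite (coef_map_id0 _ _ f0).
rewrite (cact_sum Hnm Hinv (AS i)) /pact linear_sum.
rewrite (big_morph (spair P u) (srD u) (sigma_linear_r0 u spair_lin_r)).
rewrite (big_morph (fun w => spair P w (eta_ v)) (fun a b => sD a b (eta_ v)) (s0 _)).
apply: eq_bigr => t _ /=.
rewrite (cactM Hnm Hinv (AS i)) (cact_alg Hnm Hinv (AS i)) sF eta_act srF.
by rewrite sigma_iota y_adjoint_iter.
Qed.

Definition sL (z : Lfac i) : Lfac i := prL i (sigma_ (c / xi) (inL z)).

Lemma tau_Dio z : tau (Dio z) = Dio (sL z).
Proof.
apply: tau_uniq => u v; rewrite Dproj_cactE center_adjoint.
by rewrite (DioE (q := sigma_ (c / xi) (inL z))).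
Qed.

Lemma Dio_inj : injective (@Dio _ _ _ _ _ _ _ _ _ Q i).
Proof.
move=> a b ab; apply/eqP; rewrite -subr_eq0; apply/eqP.
rewrite -[a]inLK -[b]inLK -rmorphB; apply/cactS_eq0 => u.
rewrite (cactD Hnm Hinv (AS i)) (cactN Hnm Hinv (AS i)).
by rewrite -!Dproj_cactE -/(Dio a) -/(Dio b) ab subrr.
Qed.

(** The algebraic properties of [sL] are inherited from those of [tau] through the injection [Dio],
    so no computation with the formula of [sigma_] is required. *)
Lemma sLK z : sL (sL z) = z.
Proof. by apply: Dio_inj; rewrite -!tau_Dio tauK. Qed.

Lemma sL_zmod : zmod_morphism sL.
Proof.
have sLD a b : sL (a + b) = sL a + sL b.
  by apply: Dio_inj; rewrite DioD -!tau_Dio DioD tauD.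
have sL0 : sL 0 = 0 by apply: (addrI (sL 0)); rewrite -sLD !addr0.
move=> a b; rewrite sLD; congr (_ + _).
by apply: (addrI (sL b)); rewrite -sLD !subrr sL0.
Qed.

Lemma sL_monoid : monoid_morphism sL.
Proof.
split; last by move=> a b; apply: Dio_inj; rewrite -tau_Dio DioM tauM !tau_Dio DioC DioM.
apply: Dio_inj; rewrite -tau_Dio Dio1; apply: tau_uniq => u v.
by rewrite !DoneE.
Qed.

HB.instance Definition _ := GRing.isZmodMorphism.Build (Lfac i) (Lfac i) sL sL_zmod.
HB.instance Definition _ := GRing.isMonoidMorphism.Build (Lfac i) (Lfac i) sL sL_monoid.

(** The map sending d to the transpose of [rho (tau d)] is again multiplicative, with structure map
    [h \o sL]. Its trace is therefore a reduced trace, and uniqueness applies. *)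
Lemma Trd_tau d : Trd P (tau d) = sL (Trd P d).
Proof.
have [E [h [r [rho [rD rM rI dd tE]]]]] := TrdP P i.
rewrite -[LHS]sLK; congr sL.
apply: (@reduced_trace_unique _ _ _ _ _ _ _ _ _ _ _ (fun d => sL (Trd P (tau d)))
  (@Trd _ _ _ _ _ _ _ _ _ _ P i)); last exact: TrdP.
exists E, (h \o sL), r, (fun d => (rho (tau d))^T); split=> //.
- by move=> d1 d2; rewrite tauD rD linearD.
- by move=> d1 d2; rewrite tauM rM trmx_mul.
- by move=> q; rewrite Dproj_cact tau_Dio /Dio rI inLK tr_scalar_mx.
by move=> d1; rewrite /= sLK tE mxtrace_tr.
Qed.

(* The antisymmetry of an element of g(xi), read on its component at a fixed arrow. *)
Definition fixed_antisym (psi : 'Hom(M i, M (xb i))) := forall x y (u v : S i),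
  B (ev (eta_ u) (psi x)) (ev v y) + B (ev u x) (ev (eta_ v) (psi y)) = 0.

Lemma fixed_antisymP psi : is_Dhom psi ->
  fixed_antisym psi <-> in_h P (- (eps V * eps_a P i)) psi.
Proof.
move=> psiD; set s := - _.
have iE : i = dia (xb i) by rewrite fixed_arrow.
have [sD sF] := spair_lin_l.
have sZ (a : k0) (u : S i) (w : S (xb i)) : spair P (a *: u) w = a *: (spair P u w : F) :> F.
  by rewrite -(actA (AS i)) sF mulr_algl.
(* The sign eps arises from exchanging the arguments of the form on V, and the sign eps_e from
   exchanging those of [spair P u (eta_ v)]; their product is the one in h^{- eps eps_e}. *)
have bE (x y1 : M i) (u v : S i) : B (ev (eta_ u) (psi x)) (ev v y1) =
    (eps V * eps_a P i) *: spair P (Dval (tau (mpairD P y1 (psi x))) u) (eta_ v).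
  rewrite vform_sym (mpairDE P _ _ _ _ xb_dia) eta_symi tauE scalerA.
  by [].
have bE' (x y1 : M i) (u v : S i) : B (ev u x) (ev (eta_ v) (psi y1)) =
    spair P (Dval (mpairD P x (psi y1)) u) (eta_ v).
  by rewrite (mpairDE P _ _ _ _ xb_dia).
have antiP : fixed_antisym psi <->
    (forall x y1, mpairD P x (psi y1) = s *: tau (mpairD P y1 (psi x))).
  split=> [h x y1|h x y1 u v].
    apply: Dval_inj => u; apply: spair_eta_inj => v.
    have := h x y1 u v; rewrite bE bE' => /eqP; rewrite addrC addr_eq0 => /eqP ->.
    by rewrite DvalZ sZ /s scaleNr.
  by rewrite bE bE' (h x y1) DvalZ sZ /s scaleNr subrr.
have TrdZ a d : Trd P (a *: d) = a *: Trd P d :> Lfac i.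
  by have := tr_linear (TrdP P i) a d 0; rewrite (tr0 (TrdP P i)) !addr0.
split=> [/antiP h|[_ h]]; first split=> // x y1.
  by rewrite /mpair h TrdZ Trd_tau.
apply/antiP => x y1; apply/eqP; rewrite -subr_eq0; apply/eqP.
(* The defect [X] is D_i-linear because [tau] is an involution. The traced identity at all multiples
   of x thus says that [X x] is orthogonal to D_i for the trace form. *)
pose X z := mpairD P z (psi y1) - s *: tau (mpairD P y1 (psi z)).
rewrite -/(X x); apply: (tr_nondeg (TrdP P i)) => d.
have TrN d' : Trd P (- d') = - Trd P d' :> Lfac i by rewrite -scaleN1r TrdZ scaleN1r.
have Xd : X (Dact d x) = Dmul d (X x).
  rewrite /X (mpairD_Dactl P _ _ _ xb_dia) psiD.
  rewrite (mpairD_Dactr (d' := tau d) _ _ xb_dia); last first.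
    by move=> u w; rewrite -[w]etaVK -flatP tauE.
  rewrite tauM tauK; apply: Dval_inj => u.
  by rewrite DmulE !DvalD -!scaleNr !DvalZ !DmulE.
rewrite -Xd /X (trD (TrdP P i)) TrN TrdZ Trd_tau.
by have := h y1 (Dact d x); rewrite /mpair => ->; rewrite subrr.
Qed.

End FixedArrows.

(** * Isometries *)

Section Isometries.
Variables (k0 : fieldType) (k : fieldExtType k0) (sigk : {rmorphism k -> k}).
Variables (n m : nat) (beta : k) (F : cyclic_algebra sigk n).
Variables (V : polarized_space m beta F) (xi : F) (Q : quiver V xi).
Variable P : quiver_pairings Q.
Hypothesis xi_unit : xi \is a GRing.unit.
Hypothesis xi_fixed : sigma F xi = xi.
Local Notation S := (Smod (q0 := Q)).
Local Notation sig := (sigma F).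
Local Notation B := (vform (p := V)).
Local Notation pe := pairing_ext.
Local Notation mp i j := (@mpair _ _ _ _ _ _ _ _ _ _ P i j).
Implicit Types (i j : Q).

Let Hnm := n_dvd_m V.
Let Hinv := mn_inv V.
Let Hb := beta_neq0 V.

Lemma adjoint_ex (f : 'End(V)) : (forall a x, f (tm_act V a x) = tm_act V a (f x)) ->
  exists fs : 'End(V), (forall x y, B (f x) y = B x (fs y)) /\
    forall a x, fs (tm_act V a x) = tm_act V a (fs x).
Proof.
move=> fF.
have [||T [TE TF]] := @perfect_map _ _ _ _ m beta F V V V B (fun u w => B (f u) w)
  (AV V) (AV V) (AV V) (vform_perfect V) (vform_lin_l V) (vform_lin_r V).
- by split=> *; rewrite ?linearD ?vformDl ?fF ?vformFl.
- by split=> *; rewrite ?vformDr ?vformFr.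
by exists T.
Qed.

Lemma vform_inj_r y y' : (forall x, B x y = B x y') -> y = y'.
Proof.
move=> yy; apply/eqP; rewrite -subr_eq0; apply/eqP.
by apply: vform_nondeg_r => x; rewrite vformBr yy subrr.
Qed.

Lemma adjoint_Ahom (f fs : 'End(V)) : Abeta_hom f ->
  (forall x y, B (f x) y = B x (fs y)) ->
  (forall a x, fs (tm_act V a x) = tm_act V a (fs x)) -> Abeta_hom fs.
Proof.
move=> [fF fT] fsE fsF; split=> // y; apply: vform_inj_r => x.
have [x' ->] := iter_theta_surj Hinv Hb 1 (AV V) x; rewrite /=.
by rewrite -fsE fT !vform_theta fsE.
Qed.

Lemma adjoint_twisted (f fs : 'End(V)) : twisted xi f ->
  (forall x y, B (f x) y = B x (fs y)) ->
  (forall a x, fs (tm_act V a x) = tm_act V a (fs x)) -> twisted xi fs.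
Proof.
move=> [fF fT] fsE fsF; split=> // y; apply: vform_inj_r => x.
have [x' ->] := iter_theta_surj Hinv Hb 1 (AV V) x; rewrite /=.
by rewrite vform_theta -fsE -vform_theta fT vformFl fsE vformFr xi_fixed.
Qed.

Lemma adjoint_sym (f fs : 'End(V)) : (forall x y, B (f x) y = B x (fs y)) ->
  forall x y, B (fs x) y = B x (f y).
Proof.
by move=> fsE x y; rewrite vform_sym -fsE -vform_sym.
Qed.

Lemma mpair_bilin i j : j = dia i -> bilin (fun (x : M i) (y : M j) => mpair P x y).
Proof.
move=> e; have [Dl Dr] := mpairD_bilin P e; have trl := tr_linear (TrdP P i).
by split=> [y|x] a x1 x2; rewrite /mpair ?Dl ?Dr trl.
Qed.

Lemma mpair_nondeg_r i j (y : M j) : j = dia i ->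
  (forall x : M i, mpair P x y = 0) -> y = 0.
Proof.
move=> e y0; apply: ev_inj => v; rewrite linear0.
apply: vform_nondeg_r => w; rewrite (decomp Q w).
rewrite (big_morph (B^~ (ev v y)) (fun a b => vformDl a b _) (vform0l _)); apply: big1 => l _.
rewrite (big_morph (B^~ (ev v y)) (fun a b => vformDl a b _) (vform0l _)); apply: big1 => a _.
have [el|ne] := eqVneq l i; last first.
  by apply: (vform_orth P) => jl; case/eqP: ne; rewrite -[i](diaK P) -e jl (diaK P).
subst l; rewrite (mpairDE P) //.
suff -> : mpairD P (vbasis {:M i})`_a y = 0.
  by rewrite Dval0; have [[_ sF] _ _] := spair_adm P e;
     rewrite -(act0 (AS i) 0) sF mul0r.
apply: (tr_nondeg (TrdP P i)) => d.
rewrite -(mpairD_Dactl P) //; exact: y0.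
Qed.

Variable R : comAlgType k0.
Local Notation EndV := 'M[R]_(\dim {:V}).
Local Notation EndM i := 'M[R]_(\dim {:M i}).
Local Notation RV := 'cV[R]_(\dim {:V}).
Local Notation RM i := 'cV[R]_(\dim {:M i}).

(** Nondegeneracy on the left means that the partial maps attached to the elements of N1 are jointly
    injective, a property that [tens_joint_inj] carries to R. *)
Lemma pairing_nondeg_l (M1 N1 P1 : vectType k0) (B1 : M1 -> N1 -> P1) : bilin B1 ->
  (forall x, (forall y, B1 x y = 0) -> x = 0) ->
  forall w : 'cV[R]_(\dim {:M1}), (forall z, pe B1 w z = 0) -> w = 0.
Proof.
move=> [Bl Br] nd w w0.
pose kap y : 'Hom(M1, P1) := linfun (B1^~ y).
have kapE y x : kap y x = B1 x y by rewrite /kap lfun_linfun //; apply: Bl.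
apply: (@tens_joint_inj _ R N1 M1 P1 kap).
  by move=> x x0; apply: nd => y; rewrite -kapE x0.
move=> y; rewrite -[RHS](w0 (tens1 R y)) -lin_extE /pairing_ext.
apply: eq_lin_ext => x; rewrite lin_ext_tens1 ?kapE // => a y1 y2.
by rewrite Br tens1_lin.
Qed.

Lemma pairing_nondeg_r (M1 N1 P1 : vectType k0) (B1 : M1 -> N1 -> P1) : bilin B1 ->
  (forall y, (forall x, B1 x y = 0) -> y = 0) ->
  forall z : 'cV[R]_(\dim {:N1}), (forall w, pe B1 w z = 0) -> z = 0.
Proof.
move=> [Bl Br] nd z z0; apply: (@pairing_nondeg_l N1 M1 P1 (fun y x => B1 x y)) => //.
by move=> w; rewrite pairing_ext_swap.
Qed.

Lemma pe_eq_l (M1 N1 P1 : vectType k0) (B1 : M1 -> N1 -> P1) : bilin B1 ->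
  (forall x, (forall y, B1 x y = 0) -> x = 0) ->
  forall w w' : 'cV[R]_(\dim {:M1}), (forall z, pe B1 w z = pe B1 w' z) -> w = w'.
Proof.
move=> Bb nd w w' ww; apply/eqP; rewrite -subr_eq0; apply/eqP.
apply: (pairing_nondeg_l Bb nd) => z.
by rewrite pairing_extDl pairing_extNl ww subrr.
Qed.

Lemma pe_eq_r (M1 N1 P1 : vectType k0) (B1 : M1 -> N1 -> P1) : bilin B1 ->
  (forall y, (forall x, B1 x y = 0) -> y = 0) ->
  forall w w' : 'cV[R]_(\dim {:N1}), (forall z, pe B1 z w = pe B1 z w') -> w = w'.
Proof.
move=> Bb nd w w' ww; apply/eqP; rewrite -subr_eq0; apply/eqP.
apply: (pairing_nondeg_r Bb nd) => z.
by rewrite pairing_extDr pairing_extNr ww subrr.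
Qed.

Lemma mpairR_inj_r i j (z z' : RM j) : j = dia i ->
  (forall w : RM i, pe (mp i j) w z = pe (mp i j) w z') -> z = z'.
Proof. by move=> e; apply: (pe_eq_r (mpair_bilin e)) => y; apply: mpair_nondeg_r. Qed.

Lemma vformR_inj_l (a a' : RV) : (forall b, pe B a b = pe B a' b) -> a = a'.
Proof. by apply: (pe_eq_l (vform_bilin V)) => x; apply: vform_nondeg. Qed.

Lemma vformR_inj_r (a a' : RV) : (forall b, pe B b a = pe B b a') -> a = a'.
Proof. by apply: (pe_eq_r (vform_bilin V)) => x; apply: vform_nondeg_r. Qed.

Lemma vformR_swap : exists sg : 'End(F), forall a b : RV, pe B b a = tensf R sg *m pe B a b.
Proof.
pose sg : 'End(F) := linfun (fun x : F => eps V *: sig x).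
have sgE x : sg x = eps V *: sig x.
  rewrite /sg lfun_linfun // => a y z.
  by rewrite rmorphD sigmaZ scalerDr !scalerA mulrC.
exists sg => a b; rewrite tensf_pairing_ext -[RHS]pairing_ext_swap.
by apply: eq_pairing_ext => y x; rewrite sgE -vform_sym.
Qed.

Lemma vformR_orth i j (u : S i) (v : S j) (w : RM i) (z : RM j) : j <> dia i ->
  pe B (tensf R (ev u) *m w) (tensf R (ev v) *m z) = 0.
Proof.
move=> ji; rewrite pairing_ext_comp; last exact: vform_bilin.
rewrite pairing_extE; apply: big1 => s _; apply: big1 => t _.
by rewrite (vform_orth P) // tens10 scaler0.
Qed.

(** Both sides are equivalent to one identity between D_i-valued pairings over R. An element of R
    (x) D_i is detected by the maps [kap] through the pairing on S_i, and by the maps [tk] through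
    traces of multiples. Commutation with D_i allows the multiplier d to be absorbed into w. *)
Lemma comp_pairing i j (g1 g3 : EndM i) (g2 g4 : EndM j) : j = dia i ->
  (forall d : D i, g1 *m tensf R (Dact d) = tensf R (Dact d) *m g1) ->
  (forall d : D i, g3 *m tensf R (Dact d) = tensf R (Dact d) *m g3) ->
  (forall w z, pe (mp i j) (g1 *m w) (g2 *m z) =
     pe (mp i j) (g3 *m w) (g4 *m z)) <->
  (forall (u : S i) (v : S j) w z,
     pe B (tensf R (ev u) *m (g1 *m w)) (tensf R (ev v) *m (g2 *m z)) =
     pe B (tensf R (ev u) *m (g3 *m w)) (tensf R (ev v) *m (g4 *m z))).
Proof.
move=> e g1D g3D.
pose mD (x : M i) (y : M j) := mpairD P x y.
have mDb : bilin mD := mpairD_bilin P e.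
have [sl sr _] := spair_adm P e.
have [sD sF] := sl.
have s0 v : spair P (0 : S i) (v : S j) = 0 by rewrite -(act0 (AS i) 0) sF mul0r.
pose kap (t : S i * S j) : 'Hom(D i, F) := linfun (fun d : D i => spair P (Dval d t.1) t.2).
have kapE t d : kap t d = spair P (Dval d t.1) t.2.
  rewrite /kap lfun_linfun // => a d1 d2.
  by rewrite DvalD DvalZ sD -(actA (AS i)) sF mulr_algl.
have evE (u : S i) (v : S j) (w : RM i) (z : RM j) :
    pe B (tensf R (ev u) *m w) (tensf R (ev v) *m z) = tensf R (kap (u, v)) *m pe mD w z.
  rewrite pairing_ext_comp; last exact: vform_bilin.
  rewrite tensf_pairing_ext; apply: eq_pairing_ext => x y.
  by rewrite kapE (mpairDE P).
pose tk (d : D i) : 'Hom(D i, Lfac i) := linfun (fun x : D i => Trd P (Dmul d x)).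
have tkE d x : tk d x = Trd P (Dmul d x).
  rewrite /tk lfun_linfun // => a d1 d2.
  by rewrite -(tr_linear (TrdP P i)) DmulDr; congr (Trd P (_ + _));
    apply: Dval_inj => u; rewrite !(DmulE, DvalZ).
have mpE (d : D i) (w : RM i) (z : RM j) :
    pe (mp i j) (tensf R (Dact d) *m w) z = tensf R (tk d) *m pe mD w z.
  rewrite pairing_ext_compl; last exact: mpair_bilin.
  rewrite tensf_pairing_ext; apply: eq_pairing_ext => x y.
  by rewrite tkE /mpair (mpairD_Dactl P).
have mpE1 (w : RM i) (z : RM j) :
    pe (mp i j) w z = tensf R (tk (Done i)) *m pe mD w z.
  rewrite -mpE; congr (pe _ _ z); rewrite -{1}[w]mul1mx -tensf1; congr (tensf R _ *m _).
  by apply/lfunP=> x; rewrite id_lfunE; apply: ev_inj => u; rewrite -ev_Dval DoneE.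
split=> h.
  have hD w z : pe mD (g1 *m w) (g2 *m z) = pe mD (g3 *m w) (g4 *m z).
    apply/eqP; rewrite -subr_eq0; apply/eqP.
    apply: (@tens_joint_inj _ R (D i) (D i) (Lfac i) tk).
      by move=> x x0; apply: (tr_nondeg (TrdP P i)) => d; rewrite -tkE x0.
    move=> d; rewrite mulmxBr -!mpE !mulmxA -g1D -g3D -!mulmxA h.
    by rewrite subrr.
  by move=> u v w z; rewrite !evE hD.
move=> w z; rewrite !mpE1; congr (_ *m _).
apply/eqP; rewrite -subr_eq0; apply/eqP.
apply: (@tens_joint_inj _ R (S i * S j)%type (D i) F kap).
  move=> x x0; apply: Dval_inj => u; rewrite Dval0; apply: (spair_injl (P := P) e) => v.
  by have := x0 (u, v); rewrite kapE /= => ->; rewrite s0.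
by move=> [u v]; rewrite mulmxBr -!evE h subrr.
Qed.

Definition isoM i j (gi : EndM i) (gj : EndM j) := forall w z,
  pe (mp i j) (gi *m w) (gj *m z) =
  pe (mp i j) w z.

Lemma comp_pairing_vform i j (g1 g2 g3 g4 : EndV) : j = dia i ->
  commA g1 -> commA g2 -> commA g3 -> commA g4 ->
  (forall a b, pe B (g1 *m a) (g2 *m b) = pe B (g3 *m a) (g4 *m b)) ->
  forall w z, pe (mp i j) (comp g1 i *m w) (comp g2 j *m z) =
    pe (mp i j) (comp g3 i *m w) (comp g4 j *m z).
Proof.
move=> e A1 A2 A3 A4 h.
apply/(comp_pairing _ _ e) => [d|d|u v w z]; try exact: comp_Dact.
rewrite !mulmxA -!compP // -!mulmxA; exact: h.
Qed.

Lemma preserves_isoM i j (g : EndV) : j = dia i -> commA g -> preserves B g ->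
  isoM (comp g i) (comp g j).
Proof.
move=> e gA gB w z.
have := comp_pairing_vform e gA gA (commA1 V R) (commA1 V R).
by rewrite !comp1 => -> //; rewrite ?mul1mx // => a b; rewrite gB !mul1mx.
Qed.

(** One condition for each pair {i, dia i} is enough since the form is symmetric up to an
    automorphism of F; the pairs (i, j) with j different from dia i are orthogonal before and after
    applying g. *)
Lemma preserves_of_iso (g : EndV) : commA g ->
  (forall i, isoM (comp g i) (comp g (dia i)) \/
     isoM (comp g (dia i)) (comp g (dia (dia i)))) -> preserves B g.
Proof.
move=> gA giso.
pose ok i j := forall (u : S i) (v : S j) (w : RM i) (z : RM j),
  pe B (g *m (tensf R (ev u) *m w)) (g *m (tensf R (ev v) *m z)) =
  pe B (tensf R (ev u) *m w) (tensf R (ev v) *m z).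
have ok_iso i : isoM (comp g i) (comp g (dia i)) -> ok i (dia i).
  move=> h u v w z; rewrite !mulmxA !compP // -!mulmxA.
  have [h1 _] := @comp_pairing i (dia i) (comp g i) 1%:M (comp g (dia i)) 1%:M erefl
    (fun d => comp_Dact d gA) (fun d => etrans (mul1mx _) (esym (mulmx1 _))).
  by rewrite h1 ?mul1mx // => w' z'; rewrite h !mul1mx.
have ok_sym i j : ok i j -> ok j i.
  move=> h u v w z; have [sg sgE] := vformR_swap.
  by rewrite sgE [RHS]sgE h.
have ok_all i j : ok i j.
  have [->|/eqP ne] := eqVneq j (dia i); last first.
    move=> u v w z; rewrite !mulmxA !compP // -!mulmxA.
    by rewrite !vformR_orth.
  have [h|h] := giso i; first exact: ok_iso.
  by apply: ok_sym; have := ok_iso _ h; rewrite (diaK P).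
suff E : forall a b, pe B (g *m a) (g *m b) = pe B a b by [].
apply: (@tens_bilin_ext _ R V V _ (fun a b => pe B (g *m a) (g *m b)) (pe B)).
- by move=> b r a a'; rewrite mulmxDr -scalemxAr pairing_ext_linl.
- by move=> a r b b'; rewrite mulmxDr -scalemxAr pairing_ext_linr.
- by move=> b r a a'; rewrite pairing_ext_linl.
- by move=> a r b b'; rewrite pairing_ext_linr.
move=> x y; rewrite (decomp Q x) (decomp Q y) !tens1_sum !mulmx_sumr.
rewrite !pairing_ext_suml; apply: eq_bigr => i _.
rewrite !tens1_sum !mulmx_sumr !pairing_ext_suml; apply: eq_bigr => a _.
rewrite !pairing_ext_sumr; apply: eq_bigr => j _.
rewrite !tens1_sum !mulmx_sumr !pairing_ext_sumr; apply: eq_bigr => b _.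
rewrite -!tensfE; exact: ok_all.
Qed.

Lemma adjointR (K : EndV) : commA K ->
  exists2 Ks : EndV, commA Ks & forall a b, pe B (K *m a) b = pe B a (Ks *m b).
Proof.
move=> KA; have [I [r [f [fA KE]]]] := commA_span Hnm Hinv Hb (AV V) (AV V) KA.
have ex b : exists fs : 'End(V), Abeta_hom fs /\ forall x y, B (f b x) y = B x (fs y).
  have [fs [fsE fsF]] := adjoint_ex (proj1 (fA b)).
  by exists fs; split=> //; apply: (adjoint_Ahom (fA b)).
have /fin_all_exists[fs fsP] := ex.
exists (\sum_b r b *: tensf R (fs b)).
  split=> [a|]; rewrite mulmx_suml mulmx_sumr; apply: eq_bigr => b _;
    rewrite -scalemxAl -scalemxAr -!tensf_comp; congr (_ *: tensf R _);
    by apply/lfunP=> x; rewrite !comp_lfunE; case: (fsP b) => [[h1 h2] _]; rewrite ?h1 ?h2.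
move=> a b; rewrite KE !mulmx_suml pairing_ext_suml pairing_ext_sumr.
apply: eq_bigr => t _; rewrite -!scalemxAl pairing_extZl pairing_extZr; congr (_ *: _).
rewrite pairing_ext_compl; last exact: vform_bilin.
rewrite pairing_ext_compr; last exact: vform_bilin.
by apply: eq_pairing_ext => x y; case: (fsP t) => _ ->.
Qed.

Lemma H_commA (g : EndV) : H_points g -> commA g.
Proof. by case=> [[_ gF] gT _]. Qed.

End Isometries.

(** * The description of H^alpha and g(xi)^alpha by half of the quiver *)

Section Description.
Variables (k0 : fieldType) (k : fieldExtType k0) (sigk : {rmorphism k -> k}).
Variables (n m : nat) (beta : k) (F : cyclic_algebra sigk n).
Variables (V : polarized_space m beta F) (xi : F) (Q : quiver V xi).
Variable P : quiver_pairings Q.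
Hypothesis xi_unit : xi \is a GRing.unit.
Hypothesis xi_fixed : sigma F xi = xi.
Local Notation S := (Smod (q0 := Q)).
Local Notation xb := (xibar Q).
Local Notation B := (vform (p := V)).
Local Notation pe := pairing_ext.
Local Notation mp i j := (@mpair _ _ _ _ _ _ _ _ _ _ P i j).
Implicit Types (i j : Q).

Variable alpha : {set {set Q}}.
Variables (dV dAut dHom dOut dIn : {set Q}).
Local Notation C := (finset.cover alpha).
Local Notation dE := (dHom :|: dOut :|: dIn).
(** What the description needs from a shape: [dV] meets every pair {i, dia i} of vertices, in a
    single vertex unless it is fixed and in [dAut]; the chosen arrows meet every pair of opposite
    arrows, those in [dOut] and [dIn] being fixed and those in [dHom] excluding their opposites. *)
Hypotheses (C_dia : forall i, i \in C -> dia i \in C)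
  (C_xb : forall i, i \in C -> xb i \in C)
  (dV_sub : forall i, i \in dV -> i \in C)
  (dV_cover : forall i, i \in C -> i \in dV \/ dia i \in dV)
  (dAut_dia : forall i, i \in dAut -> dia i = i)
  (dV_both : forall i, i \in dV -> dia i \in dV -> i \in dAut)
  (dE_sub : forall i, i \in dE -> i \in C)
  (dE_cover : forall i, i \in C -> i \in dE \/ dia (xb i) \in dE)
  (dFix : forall i, i \in dOut :|: dIn -> dia (xb i) = i)
  (dHom_opp : forall i, i \in dHom -> dia (xb i) \notin dE).

Lemma in_C_dia i : (dia i \in C) = (i \in C).
Proof. by apply/idP/idP=> [/C_dia|/C_dia //]; rewrite (diaK P). Qed.

Lemma opp_opp i : dia (xb (dia (xb i))) = i.
Proof. by rewrite (xibar_dia P xi_unit xi_fixed) (diaK P). Qed.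

Lemma in_C_opp i : (dia (xb i) \in C) = (i \in C).
Proof.
apply/idP/idP=> [h|/C_xb/C_dia //]; rewrite -[i]opp_opp; exact/C_dia/C_xb.
Qed.

Section OverR.
Variable R : comAlgType k0.
Local Notation EndV := 'M[R]_(\dim {:V}).
Local Notation EndM i := 'M[R]_(\dim {:M i}).

Lemma H_alpha_comp_off (g : EndV) i : H_alpha alpha g -> i \notin C -> comp g i = 1%:M.
Proof. by move=> [_ gC] iC; apply/comp_unique/gC. Qed.

Lemma H_alpha_model (g : EndV) : H_alpha alpha g ->
  model_group P dV dAut (fun i => comp g i).
Proof.
move=> [gH gC] i iV; have gA := H_commA gH; have [[[h gh] _] _ gB] := gH.
split; first by split=> [|d]; [exists (comp h i); apply: comp_inv | exact: comp_Dact].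
by move=> /dAut_dia di; apply: (preserves_isoM P _ gA gB); rewrite di.
Qed.

Lemma H_alpha_inj (g h : EndV) : H_alpha alpha g -> H_alpha alpha h ->
  (forall i, i \in dV -> comp g i = comp h i) -> g = h.
Proof.
move=> gal hal gh; have [[gA hA] [gB hB]] : (commA g /\ commA h) /\ (preserves B g /\ preserves B h).
  by case: gal hal => [gH _] [hH _]; split; split; try exact: H_commA; case: gH; case: hH.
suff ghi i : comp g i = comp h i.
  by apply: (tensf_ev_ext (Q := Q)) => i u; rewrite !compP // ghi.
have [iC|iC] := boolP (i \in C); last by rewrite !H_alpha_comp_off.
have [/gh //|jV] := dV_cover iC; set j := dia i in jV.
have e : i = dia j by rewrite /j (diaK P).
apply: tens_mx_ext => z; apply: (mpairR_inj_r (P := P) e) => w.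
have [[[[g' gg'] _] _ _] _] := gal.
have gg := comp_inv j gg' gA.
have -> : w = comp g j *m (comp g' j *m w) by rewrite mulmxA gg.1 mul1mx.
set w' := comp g' j *m w.
rewrite (preserves_isoM P e gA gB) gh //.
by rewrite (preserves_isoM P e hA hB).
Qed.

Section Lift.
Variable g0 : forall i, EndM i.
Hypothesis g0_model : model_group P dV dAut g0.

(** Outside [dV] the component must be contragredient to the one at the mirror vertex. All these
    contragredients are produced together, as components of the adjoint [Kt] of the inverse of an
    assembled [K], because adjoints are available on V. *)
Lemma group_lift : exists2 g, H_alpha alpha g & forall i, i \in dV -> comp g i = g0 i.
Proof.
have [g0' g0'P] : exists g0' : forall i, EndM i,
    forall i, i \in dV -> is_inverse_mx (g0 i) (g0' i).
  have ex i : exists h : EndM i, i \in dV -> is_inverse_mx (g0 i) h.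
    have [/g0_model[[[h hE] _] _]|_] := boolP (i \in dV); first by exists h.
    by exists 0.
  exists (fun i => projT1 (cid (ex i))) => i iV.
  by case: cid => h /= /(_ iV).
(* Vertices in [dAut] are their own mirrors and their components are isometries already, so [K] is
   trivial there. *)
pose big i := (i \in dV) && (i \notin dAut).
pose c1 i : EndM i := if big i then g0 i else 1%:M.
pose c1' i : EndM i := if big i then g0' i else 1%:M.
have c1inv i : is_inverse_mx (c1 i) (c1' i).
  rewrite /c1 /c1' /big; case: ifP => [/andP[/g0'P]//|_].
  by split; rewrite mul1mx.
have inv_comm i (a b t : EndM i) : is_inverse_mx a b -> a *m t = t *m a -> b *m t = t *m b.
  move=> [ab ba] at_.
  by rewrite -[b *m t]mulmx1 -ab mulmxA -(mulmxA b) -at_ (mulmxA b) ba mul1mx.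
have c1D i (d : D i) : c1 i *m tensf R (Dact d) = tensf R (Dact d) *m c1 i.
  rewrite /c1; case: ifP => [/andP[iV _]|_]; last by rewrite mul1mx mulmx1.
  by have [[_ h] _] := g0_model iV; apply: h.
have c1'D i (d : D i) : c1' i *m tensf R (Dact d) = tensf R (Dact d) *m c1' i.
  exact: inv_comm (c1inv i) (c1D i d).
have KP i := asmP (c := c1) (c1D i); have K'P i := asmP (c := c1') (c1'D i).
set K := asm c1 in KP; set K' := asm c1' in K'P.
have KA : commA K := commA_of_vcomp KP.
have K'A : commA K' := commA_of_vcomp K'P.
have [Ks KsA KsE] := adjointR KA; have [Kt KtA KtE] := adjointR K'A.
have KK' : K *m K' = 1%:M.
  apply: (tensf_ev_ext (Q := Q)) => i u.
  by rewrite (vcomp_mul (KP i) (K'P i)) (c1inv i).1 mulmx1 mul1mx.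
have K'K : K' *m K = 1%:M.
  apply: (tensf_ev_ext (Q := Q)) => i u.
  by rewrite (vcomp_mul (K'P i) (KP i)) (c1inv i).2 mulmx1 mul1mx.
have KtKs : is_inverse_mx Kt Ks.
  split; apply: tens_mx_ext => x; apply: vformR_inj_r => b.
    by rewrite -mulmxA -KtE -KsE mulmxA KK' !mul1mx.
  by rewrite -mulmxA -KsE -KtE mulmxA K'K !mul1mx.
pose cc i : EndM i := if i \in dV then g0 i else comp Kt i.
have ccinv i : exists h, is_inverse_mx (cc i) h.
  rewrite /cc; case: ifP => [/g0'P h|_]; first by exists (g0' i).
  by exists (comp Ks i); apply: comp_inv.
have ccD i (d : D i) : cc i *m tensf R (Dact d) = tensf R (Dact d) *m cc i.
  rewrite /cc; case: ifP => [iV|_]; last exact: comp_Dact.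
  by have [[_ h] _] := g0_model iV; apply: h.
have GP i := asmP (c := cc) (ccD i); set G := asm cc in GP.
have GA : commA G := commA_of_vcomp GP.
have Gc i : comp G i = cc i by apply: comp_unique.
pose cc' i : EndM i := projT1 (cid (ccinv i)).
have cc'P i : is_inverse_mx (cc i) (cc' i) by rewrite /cc'; case: cid.
have cc'D i (d : D i) : cc' i *m tensf R (Dact d) = tensf R (Dact d) *m cc' i.
  exact: inv_comm (cc'P i) (ccD i d).
have G'P i := asmP (c := cc') (cc'D i); set G' := asm cc' in G'P.
have GG' : is_inverse_mx G G'.
  split; apply: (tensf_ev_ext (Q := Q)) => i u.
    by rewrite (vcomp_mul (GP i) (G'P i)) (cc'P i).1 mulmx1 mul1mx.
  by rewrite (vcomp_mul (G'P i) (GP i)) (cc'P i).2 mulmx1 mul1mx.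
have K'c i : comp K' i = c1' i by apply: comp_unique.
have Kt_adj i j w z : j = dia i -> pe (mp i j) (c1' i *m w) z = pe (mp i j) w (comp Kt j *m z).
  move=> e; have := comp_pairing_vform P e K'A (commA1 V R) (commA1 V R) KtA.
  rewrite !comp1 K'c => h; have := h _ w z; rewrite !mul1mx; apply.
  by move=> a b; rewrite !mul1mx KtE.
have Kt1 i j : j = dia i -> ~~ big i -> comp Kt j = 1%:M.
  move=> e nb; apply: tens_mx_ext => z; apply: (mpairR_inj_r (P := P) e) => w.
  by rewrite -Kt_adj // /c1' (negPf nb) !mul1mx.
have nbig_dia i : i \in dV -> ~~ big (dia i).
  move=> iV; rewrite /big; have [djV|//] := boolP (dia i \in dV).
  have iA := dV_both iV djV; by rewrite (dAut_dia iA) iA.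
have cc_off i : i \notin C -> cc i = 1%:M.
  move=> iC; have iV : (i \in dV) = false by apply/negbTE; apply: contra iC => /dV_sub.
  rewrite /cc iV (Kt1 (dia i)) ?(diaK P) // /big.
  by apply: contra iC => /andP[/dV_sub]; rewrite in_C_dia.
have isoV i j : j = dia i -> i \in dV -> isoM P (comp G i) (comp G j).
  move=> e iV w z; rewrite !Gc {1}/cc iV.
  have [iA|iA] := boolP (i \in dAut).
    have ji : j = i by rewrite e dAut_dia.
    clear e; subst j; rewrite /cc iV; have [_ /(_ iA) gB] := g0_model iV; exact: gB.
  have bi : big i by rewrite /big iV.
  have jV : (j \in dV) = false.
    by apply/negbTE; rewrite e; apply: contra iA; apply: dV_both.
  rewrite /cc jV -Kt_adj // mulmxA.
  by have := (c1inv i).2; rewrite {1}/c1 bi => ->; rewrite mul1mx.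
have GB : preserves B G.
  apply: (preserves_of_iso (P := P) GA) => i.
  have [iC|iC] := boolP (i \in C).
    by case: (dV_cover iC) => iV; [left | right]; apply: isoV.
  by left => w z; rewrite !Gc !cc_off ?in_C_dia // !mul1mx.
have [GF GT] := GA.
exists G; last by move=> i iV; rewrite Gc /cc iV.
split; first by split=> //; split=> //; exists G'.
by move=> i iC u; rewrite GP cc_off.
Qed.
End Lift.

Lemma contragredient_comp (h : EndV) (h' : EndV) i j : is_inverse_mx h h' -> commA h ->
  preserves B h -> j = dia i -> contragredient (mp i j) (comp h i) (comp h j).
Proof.
move=> hh hA hB e; have hhj := comp_inv j hh hA.
exists (comp h' j); last by case: hhj.
move=> u v; rewrite -[in RHS](preserves_isoM P e hA hB).
by rewrite mulmxA hhj.1 mul1mx.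
Qed.

Lemma contragredient_unique (h : EndV) i j (gc : EndM j) : j = dia i -> commA h ->
  preserves B h -> contragredient (mp i j) (comp h i) gc -> gc = comp h j.
Proof.
move=> e hA hB [gs gsE [gg _]].
have gh : gs *m comp h j = 1%:M.
  apply: tens_mx_ext => z; apply: (mpairR_inj_r (P := P) e) => w.
  by rewrite mul1mx -mulmxA -gsE (preserves_isoM P e hA hB).
have [gg' gg2] : is_inverse_mx gs gc by split=> //; exact: mulmx1C.
by rewrite -[gc]mulmx1 -gh mulmxA gg2 mul1mx.
Qed.

End OverR.

Lemma comp_map (R R' : comAlgType k0) (f : {lrmorphism R -> R'}) (g : 'M[R]_(\dim {:V})) i :
  comp (map_mx f g) i = map_mx f (comp g i).
Proof.
have tf (X Y : vectType k0) (h : 'Hom(X, Y)) : tensf R' h = map_mx f (tensf R h).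
  by apply/matrixP=> a b; rewrite !mxE rmorph_alg.
rewrite /comp map_mx_sum; apply: eq_bigr => l _.
by rewrite !map_mxM /= !tf.
Qed.

Lemma described_group : is_group_iso P alpha dV dAut (fun R g i => comp g i).
Proof.
split.
- by move=> R g; apply: H_alpha_model.
- by move=> R g h [gH _] [hH _] i _; apply: compM; apply: H_commA.
- by move=> R g h; apply: H_alpha_inj.
- by move=> R g'; apply: group_lift.
by move=> R R' f g _ i _; apply: comp_map.
Qed.

Lemma g_alpha_mem (phi : 'End(V)) : phi \in g_alpha alpha <->
  phi \in g_xi V xi /\ forall i, i \notin C -> is_arrow_component phi (0 : 'Hom(M i, M (xb i))).
Proof.
apply: vspace_ofP => [|a f g [fX fC] [gX gC]].
  split; first exact: mem0v.
  by move=> i _ u x; rewrite !lfunE /= linear0.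
split; first by rewrite memvD // memvZ.
by move=> i iC u x; rewrite add_lfunE scale_lfunE fC // gC // lfunE /= linear0 scaler0 addr0.
Qed.

Lemma g_xi_twisted (phi : 'End(V)) : phi \in g_xi V xi -> twisted xi phi.
Proof. by move/g_xi_mem => [pF pT _]. Qed.

Lemma g_alpha_comp_off (phi : 'End(V)) i : phi \in g_alpha alpha -> i \notin C -> acomp phi i = 0.
Proof. by move=> /g_alpha_mem[_ pC] iC; apply/acomp_unique/pC. Qed.

Definition Lam i : 'Hom(subvs_of (g_alpha alpha), 'Hom(M i, M (xb i))) :=
  linfun (fun phi => acomp (vsval phi) i).

Lemma LamE i phi : Lam i phi = acomp (vsval phi) i.
Proof.
by rewrite /Lam lfun_linfun // => a f g; rewrite linearP acomp_linear.
Qed.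

Lemma g_alpha_ev (phi : subvs_of (g_alpha alpha)) i (u : S i) x :
  vsval phi (ev u x) = ev (eta i (xb i) u) (Lam i phi x).
Proof.
have [/g_xi_twisted pT _] := (proj1 (g_alpha_mem _)) (subvsP phi).
by rewrite LamE -(acompP pT).
Qed.

Lemma g_alpha_anti (phi : subvs_of (g_alpha alpha)) x y :
  B (vsval phi x) y + B x (vsval phi y) = 0.
Proof.
by have [/g_xi_mem[_ _ h] _] := (proj1 (g_alpha_mem _)) (subvsP phi).
Qed.

Lemma vspan_ind (T : V -> Prop) : T 0 -> (forall x y, T x -> T y -> T (x + y)) ->
  (forall i (u : S i) x, T (ev u x)) -> forall v, T v.
Proof.
move=> T0 TD Te v; rewrite (decomp Q v).
apply: (big_ind T) => // i _; apply: (big_ind T) => // a _; exact: Te.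
Qed.

Lemma vform_ev_ext y y' : (forall i (u : S i) x, B (ev u x) y = B (ev u x) y') -> y = y'.
Proof.
move=> h; apply: vform_inj_r; apply: vspan_ind => //; first by rewrite !vform0l.
by move=> a b ha hb; rewrite !vformDl ha hb.
Qed.

Lemma anti_ext (phi : 'End(V)) :
  (forall i j (u : S i) (v : S j) x y,
     B (phi (ev u x)) (ev v y) + B (ev u x) (phi (ev v y)) = 0) ->
  forall x y, B (phi x) y + B x (phi y) = 0.
Proof.
move=> h; apply: vspan_ind => [y|a b ha hb y|i u x].
- by rewrite linear0 !vform0l addr0.
- by rewrite linearD /= !vformDl addrACA ha hb addr0.
apply: vspan_ind => [|a b ha hb|//].
  by rewrite linear0 !vform0r addr0.
by rewrite linearD /= !vformDr addrACA ha hb addr0.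
Qed.

(** Taking adjoints moves a component to the opposite arrow: the i-th component of [fs] can pair
    nontrivially only with the vertex [dia (xb i)]. *)
Lemma adjoint_arrow0 (f fs : 'End(V)) (psi : forall i, 'Hom(M i, M (xb i))) i :
  (forall x y, B (f x) y = B x (fs y)) ->
  (forall j, is_arrow_component f (psi j)) -> psi (dia (xb i)) = 0 ->
  is_arrow_component fs (0 : 'Hom(M i, M (xb i))).
Proof.
move=> fsE fP p0 u x; rewrite zero_lfunE linear0; apply: vform_ev_ext => j w y.
rewrite vform0r -fsE fP; have [e|/eqP ne] := eqVneq j (dia (xb i)).
  by subst j; rewrite p0 zero_lfunE linear0 vform0l.
apply: (vform_orth P) => e; apply: ne.
by rewrite e (xibar_dia P xi_unit xi_fixed) (diaK P).
Qed.

Lemma is_Dhom0 i : is_Dhom (0 : 'Hom(M i, M (xb i))).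
Proof. by move=> d x; rewrite !zero_lfunE linear0. Qed.

Lemma described_space : is_space_iso P dHom dOut dIn Lam.
Proof.
split.
- move=> phi; have [/g_xi_twisted pT _] := (proj1 (g_alpha_mem _)) (subvsP phi).
  have pD i : is_Dhom (Lam i phi) by rewrite LamE; apply: acomp_Dhom.
  split=> i iE //; apply/(fixed_antisymP P xi_unit xi_fixed (dFix iE)) => // x y u v.
  by rewrite -!g_alpha_ev g_alpha_anti.
- move=> phi psi h; apply: val_inj => /=; apply: (ev_ext (Q := Q)) => i u x.
  rewrite !g_alpha_ev; have [iE|iE] := boolP (i \in dE); first by rewrite h.
  have [iC|iC] := boolP (i \in C); last first.
    rewrite !LamE !g_alpha_comp_off //; exact: subvsP.
  (* Antisymmetry expresses an unchosen component through the one at the opposite arrow, which is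
     chosen. *)
  have jE : dia (xb i) \in dE by case: (dE_cover iC) => // iE'; rewrite iE' in iE.
  apply: vform_ev_ext => j w y; rewrite -!g_alpha_ev.
  have pB (p : subvs_of (g_alpha alpha)) a b : B a (vsval p b) = - B (vsval p a) b.
    by apply/eqP; rewrite -addr_eq0 addrC g_alpha_anti.
  rewrite !pB !g_alpha_ev; congr (- _).
  have [e|/eqP ne] := eqVneq j (dia (xb i)); first by subst j; rewrite h.
  by rewrite !(vform_orth P) // => e; apply: ne;
    rewrite e (xibar_dia P xi_unit xi_fixed) (diaK P).
move=> psi [psiD psiH].
have dHomF i : i \in dHom -> (i \in dOut :|: dIn) = false.
  move=> iH; apply/negbTE/negP => /dFix e; have := dHom_opp iH.
  by rewrite e !inE iH.
pose psi1 i := if i \in dHom then psi i else 0.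
pose psi0 i := if i \in dOut :|: dIn then psi i else 0.
have psi1D i : is_Dhom (psi1 i).
  by rewrite /psi1; case: ifP => [/psiD//|_]; apply: is_Dhom0.
have psi0D i : is_Dhom (psi0 i).
  by rewrite /psi0; case: ifP => [/psiH[]//|_]; apply: is_Dhom0.
have P1 i := asmAP (psi := psi1) (psi1D i); set f1 := asmA psi1 in P1.
have P0 i := asmAP (psi := psi0) (psi0D i); set f0 := asmA psi0 in P0.
have T1 := twisted_of_acomp  P1; have T0 := twisted_of_acomp  P0.
have [f1s [f1sE f1sF]] := adjoint_ex (proj1 T1).
have T1s := adjoint_twisted  xi_fixed T1 f1sE f1sF.
(* The difference of [f1] and its adjoint is antisymmetric for any [f1], and the adjoint lives on
   the opposites of the arrows in [dHom], none of which is chosen. Fixed arrows cannot be treated in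
   this way; [f0] is antisymmetric by the condition defining h^{- eps eps_e}. *)
pose phi := f1 - f1s + f0.
have phiE x : phi x = f1 x - f1s x + f0 x by rewrite /phi !add_lfunE opp_lfunE.
have phi_comp i : psi1 (dia (xb i)) = 0 -> is_arrow_component phi (psi1 i + psi0 i).
  move=> p0 u x; rewrite phiE (adjoint_arrow0 f1sE P1 p0) P1 P0.
  by rewrite zero_lfunE linear0 subr0 add_lfunE linearD.
have phiX : phi \in g_xi V xi.
  apply/g_xi_mem; split.
  - by move=> a x; rewrite !phiE !linearD linearN /= T1.1 T1s.1 T0.1.
  - by move=> x; rewrite !phiE !linearD !linearN /= T1.2 T1s.2 T0.2.
  have h0 x y : B (f0 x) y + B x (f0 y) = 0.
    move: x y; apply: anti_ext => i j u v x y; rewrite !P0 /psi0.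
    have orth i1 j1 : j1 \in dOut :|: dIn -> i1 <> j1 -> xb j1 <> dia i1.
      by move=> jE ne e; apply: ne; rewrite -(dFix jE) e (diaK P).
    have [e|/eqP ne] := eqVneq i j.
      subst j; case: ifP => iE; last by rewrite !zero_lfunE !linear0 vform0l vform0r addr0.
      by have /(fixed_antisymP P xi_unit xi_fixed (dFix iE) (psiH _ iE).1) := psiH _ iE; apply.
    rewrite [X in X + _](_ : _ = 0) ?[X in _ + X](_ : _ = 0) ?addr0 //.
      case: ifP => jE; last by rewrite zero_lfunE linear0 vform0r.
      by apply: (vform_orth P); apply: orth.
    case: ifP => iE; last by rewrite zero_lfunE linear0 vform0l.
    apply: (vform_orth P) => e.
    apply: (orth j i iE) => [e'|]; first by apply: ne.
    by rewrite e (diaK P).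
  move=> x y; rewrite !phiE !vformDl !vformDr addrACA h0 addr0.
  rewrite -scaleN1r -[- f1s y]scaleN1r vformZl vformZr f1sE (adjoint_sym f1sE).
  by rewrite !scaleN1r addrA subrK subrr.
have psi1_off i : i \notin dHom -> psi1 i = 0 by rewrite /psi1 => /negbTE->.
have psi0_off i : i \notin dOut :|: dIn -> psi0 i = 0 by rewrite /psi0 => /negbTE->.
have phiA : phi \in g_alpha alpha.
  apply/g_alpha_mem; split=> // i iC.
  have nE j : j \notin C -> (j \notin dHom) /\ (j \notin dOut :|: dIn).
    move=> jC; split; apply: contra jC => jE; apply: dE_sub; rewrite -setUA in_setU jE ?orbT //.
  have -> : 0 = psi1 i + psi0 i.
    by have [h1 h2] := nE i iC; rewrite psi1_off ?psi0_off ?addr0.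
  by apply: phi_comp; apply: psi1_off; apply: (proj1 (nE _ _)); rewrite in_C_opp.
exists (vsproj _ phi) => i iE; rewrite LamE vsprojK //.
have [iH|iH] := boolP (i \in dHom).
  have -> : psi i = psi1 i + psi0 i by rewrite /psi1 iH psi0_off ?addr0 // dHomF.
  apply/acomp_unique/phi_comp/psi1_off.
  by apply: contra (dHom_opp iH); rewrite !inE => ->.
have iO : i \in dOut :|: dIn by move: iE; rewrite !inE (negPf iH).
have -> : psi i = psi1 i + psi0 i by rewrite /psi0 iO psi1_off ?add0r.
by apply/acomp_unique/phi_comp; rewrite psi1_off // (dFix iO).
Qed.

Section Equivariance.
Variable R : comAlgType k0.
Local Notation EndV := 'M[R]_(\dim {:V}).
Local Notation inEnd :=
  (lin_ext (fun phi : subvs_of (g_alpha alpha) => tensf R (vsval phi))).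
Local Notation LamR i := (lin_ext (fun phi => tensf R (Lam i phi))).

Lemma tens_span_ind (T : 'cV[R]_(\dim {:V}) -> Prop) :
  (forall a x y, T x -> T y -> T (a *: x + y)) ->
  (forall j (v : S j) z, T (tensf R (ev v) *m z)) -> T 0 -> forall b, T b.
Proof.
move=> TD Te T0 b; rewrite (tens1_col b).
apply: (big_ind T) => // [x y hx hy|s _]; first by rewrite -[x]scale1r; apply: TD.
rewrite -[_ *: _]addr0; apply: (TD) => //; move: (_`_s) => y.
apply: (vspan_ind (T := fun y => T (tens1 R y))); first by rewrite tens10.
  by move=> x z hx hz; rewrite tens1D -[tens1 R x]scale1r; apply: TD.
by move=> i u x; rewrite -tensfE; apply: Te.
Qed.

Lemma inEnd_ev (X : 'cV[R]_(\dim {: subvs_of (g_alpha alpha)})) i (u : S i) :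
  inEnd X *m tensf R (ev u) = tensf R (ev (eta i (xb i) u)) *m LamR i X.
Proof.
rewrite /lin_ext mulmx_suml mulmx_sumr; apply: eq_bigr => s _.
rewrite -scalemxAl -scalemxAr -!tensf_comp; congr (_ *: tensf R _).
by apply/lfunP=> x; rewrite !comp_lfunE g_alpha_ev.
Qed.

Lemma inEnd_anti (X : 'cV[R]_(\dim {: subvs_of (g_alpha alpha)})) a b :
  pe B (inEnd X *m a) b + pe B a (inEnd X *m b) = 0.
Proof.
rewrite /lin_ext !mulmx_suml pairing_ext_suml pairing_ext_sumr -big_split.
apply: big1 => s _ /=; rewrite -!scalemxAl pairing_extZl pairing_extZr -scalerDr.
rewrite pairing_ext_compl; last exact: vform_bilin.
rewrite pairing_ext_compr; last exact: vform_bilin.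
rewrite !pairing_extE -big_split big1 ?scaler0 // => t _; rewrite -big_split big1 // => r _.
by rewrite /= -scalerDr -tens1D g_alpha_anti tens10 scaler0.
Qed.

Lemma LamR_off (X : 'cV[R]_(\dim {: subvs_of (g_alpha alpha)})) i :
  i \notin C -> LamR i X = 0.
Proof.
move=> iC; apply: big1 => s _; rewrite LamE g_alpha_comp_off ?tensf0 ?scaler0 //.
exact: subvsP.
Qed.

Lemma equivariant_comp (h : EndV) X Y : commA h ->
  inEnd Y *m h = h *m inEnd X <->
  forall i, LamR i Y *m comp h i = comp h (xb i) *m LamR i X.
Proof.
move=> hA; split=> [E i|E].
  apply: (tensf_ev_inj (Q := Q)) => w.
  rewrite -[w]etaVK; set u := (eta i (xb i))^-1%VF w.
  by rewrite [LHS]mulmxA -inEnd_ev -mulmxA -(compP hA) mulmxA E -mulmxA inEnd_ev mulmxA (compP hA) -mulmxA.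
apply: (tensf_ev_ext (Q := Q)) => i u.
by rewrite -!mulmxA inEnd_ev (compP hA) !mulmxA inEnd_ev (compP hA) -!mulmxA E.
Qed.

Lemma described_equivariant_R (h : EndV) X Y : H_alpha alpha h ->
  inEnd Y *m h = h *m inEnd X <->
  forall i, model_action P dHom dOut dIn (fun i => comp h i) (LamR i X) (LamR i Y).
Proof.
move=> [hH _]; have hA := H_commA hH; have [[[h' hh] _] _ hB] := hH.
have dOut_opp i : i \in dOut -> xb i = dia i.
  by move=> iO; rewrite -[in RHS](dFix (i := i)) ?inE ?iO // (diaK P).
have dIn_opp i : i \in dIn -> i = dia (xb i).
  by move=> iI; rewrite dFix // inE iI orbT.
split=> [/(equivariant_comp X Y hA) E i|E].
  split=> [_|iO|iI]; first exact: E.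
    exists (comp h (xb i)); last exact: E.
    by apply: (contragredient_comp hh) => //; apply: dOut_opp.
  exists (comp h i); last exact: E.
  by apply: (contragredient_comp hh) => //; apply: dIn_opp.
have EE i : i \in dE -> LamR i Y *m comp h i = comp h (xb i) *m LamR i X.
  have [E1 E2 E3] := E i; rewrite -setUA !in_setU => /or3P[|iO|iI]; first exact: E1.
    have [gc gcP ->] := E2 iO.
    by rewrite (contragredient_unique (dOut_opp _ iO) hA hB gcP).
  have [gc gcP] := E3 iI.
  by rewrite (contragredient_unique (dIn_opp _ iI) hA hB gcP).
pose Z := inEnd Y *m h - h *m inEnd X.
pose Zi i := LamR i Y *m comp h i - comp h (xb i) *m LamR i X.
have ZE i (u : S i) : Z *m tensf R (ev u) = tensf R (ev (eta i (xb i) u)) *m Zi i.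
  rewrite mulmxBl -!mulmxA inEnd_ev (compP hA) !mulmxA inEnd_ev (compP hA).
  by rewrite -!mulmxA -mulmxBr.
(* The model action gives the vanishing of the intertwining defect [Z] at the chosen arrows only.
   This antisymmetry relative to the isometry h transfers it to the opposite arrows. *)
have Zanti a b : pe B (Z *m a) (h *m b) = - pe B (h *m a) (Z *m b).
  rewrite !mulmxBl pairing_extDl pairing_extDr pairing_extNl pairing_extNr.
  rewrite -!mulmxA !hB.
  have /eqP := inEnd_anti Y (h *m a) (h *m b); rewrite addr_eq0 => /eqP ->.
  have /eqP := inEnd_anti X a b; rewrite addr_eq0 => /eqP ->.
  by rewrite [RHS]opprD.
suff Z0 : Z = 0 by apply/eqP; rewrite -subr_eq0 -/Z Z0.
apply: (tensf_ev_ext (Q := Q)) => i u; rewrite mul0mx ZE.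
have [iE|iE] := boolP (i \in dE); first by rewrite /Zi EE // subrr mulmx0.
have [iC|iC] := boolP (i \in C); last first.
  by rewrite /Zi !LamR_off // mul0mx mulmx0 subr0 mulmx0.
have jE : dia (xb i) \in dE by case: (dE_cover iC) => // iE'; rewrite iE' in iE.
apply: tens_mx_ext => x; rewrite mul0mx -ZE -!mulmxA.
apply: (vformR_inj_l (V := V)) => b; rewrite pairing_ext0l.
rewrite -[b]mul1mx -hh.1 -mulmxA; move: (h' *m b); apply: tens_span_ind.
- by move=> a y z hy hz; rewrite mulmxDr -scalemxAr pairing_extDr pairing_extZr hy hz scaler0 addr0.
- move=> j v z; have [e|/eqP ne] := eqVneq j (dia (xb i)).
    subst j; rewrite Zanti mulmxA mulmxA ZE /Zi EE // subrr mulmx0 !mul0mx.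
    by rewrite pairing_ext0r oppr0.
  rewrite mulmxA mulmxA ZE (compP hA) -!mulmxA.
  by apply: (vformR_orth P).
by rewrite mulmx0 pairing_ext0r.
Qed.
End Equivariance.

Lemma described : pair_described P alpha dV dAut dHom dOut dIn.
Proof.
exists (fun R g i => comp g i), Lam; split.
- exact: described_group.
- exact: described_space.
by move=> R h X Y hH; apply: described_equivariant_R.
Qed.

End Description.

(** * Shapes *)

Section Shapes.
Variables (k0 : fieldType) (k : fieldExtType k0) (sigk : {rmorphism k -> k}).
Variables (n m : nat) (beta : k) (F : cyclic_algebra sigk n).
Variables (V : polarized_space m beta F) (xi : F) (Q : quiver V xi).
Variable P : quiver_pairings Q.
Hypothesis xi_unit : xi \is a GRing.unit.
Hypothesis xi_fixed : sigma F xi = xi.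
Local Notation xb := (xibar Q).
Local Notation orb i := (porbit xb i).
Implicit Types (i j : Q) (alpha : {set {set Q}}).

Let xbdK i : xb (dia (xb i)) = dia i := xibar_dia P xi_unit xi_fixed i.
Let ddK i : dia (dia i) = i := diaK P i.

Lemma dia_inj : injective (@dia _ _ _ _ _ _ _ _ _ Q).
Proof. exact: can_inj ddK. Qed.

Lemma orb_xb i : orb (xb i) = orb i.
Proof. by have := porbit_perm xb 1 i; rewrite expg1. Qed.

Lemma connect_adj i j : connect (@Q_adj _ _ _ _ _ _ _ _ _ Q) i j = (j \in orb i).
Proof.
apply/idP/porbitP => [/connectP[p]|[t ->]].
  elim: p i => [|x p IH] i /=; first by move=> _ ->; exists 0%N; rewrite expg0 perm1.
  move=> /andP[ix xp] e; have /porbitP : j \in orb i; last by [].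
  have /porbitP jx := IH x xp e.
  by case/orP: ix => /eqP h; move: jx; rewrite h orb_xb.
elim: t => [|t IH]; first by rewrite expg0 perm1.
by apply: connect_trans IH (connect1 _); rewrite /Q_adj /= expgSr permM eqxx.
Qed.

Lemma components_porbits : components Q = porbits xb.
Proof.
have E i : [set j in [set: Q] | connect (@Q_adj _ _ _ _ _ _ _ _ _ Q) i j] = orb i.
  by apply/setP=> j; rewrite !inE connect_adj.
apply/setP=> C; apply/imsetP/imsetP => -[i _ ->]; exists i; rewrite ?inE ?E //.
Qed.

Lemma dia_orb i j : j \in orb i -> dia j \in orb (dia i).
Proof.
case/porbitP=> t ->; elim: t i => [|t IH] i.
  by rewrite expg0 perm1 porbit_id.
by rewrite expgS permM -[in X in _ \in X]xbdK orb_xb; apply: IH.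
Qed.

Lemma dia_imset_orb i : [set dia j | j in orb i] = orb (dia i).
Proof.
apply/setP=> j; apply/imsetP/idP => [[x /dia_orb xi' ->] //|jd].
by exists (dia j); rewrite ?ddK // -[i]ddK; apply: dia_orb.
Qed.

Definition orbit_of i : {set {set Q}} := [set orb i; orb (dia i)].

Lemma orbit_of_Pi i : orbit_of i \in Pi_orbits Q.
Proof.
apply/imsetP; exists (orb i); last by rewrite dia_imset_orb.
by rewrite components_porbits; apply: imset_f.
Qed.

Lemma Pi_orbit_of alpha : alpha \in Pi_orbits Q -> exists i, alpha = orbit_of i.
Proof.
case/imsetP=> C; rewrite components_porbits => /imsetP[i _ ->] ->.
by exists i; rewrite dia_imset_orb.
Qed.

Lemma cover_orbit_of i j :
  (j \in finset.cover (orbit_of i)) = (j \in orb i) || (j \in orb (dia i)).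
Proof.
apply/bigcupP/orP => [[C]|[h|h]].
- by rewrite !inE => /orP[]/eqP->; [left | right].
- by exists (orb i); rewrite // !inE eqxx.
by exists (orb (dia i)); rewrite // !inE eqxx orbT.
Qed.

Lemma orbit_of_xb i : orbit_of (xb i) = orbit_of i.
Proof.
by rewrite /orbit_of orb_xb -[in orb (dia i)]xbdK orb_xb.
Qed.

Lemma orbit_of_dia i : orbit_of (dia i) = orbit_of i.
Proof. by rewrite /orbit_of ddK setUC. Qed.

Lemma orbit_of_mem i j : j \in orb i -> orbit_of j = orbit_of i.
Proof.
case/porbitP=> t ->; elim: t => [|t IH]; first by rewrite expg0 perm1.
by rewrite expgSr permM orbit_of_xb.
Qed.

Lemma in_cover alpha i : alpha \in Pi_orbits Q ->
  (i \in finset.cover alpha) = (alpha == orbit_of i).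
Proof.
case/Pi_orbit_of=> x ->; rewrite cover_orbit_of.
apply/idP/eqP => [/orP[/orbit_of_mem->|/orbit_of_mem->]|e].
- by [].
- by rewrite orbit_of_dia.
have : orb i \in orbit_of x by rewrite e !inE eqxx.
by rewrite !inE => /orP[]/eqP <-; rewrite porbit_id ?orbT.
Qed.

Lemma cover_xb alpha i : alpha \in Pi_orbits Q -> i \in finset.cover alpha ->
  xb i \in finset.cover alpha.
Proof. by move=> aP; rewrite !in_cover // orbit_of_xb. Qed.

Lemma cover_dia alpha i : alpha \in Pi_orbits Q -> i \in finset.cover alpha ->
  dia i \in finset.cover alpha.
Proof. by move=> aP; rewrite !in_cover // orbit_of_dia. Qed.

Lemma iter_dia t i : iter t xb (dia (iter t xb i)) = dia i.
Proof. by elim: t => // t IH; rewrite [in iter t.+1 xb i]/= iterSr xbdK. Qed.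

Lemma iter_xb_inj t : injective (iter t xb).
Proof. by elim: t => [|t IH] i j //= /perm_inj /IH. Qed.

(** On a cycle [dia] is a reflection: it exchanges the positions t and s whenever their sum is the
    position of [dia i]. *)
Lemma dia_iter s t i : iter (t + s) xb i = dia i -> dia (iter t xb i) = iter s xb i.
Proof. by move=> h; apply: (@iter_xb_inj t); rewrite iter_dia -iterD h. Qed.

(* Every shape lists the vertices of its cycle in the order x, xb x, xb (xb x), etc. *)
Lemma labels_traject (v : nat -> Q) x (b p c q : nat) :
  (forall j : nat, (j < p)%N -> v (b + j)%N = iter j xb x) ->
  (forall j : nat, (j < q)%N -> dia (v (c + j)%N) = iter (p + q - j.+1) xb x) ->
  labels v b (b + p) ++ dia_labels v c (c + q) = traject xb x (p + q).
Proof.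
move=> vp vq; apply: (@eq_from_nth _ x) => [|t].
  by rewrite size_cat size_rev !size_map !size_iota size_traject !addKn.
rewrite size_cat size_rev !size_map !size_iota !addKn => tN.
rewrite nth_traject // nth_cat size_map size_iota addKn.
case: ltnP => tp.
  by rewrite (nth_map 0%N) ?size_iota ?addKn // nth_iota ?addKn // vp.
rewrite nth_rev !size_map !size_iota addKn; last by lia.
rewrite -map_comp (nth_map 0%N) ?size_iota ?addKn; last by lia.
rewrite nth_iota ?addKn /=; last by lia.
by rewrite vq; [congr (iter _ _ _); lia | lia].
Qed.

Lemma fcycle_traject x N : iter N xb x = x -> fcycle xb (traject xb x N).
Proof.
case: N => // N e; rewrite /= -[X in rcons _ X]e iterSr -trajectSr.
exact: fpath_traject.
Qed.

Lemma fcycle_is_traject x (s : seq Q) : fcycle xb (x :: s) ->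
  x :: s = traject xb x (size s).+1 /\ iter (size s).+1 xb x = x.
Proof.
move=> /= /fpathP[N e]; have := congr1 size e; rewrite size_rcons size_traject => sN.
move: e; rewrite -sN trajectSr => /rcons_inj[sE xE].
by split; [rewrite [in LHS]sE | rewrite -iterS iterSr -xE].
Qed.

Lemma orb_cycle_shape alpha x s :
  alpha = orbit_of x -> dia x \in orb x ->
  s = traject xb x #|orb x| -> is_cycle_shape alpha s.
Proof.
move=> -> dx ->; split.
- exact: uniq_traject_porbit.
- by apply: fcycle_traject; rewrite iter_porbit.
move=> i; rewrite cover_orbit_of -porbit_traject.
have /eqP -> : orb (dia x) == orb x by rewrite eq_porbit_mem.
by rewrite orbb.
Qed.

(** If [dia] preserves a cycle of length N, it acts on positions as t |-> r - t modulo N. A fixed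
    vertex exists when r is even or N is odd; seen from it, N even gives VV and N odd gives VE. For
    r odd and N even there is none, and the cycle is EE. *)
Lemma shape_exists alpha : alpha \in Pi_orbits Q ->
  exists (l : nat) (v : nat -> Q),
    [\/ is_CC alpha l v, is_VV alpha l v, is_VE alpha l v | is_EE alpha l v].
Proof.
case/Pi_orbit_of=> x0 ->.
have N_gt0 x : (0 < #|orb x|)%N by apply/card_gt0P; exists x; exact: porbit_id.
have [dx|dx] := boolP (dia x0 \in orb x0); last first.
  exists #|orb x0|, (fun t => iter t.-1 xb x0); apply: Or41.
  have labE : labels (fun t => iter t.-1 xb x0) 1 #|orb x0|.+1 = traject xb x0 #|orb x0|.
    rewrite -[X in traject _ _ X]addn0 -(@labels_traject (fun t => iter t.-1 xb x0) x0 1 _ 0 0) //.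
    by rewrite [dia_labels _ _ _]/(rev _) /= cats0.
  have cyc : fcycle xb (traject xb x0 #|orb x0|).
    by apply: fcycle_traject; rewrite iter_porbit.
  rewrite /is_CC /dia_labels labE; split=> //.
  - rewrite cat_uniq uniq_traject_porbit rev_uniq (map_inj_uniq dia_inj).
    rewrite uniq_traject_porbit andbT /=; apply/hasPn => i.
    rewrite mem_rev => /mapP[j]; rewrite -!porbit_traject => jx ->.
    apply: contra dx => h; have := dia_orb jx; rewrite -!eq_porbit_mem => /eqP <-.
    by rewrite eq_porbit_mem.
  - rewrite rev_cycle cycle_map; apply: sub_cycle cyc => i j /= /eqP <-.
    by rewrite xbdK.
  move=> i; rewrite cover_orbit_of mem_cat mem_rev -porbit_traject; congr (_ || _).
  rewrite -dia_imset_orb; apply/imsetP/mapP => [[j jx ->]|[j]].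
    by exists j; rewrite // -porbit_traject.
  by rewrite -porbit_traject => jx ->; exists j.
have fixed_shape a : orbit_of a = orbit_of x0 -> dia a = a ->
    exists (l : nat) (v : nat -> Q), [\/ is_CC (orbit_of x0) l v,
      is_VV (orbit_of x0) l v, is_VE (orbit_of x0) l v | is_EE (orbit_of x0) l v].
  move=> <- da; set N := #|orb a|; have NE : iter N xb a = a by apply: iter_porbit.
  have dt t : (t <= N)%N -> dia (iter t xb a) = iter (N - t) xb a.
    by move=> tN; apply: dia_iter; rewrite subnKC // NE.
  have aa : dia a \in orb a by rewrite da porbit_id.
  exists N./2, (fun t => iter t xb a).
  have := odd_double_half N; case: (odd N) => NE2; [apply: Or43 | apply: Or42].
    split=> //; apply: (orb_cycle_shape (x := a)) => //.
    rewrite -/N (@labels_traject _ a 0 N./2.+1 1 N./2) //.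
      by congr traject; lia.
    by move=> j jN; rewrite dt; [congr iter; lia | lia].
  have N0 := N_gt0 a; rewrite -/N in N0.
  split=> //; first by lia.
    apply: (orb_cycle_shape (x := a)) => //.
    rewrite [X in dia_labels _ _ X](_ : _ = (1 + N./2.-1)%N); last by lia.
    rewrite -/N (@labels_traject _ a 0 N./2.+1 1 N./2.-1) //.
      by congr traject; lia.
    by move=> j jN; rewrite dt; [congr iter; lia | lia].
  by rewrite dt; [congr iter; lia | lia].
have /porbitP[r rE] := dx; have {}rE : dia x0 = iter r xb x0 by rewrite rE permX.
set N := #|orb x0|; have NE : iter N xb x0 = x0 by apply: iter_porbit.
have orbE t : orbit_of (iter t xb x0) = orbit_of x0.
  by apply: orbit_of_mem; rewrite -permX mem_porbit.
have even_fixed s : iter (s + s) xb x0 = dia x0 -> dia (iter s xb x0) = iter s xb x0.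
  exact: dia_iter.
have [re|ro] := boolP (odd r); last first.
  apply: (fixed_shape (iter r./2 xb x0)); rewrite ?orbE //.
  by apply: even_fixed; rewrite addnn even_halfK // rE.
have [No|Ne] := boolP (odd N).
  apply: (fixed_shape (iter (r + N)./2 xb x0)); rewrite ?orbE //.
  by apply: even_fixed; rewrite addnn even_halfK ?oddD ?re ?No // iterD NE rE.
(* The end point of a fixed arrow: for r odd, the reflection exchanges the consecutive positions (r
   - 1) / 2 and (r + 1) / 2. It becomes the vertex 1 of the shape EE. *)
set y := iter r./2.+1 xb x0.
have yE : xb (dia y) = y.
  rewrite /y (dia_iter (s := r./2)) // rE.
  rewrite [X in iter X](_ : _ = r) //.
  by have := odd_double_half r; rewrite re; lia.
have oy : orb y = orb x0 by apply/eqP; rewrite eq_porbit_mem /y -permX mem_porbit.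
have N0 := N_gt0 y; have NEy : iter N xb y = y by rewrite /N -oy iter_porbit.
rewrite oy -/N in N0.
have dy : dia y = iter N.-1 xb y.
  by apply: (@perm_inj _ xb); rewrite yE -iterS prednK // NEy.
exists N./2, (fun t => iter t.-1 xb y); apply: Or44.
have N2 := even_halfK Ne; split; first by lia.
rewrite -(orbE r./2.+1) -/y; apply: (orb_cycle_shape (x := y)) => //.
  by rewrite dy -permX mem_porbit.
rewrite oy -/N (@labels_traject _ y 1 N./2 1 N./2) //; first by congr traject; lia.
move=> j jN; rewrite /= add0n; apply: dia_iter; rewrite dy; congr iter; lia.
Qed.

End Shapes.

(** * Verification of the combinatorial conditions for each shape *)

Section ShapeDescriptions.
Variables (k0 : fieldType) (k : fieldExtType k0) (sigk : {rmorphism k -> k}).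
Variables (n m : nat) (beta : k) (F : cyclic_algebra sigk n).
Variables (V : polarized_space m beta F) (xi : F) (Q : quiver V xi).
Variable P : quiver_pairings Q.
Hypothesis xi_unit : xi \is a GRing.unit.
Hypothesis xi_fixed : sigma F xi = xi.
Local Notation xb := (xibar Q).
Implicit Types (i j : Q).
Variables (alpha : {set {set Q}}) (l : nat) (v : nat -> Q).
Hypothesis alphaP : alpha \in Pi_orbits Q.
Local Notation C := (finset.cover alpha).

Let xbdK i : xb (dia (xb i)) = dia i := xibar_dia P xi_unit xi_fixed i.
Let ddK i : dia (dia i) = i := diaK P i.

Lemma described_CC : is_CC alpha l v ->
  pair_described P alpha (label_set v 1 l.+1) set0 (label_set v 1 l.+1) set0 set0.
Proof.
move=> [l0 us cyc cycd cov].
have Cin i : (i \in C) = (i \in labels v 1 l.+1) || (dia i \in labels v 1 l.+1).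
  rewrite cov mem_cat mem_rev; congr (_ || _).
  apply/mapP/idP => [[j jv ->]|jv]; first by rewrite ddK.
  by exists (dia i); rewrite // ddK.
have disj i : i \in labels v 1 l.+1 -> dia i \notin labels v 1 l.+1.
  move: us; rewrite cat_uniq => /and3P[_ /hasPn h _] iv.
  apply: (h (dia i)); rewrite mem_rev; exact: map_f.
have xbv i : i \in labels v 1 l.+1 -> xb i \in labels v 1 l.+1.
  by move=> iv; have /eqP -> := next_cycle cyc iv; rewrite mem_next.
have oppv i : dia i \in labels v 1 l.+1 -> dia (xb i) \in labels v 1 l.+1.
  move=> iv; have /eqP e := prev_cycle cyc iv.
  have -> : dia (xb i) = prev (labels v 1 l.+1) (dia i).
    by apply: (@perm_inj _ xb); rewrite xbdK e.
  by rewrite mem_prev.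
have lsE i : (i \in label_set v 1 l.+1) = (i \in labels v 1 l.+1) by rewrite inE.
apply: described => //.
- by move=> i; apply: (cover_dia P).
- by move=> i; apply: (cover_xb P).
- by move=> i; rewrite lsE Cin => ->.
- by move=> i; rewrite !lsE Cin => /orP.
- by move=> i; rewrite inE.
- by move=> i; rewrite !lsE => /disj/negbTE->.
- by move=> i; rewrite !setU0 lsE Cin => ->.
- by move=> i; rewrite !setU0 !lsE Cin => /orP[h|/oppv h]; [left | right].
- by move=> i; rewrite setU0 inE.
- by move=> i; rewrite !setU0 !lsE => /xbv/disj.
Qed.

Section OneCycle.
Variables (x : Q) (N : nat).
Hypotheses (uniqN : uniq (traject xb x N))
  (covN : C =i traject xb x N).

Lemma iter_inj_lt s t : (s < N)%N -> (t < N)%N -> iter s xb x = iter t xb x -> s = t.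
Proof.
move=> sN tN e; apply/eqP; rewrite -(nth_uniq x _ _ uniqN) ?size_traject //.
by rewrite !nth_traject // e.
Qed.

(** Encodes a set of vertices of a cycle by the positions it occupies, so that the conditions on the
    half quiver become arithmetic. *)
Definition at_positions (D : {set Q}) (p : nat -> bool) :=
  (forall i, i \in D -> i \in C) /\ forall t, (t < N)%N -> (iter t xb x \in D) = p t.

Lemma at_positions_labels (b q : nat) : (forall j : nat, (j < q)%N -> v (b + j)%N = iter j xb x) ->
  (q <= N)%N -> at_positions (label_set v b (b + q)) (fun t => t < q)%N.
Proof.
move=> vq qN; split=> [i|t tN].
  rewrite inE covN => /mapP[s]; rewrite mem_index_iota => /andP[bs sq] ->.
  rewrite -(subnKC bs) vq; last by lia.
  by apply/trajectP; exists (s - b)%N => //; lia.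
rewrite inE; apply/mapP/idP => [[s]|tq].
  rewrite mem_index_iota => /andP[bs sq]; rewrite -(subnKC bs) vq; last by lia.
  by move/iter_inj_lt => ->; lia.
by exists (b + t)%N; rewrite ?vq // mem_index_iota; lia.
Qed.

Lemma at_positions0 : at_positions set0 (fun=> false).
Proof. by split=> [i|t _]; rewrite inE. Qed.

Lemma at_positions1 t : (t < N)%N -> at_positions [set iter t xb x] (fun s => s == t).
Proof.
move=> tN; split=> [i|s sN]; rewrite inE.
  by move/eqP->; rewrite covN; apply/trajectP; exists t.
by apply/eqP/eqP => [/iter_inj_lt->|->].
Qed.

Lemma at_positions2 s t : (s < N)%N -> (t < N)%N ->
  at_positions [set iter s xb x; iter t xb x] (fun r => (r == s) || (r == t)).
Proof.
move=> sN tN; have [s1 s2] := at_positions1 sN; have [t1 t2] := at_positions1 tN.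
split=> [i|r rN]; last by rewrite in_setU s2 ?t2.
by rewrite in_setU => /orP[/s1|/t1].
Qed.

(** The functions [d] and [o] give the positions of the mirror of a vertex and of the opposite of an
    arrow, an arrow being placed at its source. Each hypothesis of [described] then becomes a
    statement about numbers below N. *)
Lemma described_one_cycle (dV dAut dHom dOut dIn : {set Q}) (pV pA pH pO pI : nat -> bool)
    (d o : nat -> nat) :
  at_positions dV pV -> at_positions dAut pA -> at_positions dHom pH ->
  at_positions dOut pO -> at_positions dIn pI ->
  (forall t, (t < N)%N -> (d t < N)%N /\ dia (iter t xb x) = iter (d t) xb x) ->
  (forall t, (t < N)%N -> (o t < N)%N /\ dia (xb (iter t xb x)) = iter (o t) xb x) ->
  (forall t, (t < N)%N ->
     [/\ pV t || pV (d t), pA t -> d t = t & pV t -> pV (d t) -> pA t]) ->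
  (forall t, (t < N)%N ->
     [/\ [|| pH t, pO t, pI t, pH (o t), pO (o t) | pI (o t)], pO t || pI t -> o t = t
       & pH t -> ~~ [|| pH (o t), pO (o t) | pI (o t)]]) ->
  pair_described P alpha dV dAut dHom dOut dIn.
Proof.
move=> [V1 V2] [A1 A2] [H1 H2] [O1 O2] [I1 I2] dP oP cV cE.
have pos i : i \in C -> exists2 t, (t < N)%N & i = iter t xb x.
  by rewrite covN => /trajectP.
apply: described => //.
- by move=> i; apply: (cover_dia P).
- by move=> i; apply: (cover_xb P).
- move=> i /pos[t tN ->]; have [dN ->] := dP t tN; have [h _ _] := cV t tN.
  by rewrite !V2 //; apply/orP.
- move=> i iA; have [t tN e] := pos i (A1 i iA); move: iA; rewrite e A2 // => h.
  by have [_ ->] := dP t tN; have [_ /(_ h) ->] := cV t tN.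
- move=> i iV; have [t tN e] := pos i (V1 i iV); move: iV; rewrite e.
  have [dN ->] := dP t tN; rewrite !V2 // A2 //; by have [] := cV t tN.
- by move=> i; rewrite !in_setU -orbA => /or3P[/H1|/O1|/I1].
- move=> i /pos[t tN ->]; have [oN ->] := oP t tN; have [h _ _] := cE t tN.
  by apply/orP; rewrite !in_setU !H2 // !O2 // !I2 // -!orbA.
- move=> i iE; have iC : i \in C by move: iE; rewrite in_setU => /orP[/O1|/I1].
  have [t tN e] := pos i iC; move: iE; rewrite e in_setU O2 // I2 // => h.
  by have [_ ->] := oP t tN; have [_ ->] := cE t tN.
move=> i iH; have [t tN e] := pos i (H1 i iH); move: iH; rewrite e H2 // => h.
  have [oN ->] := oP t tN; have [_ _ /(_ h)] := cE t tN.
  by rewrite !in_setU H2 // O2 // I2 // -orbA.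
Qed.
End OneCycle.

Lemma cycle_shape_traject y s : is_cycle_shape alpha (y :: s) ->
  [/\ y :: s = traject xb y (size s).+1, iter (size s).+1 xb y = y,
      uniq (traject xb y (size s).+1) & C =i traject xb y (size s).+1].
Proof. by move=> [us /fcycle_is_traject[e ec] cov]; rewrite -e. Qed.

Lemma labels_nth (b p j : nat) s y : (j < p)%N ->
  labels v b (b + p) ++ s = traject xb y (p + size s) -> v (b + j)%N = iter j xb y.
Proof.
move=> jp e; have := congr1 (nth y ^~ j) e.
rewrite nth_cat size_map size_iota addKn jp (nth_map 0%N) ?size_iota ?addKn //.
by rewrite nth_iota ?addKn // nth_traject // ltn_addr.
Qed.

Lemma size_dia_labels (b q : nat) : size (dia_labels v b (b + q)) = q.
Proof. by rewrite size_rev !size_map size_iota addKn. Qed.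

Lemma dia_cycle y N e : dia y = iter e xb y -> iter N xb y = y -> forall t, (t <= N + e)%N ->
  dia (iter t xb y) = iter (N + e - t) xb y.
Proof.
move=> dy cyc t tN; apply: (dia_iter P xi_unit xi_fixed).
by rewrite subnKC // addnC iterD cyc.
Qed.

Lemma dia_xb_cycle y N e : dia y = iter e xb y -> iter N xb y = y -> forall t, (t < N + e)%N ->
  dia (xb (iter t xb y)) = iter (N + e - t.+1) xb y.
Proof. by move=> dy cyc t tN; rewrite -iterS (dia_cycle dy cyc). Qed.

Lemma described_VE : is_VE alpha l v ->
  pair_described P alpha (label_set v 0 l.+1) [set v 0%N] (label_set v 0 l) [set v l] set0.
Proof.
move=> [sh d0]; have [e cyc uN cN] := cycle_shape_traject sh.
set N := (size _).+1 in e cyc uN cN.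
have NE : N = (l.+1 + l)%N.
  rewrite (_ : N = size (labels v 0 l.+1 ++ dia_labels v 1 l.+1)); last exact: erefl.
  by rewrite size_cat size_map size_iota (size_dia_labels 1); lia.
have vE (j : nat) : (j < l.+1)%N -> v (0 + j)%N = iter j xb (v 0%N).
  move=> jl; apply: (labels_nth (p := l.+1) (s := dia_labels v 1 l.+1)) => //.
  by rewrite (size_dia_labels 1) -NE -e.
have vl : v l = iter l xb (v 0%N) by rewrite -(vE l).
have dE := dia_cycle (e := 0) d0 cyc; have oE := dia_xb_cycle (e := 0) d0 cyc.
rewrite addn0 in dE oE.
(* Seen from the fixed vertex, the reflection sends vertex t to N - t modulo N and arrow t to N - 1
   - t. For N = 2 l + 1 the arrow l is the only fixed one. *)
rewrite vl; apply: (described_one_cycle cN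
  (pV := (fun t => t < l.+1)%N) (pA := fun t => t == 0%N) (pH := (fun t => t < l)%N)
  (pO := fun t => t == l) (pI := fun=> false)
  (d := fun t => if t == 0%N then 0%N else (N - t)%N) (o := fun t => (N - t.+1)%N)).
- by apply: (at_positions_labels uN cN (b := 0)) => //; lia.
- by apply: (at_positions1 uN cN (t := 0)).
- by apply: (at_positions_labels uN cN (b := 0)) => [j jl|]; [apply: vE | ]; lia.
- by apply: (at_positions1 uN cN); lia.
- exact: at_positions0.
- move=> t tN; case: eqP => [->|]; first by [].
  by move=> t0; rewrite dE; [split=> //; lia | lia].
- by move=> t tN; rewrite oE //; split=> //; lia.
- by move=> t tN /=; case: eqP => t0; split; lia.
by move=> t tN; split; lia.
Qed.

Lemma described_VV : is_VV alpha l v ->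
  pair_described P alpha (label_set v 0 l.+1) [set v 0%N; v l] (label_set v 0 l) set0 set0.
Proof.
move=> [l0 sh d0 _]; have [e cyc uN cN] := cycle_shape_traject sh.
set N := (size _).+1 in e cyc uN cN.
have sD : size (dia_labels v 1 l) = l.-1.
  by have := size_dia_labels 1 l.-1; rewrite add1n prednK.
have NE : N = (l.+1 + l.-1)%N.
  rewrite (_ : N = size (labels v 0 l.+1 ++ dia_labels v 1 l)); last exact: erefl.
  by rewrite size_cat size_map size_iota sD; lia.
have vE (j : nat) : (j < l.+1)%N -> v (0 + j)%N = iter j xb (v 0%N).
  move=> jl; apply: (labels_nth (p := l.+1) (s := dia_labels v 1 l)) => //.
  by rewrite sD -NE -e.
have vl : v l = iter l xb (v 0%N) by rewrite -(vE l).
have dE := dia_cycle (e := 0) d0 cyc; have oE := dia_xb_cycle (e := 0) d0 cyc.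
rewrite addn0 in dE oE.
(* The reflection is the one of the shape VE, now with N = 2 l: the vertices 0 and l are fixed, and
   no arrow is. *)
rewrite vl; apply: (described_one_cycle cN
  (pV := (fun t => t < l.+1)%N) (pA := fun t => (t == 0%N) || (t == l)) (pH := (fun t => t < l)%N)
  (pO := fun=> false) (pI := fun=> false)
  (d := fun t => if t == 0%N then 0%N else (N - t)%N) (o := fun t => (N - t.+1)%N)).
- by apply: (at_positions_labels uN cN (b := 0)) => //; lia.
- by apply: (at_positions2 uN cN (s := 0)) => //; lia.
- by apply: (at_positions_labels uN cN (b := 0)) => [j jl|]; [apply: vE | ]; lia.
- exact: at_positions0.
- exact: at_positions0.
- move=> t tN; case: eqP => [->|]; first by [].
  by move=> t0; rewrite dE; [split=> //; lia | lia].
- by move=> t tN; rewrite oE //; split=> //; lia.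
- by move=> t tN /=; case: eqP => t0; split; lia.
by move=> t tN; split; lia.
Qed.

Lemma described_EE : is_EE alpha l v ->
  pair_described P alpha (label_set v 1 l.+1) set0 (label_set v 1 l) [set v l] [set dia (v 1%N)].
Proof.
move=> [l0 sh].
have lE : labels v 1 l.+1 = v 1%N :: behead (labels v 1 l.+1) by case: (l) l0.
rewrite lE in sh; have [e cyc uN cN] := cycle_shape_traject sh.
set N := (size _).+1 in e cyc uN cN; rewrite -cat_cons -lE in e.
have NE : N = (l + l)%N.
  by rewrite /N size_cat size_behead size_map size_iota (size_dia_labels 1); lia.
have vE (j : nat) : (j < l)%N -> v (1 + j)%N = iter j xb (v 1%N).
  move=> jl; apply: (labels_nth (p := l) (s := dia_labels v 1 l.+1)) => //.
  by rewrite (size_dia_labels 1) -NE -e.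
have d1 : dia (v 1%N) = iter N.-1 xb (v 1%N).
  have := congr1 (last (v 1%N)) e; rewrite last_cat /dia_labels lE /= rev_cons last_rcons => ->.
  by rewrite /N /= last_traject.
have vl : v l = iter l.-1 xb (v 1%N) by rewrite -vE ?prednK // add1n prednK.
have dE (t : nat) : (t < N)%N -> dia (iter t xb (v 1%N)) = iter (N.-1 - t) xb (v 1%N).
  by move=> tN; apply: (dia_iter P xi_unit xi_fixed); rewrite subnKC // /N.
have oE (t : nat) : (t < N)%N -> dia (xb (iter t xb (v 1%N))) =
    iter (if t == N.-1 then N.-1 else N.-1 - t.+1)%N xb (v 1%N).
  move=> tN; case: eqP => te; first by rewrite te -iterS cyc.
  by rewrite -iterS dE //; lia.
(* Position 0 is the end point of a fixed arrow, so vertex t goes to N - 1 - t and arrow t to N - 2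
   - t, except that the arrow N - 1 closing the cycle is fixed. For N = 2 l the other fixed arrow
   starts at l - 1. *)
rewrite vl d1; apply: (described_one_cycle cN
  (pV := (fun t => t < l)%N) (pA := fun=> false) (pH := (fun t => t < l.-1)%N)
  (pO := fun t => t == l.-1) (pI := fun t => t == N.-1)
  (d := fun t => (N.-1 - t)%N) (o := (fun t => if t == N.-1 then N.-1 else N.-1 - t.+1)%N)).
- by apply: (at_positions_labels uN cN (b := 1)) => //; lia.
- exact: at_positions0.
- rewrite -[X in label_set v 1 X](prednK l0); apply: (at_positions_labels uN cN (b := 1)).
    by move=> j jl; apply: vE; lia.
  by lia.
- by apply: (at_positions1 uN cN); lia.
- by apply: (at_positions1 uN cN); lia.
- by move=> t tN; rewrite dE //; split=> //; lia.
- by move=> t tN; rewrite oE //; split=> //; case: eqP; lia.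
- by move=> t tN /=; split; lia.
by move=> t tN; case: (t =P N.-1) => te; split; lia.
Qed.

End ShapeDescriptions.

(** * Decomposition of H and g(xi) along the orbits *)

Section Decompositions.
Variables (k0 : fieldType) (k : fieldExtType k0) (sigk : {rmorphism k -> k}).
Variables (n m : nat) (beta : k) (F : cyclic_algebra sigk n).
Variables (V : polarized_space m beta F) (xi : F) (Q : quiver V xi).
Variable P : quiver_pairings Q.
Hypothesis xi_unit : xi \is a GRing.unit.
Hypothesis xi_fixed : sigma F xi = xi.
Local Notation S := (Smod (q0 := Q)).
Local Notation xb := (xibar Q).
Local Notation B := (vform (p := V)).
Implicit Types (i j : Q) (alpha : {set {set Q}}).

Let in_coverE := in_cover P xi_unit xi_fixed.
Let orbit_Pi := orbit_of_Pi P xi_unit xi_fixed.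

Section HPoints.
Variable R : comAlgType k0.
Local Notation EndV := 'M[R]_(\dim {:V}).

Lemma H_pointsP (g : EndV) :
  H_points g <-> [/\ exists h, is_inverse_mx g h, commA g & preserves B g].
Proof. by split=> [[[gi gF] gT gB]|[gi [gF gT] gB]]; split=> //; split. Qed.

Lemma H_points1 : H_points (1%:M : EndV).
Proof.
apply/H_pointsP; split; [|exact: commA1|by move=> u v; rewrite !mul1mx].
by exists 1%:M; split; rewrite mul1mx.
Qed.

Lemma H_pointsM (g h : EndV) : H_points g -> H_points h -> H_points (g *m h).
Proof.
move=> /H_pointsP[[g' [gg g'g]] gA gB] /H_pointsP[[h' [hh h'h]] hA hB].
apply/H_pointsP; split; [|exact: commA_mul|by move=> u v; rewrite -!mulmxA gB hB].
exists (h' *m g'); split; rewrite mulmxA.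
  by rewrite -(mulmxA g) hh mulmx1 gg.
by rewrite -(mulmxA h') g'g mulmx1 h'h.
Qed.

Lemma commA_comp_ext (g h : EndV) : commA g -> commA h ->
  (forall i, comp g i = comp h i) -> g = h.
Proof.
by move=> gA hA gh; apply: (tensf_ev_ext (Q := Q)) => i u; rewrite !compP // gh.
Qed.

Lemma comp_bigprod (fam : {set {set Q}} -> EndV) (r : seq {set {set Q}}) i : uniq r ->
  (forall alpha, alpha \in Pi_orbits Q -> H_alpha alpha (fam alpha)) ->
  comp (\big[mulmx/1%:M]_(alpha <- r | alpha \in Pi_orbits Q) fam alpha) i =
  if orbit_of i \in r then comp (fam (orbit_of i)) i else 1%:M.
Proof.
move=> ur famP; elim: r ur => [_|a r IH /= /andP[ar /IH{}IH]]; first by rewrite big_nil comp1.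
rewrite big_cons inE eq_sym; case: ifP => aP; last first.
  by rewrite IH; case: eqP => // e; rewrite e orbit_Pi in aP.
have HA : H_points (\big[mulmx/1%:M]_(alpha <- r | alpha \in Pi_orbits Q) fam alpha).
  apply: (big_ind (@H_points _ _ _ _ _ _ _ _ R)) => [|g h|b /famP[]//].
    exact: H_points1.
  exact: H_pointsM.
have [faH _] := famP a aP.
rewrite compM; [|exact: H_commA..]; rewrite IH.
case: eqP => [e|ne] /=; first by rewrite -e (negPf ar) mulmx1.
rewrite [comp (fam a) i](H_alpha_comp_off (famP a aP)) ?mul1mx //.
by rewrite in_coverE //; apply/eqP.
Qed.

Lemma H_alpha_commute (alpha alpha' : {set {set Q}}) (g h : EndV) :
  alpha \in Pi_orbits Q -> alpha' \in Pi_orbits Q -> alpha != alpha' ->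
  H_alpha alpha g -> H_alpha alpha' h -> g *m h = h *m g.
Proof.
move=> aP a'P ne gH hH; have gA := H_commA (proj1 gH); have hA := H_commA (proj1 hH).
apply: commA_comp_ext => [||i]; [exact: commA_mul..|].
rewrite !compM //; have [e|ne'] := eqVneq alpha (orbit_of i).
  rewrite (H_alpha_comp_off hH) ?mulmx1 ?mul1mx // in_coverE // -e eq_sym //.
by rewrite (H_alpha_comp_off gH) ?mulmx1 ?mul1mx // in_coverE.
Qed.

(** Truncating the components of h to the support of alpha keeps an isometry because this support is
    stable under [dia]; the inverse of h, truncated in the same way, provides the inverse. *)
Lemma H_restrict (h : EndV) alpha : alpha \in Pi_orbits Q -> H_points h ->
  exists2 g : EndV, H_alpha alpha g &
    forall i, i \in finset.cover alpha -> comp g i = comp h i.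
Proof.
move=> aP /H_pointsP[[h' hh] hA hB]; have h'A := commA_inv hh hA.
pose c (g : EndV) i := if i \in finset.cover alpha then comp g i else 1%:M.
have cD g : commA g -> forall i (d : D i), c g i *m tensf R (Dact d) = tensf R (Dact d) *m c g i.
  move=> gA i d; rewrite /c; case: ifP => _; first exact: comp_Dact.
  by rewrite mul1mx mulmx1.
have gP i := asmP (c := c h) (cD h hA i); have g'P i := asmP (c := c h') (cD h' h'A i).
set g := asm (c h) in gP; set g' := asm (c h') in g'P.
have gA := commA_of_vcomp gP.
have gc i : comp g i = c h i by apply: comp_unique.
exists g; last by move=> i iC; rewrite gc /c iC.
split; last by move=> i iC u; rewrite gP /c (negPf iC).
have cc i : is_inverse_mx (c h i) (c h' i).
  rewrite /c; case: ifP => _; first exact: comp_inv.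
  by split; rewrite mul1mx.
apply/H_pointsP; split=> //.
  exists g'; split; apply: (tensf_ev_ext (Q := Q)) => i u.
    by rewrite (vcomp_mul (gP i) (g'P i)) (cc i).1 mulmx1 mul1mx.
  by rewrite (vcomp_mul (g'P i) (gP i)) (cc i).2 mulmx1 mul1mx.
apply: (preserves_of_iso (P := P) gA) => i; left => w z.
rewrite !gc /c !in_coverE // (orbit_of_dia P).
by case: ifP => _; [apply: (preserves_isoM P) | rewrite !mul1mx].
Qed.

End HPoints.

Lemma H_product : H_is_product Q.
Proof.
move=> R; split.
- exact: H_alpha_commute.
- move=> fam famP; apply: (big_ind (@H_points _ _ _ _ _ _ _ _ R)) => [|g h|b /famP[]//].
    exact: H_points1.
  exact: H_pointsM.
move=> h hH.
have ex alpha : exists g, alpha \in Pi_orbits Q -> H_alpha alpha g /\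
    forall i, i \in finset.cover alpha -> comp g i = comp h i.
  have [/H_restrict/(_ hH)[g gH gc]|_] := boolP (alpha \in Pi_orbits Q); first by exists g.
  by exists 1%:M.
have [fam famP] := fin_all_exists ex.
have prodc (f : {set {set Q}} -> 'M[R]_(\dim {:V})) i :
    (forall alpha, alpha \in Pi_orbits Q -> H_alpha alpha (f alpha)) ->
    comp (\big[mulmx/1%:M]_(alpha in Pi_orbits Q) f alpha) i = comp (f (orbit_of i)) i.
  move=> fP; rewrite comp_bigprod ?mem_index_enum //; exact: index_enum_uniq.
have self i : i \in finset.cover (orbit_of i) by rewrite in_coverE.
have prodA (f : {set {set Q}} -> 'M[R]_(\dim {:V})) :
    (forall alpha, alpha \in Pi_orbits Q -> H_alpha alpha (f alpha)) ->
    commA (\big[mulmx/1%:M]_(alpha in Pi_orbits Q) f alpha).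
  move=> fP; apply: big_ind => [|g g'|b /fP[/H_commA]//]; [exact: commA1 | exact: commA_mul].
have famH alpha : alpha \in Pi_orbits Q -> H_alpha alpha (fam alpha) by move/famP=> [].
exists fam; split=> //.
  apply: commA_comp_ext => [||i]; [exact: H_commA | exact: prodA |].
  by rewrite prodc //; have [_ ->] := famP _ (orbit_Pi i).
move=> fam' fam'P hE alpha aP.
have f'H := fam'P _ aP; have fH := famH _ aP.
apply: commA_comp_ext => [||i]; [by case: f'H => /H_commA | by case: fH => /H_commA |].
have [iC|iC] := boolP (i \in finset.cover alpha); last first.
  by rewrite (H_alpha_comp_off f'H iC) (H_alpha_comp_off fH iC).
have [_ ->] := famP _ aP; last by [].
by move: iC; rewrite in_coverE // hE prodc // => /eqP->.
Qed.

(** The truncation remains antisymmetric because the support of alpha is stable under both [dia] and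
    [xb], which makes the mixed terms orthogonal. *)
Lemma g_restrict (phi : 'End(V)) alpha : alpha \in Pi_orbits Q -> phi \in g_xi V xi ->
  exists2 psi, psi \in g_alpha alpha & forall i (u : S i) x,
    i \in finset.cover alpha -> psi (ev u x) = phi (ev u x).
Proof.
move=> aP /g_xi_mem[pF pT pB]; have tw : twisted xi phi by [].
pose p i := if i \in finset.cover alpha then acomp phi i else 0.
have pD i : is_Dhom (p i).
  rewrite /p; case: ifP => _; first exact: acomp_Dhom.
  exact: is_Dhom0.
have qP i := asmAP (psi := p) (pD i); set q := asmA p in qP.
have [qF qT] := twisted_of_acomp qP.
have qin i (u : S i) x : i \in finset.cover alpha -> q (ev u x) = phi (ev u x).
  by move=> iC; rewrite qP /p iC -(acompP tw).
have qout i (u : S i) x : i \notin finset.cover alpha -> q (ev u x) = 0.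
  by move=> iC; rewrite qP /p (negPf iC) zero_lfunE linear0.
exists q; last exact: qin.
apply/g_alpha_mem; split; last first.
  by move=> i iC u x; rewrite qout // zero_lfunE linear0.
apply/g_xi_mem; split=> //; apply: (anti_ext (Q := Q)) => i j u v x y.
have orth i1 j1 (u1 : S i1) (v1 : S j1) x1 y1 : i1 \in finset.cover alpha ->
    j1 \notin finset.cover alpha -> B (ev u1 x1) (ev v1 y1) = 0.
  move=> iC jC; apply: (vform_orth P) => e; move: jC.
  by rewrite e in_coverE // (orbit_of_dia P) -in_coverE // iC.
have xbC i1 : (xb i1 \in finset.cover alpha) = (i1 \in finset.cover alpha).
  by rewrite !in_coverE // (orbit_of_xb P).
have [iC|iC] := boolP (i \in finset.cover alpha);
  have [jC|jC] := boolP (j \in finset.cover alpha).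
- by rewrite !qin.
- rewrite (qout j) // vform0r addr0 qP; apply: orth => //; by rewrite xbC.
- rewrite (qout i) // vform0l add0r qP vform_sym orth ?rmorph0 ?scaler0 //.
  by rewrite xbC.
by rewrite !qout // vform0l vform0r addr0.
Qed.

Lemma g_sum : g_xi_is_sum Q.
Proof.
have off alpha (phi : 'End(V)) i (u : S i) x : alpha \in Pi_orbits Q ->
    alpha != orbit_of i -> phi \in g_alpha alpha -> phi (ev u x) = 0.
  move=> aP ne /g_alpha_mem[_ pC]; rewrite pC ?in_coverE //.
  by rewrite zero_lfunE linear0.
have sumE (f : {set {set Q}} -> 'End(V)) i (u : S i) x :
    (forall alpha, alpha \in Pi_orbits Q -> f alpha \in g_alpha alpha) ->
    (\sum_(alpha in Pi_orbits Q) f alpha) (ev u x) = f (orbit_of i) (ev u x).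
  move=> fP; rewrite sum_lfunE (bigD1 (orbit_of i)) ?orbit_Pi //= big1 ?addr0 //.
  by move=> alpha /andP[aP ne]; exact: (off _ _ _ _ _ aP ne (fP _ aP)).
split.
  apply/eqP; rewrite eqEsubv; apply/andP; split; apply/subvP => phi.
    move=> pX.
    have ex alpha : exists psi : 'End(V), alpha \in Pi_orbits Q ->
        psi \in g_alpha alpha /\ forall i (u : S i) x,
          i \in finset.cover alpha -> psi (ev u x) = phi (ev u x).
      have [/g_restrict/(_ pX)[psi]|_] := boolP (alpha \in Pi_orbits Q); first by exists psi.
      by exists 0.
    have [f fP] := fin_all_exists ex.
    have -> : phi = \sum_(alpha in Pi_orbits Q) f alpha.
      apply: (ev_ext (Q := Q)) => i u x; rewrite sumE => [|alpha /fP[]//].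
      by have [_ ->] := fP _ (orbit_Pi i); rewrite // in_coverE.
    by apply: memv_sumr => alpha /fP[].
  by case/memv_sumP => f fP ->; apply: memv_suml => alpha /fP /g_alpha_mem[].
apply/directv_sum_independent => us usP us0 alpha aP.
apply: (ev_ext (Q := Q)) => i u x; rewrite zero_lfunE.
have [e|ne] := eqVneq alpha (orbit_of i); last by apply: off ne (usP _ aP).
by rewrite e -sumE // us0 zero_lfunE.
Qed.

End Decompositions.

Theorem theorem3p22 (k0 : fieldType) (k : fieldExtType k0)
    (sigk : {rmorphism k -> k}) (n m : nat) (beta : k) :
  (forall (F F' : cyclic_algebra sigk n)
          (V : polarized_space m beta F) (V' : polarized_space m beta F')
          (xi : F) (xi' : F'),
     in_Xi_sigma m xi -> in_Xi_sigma m xi' ->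
     Nm (pol_c V) = Nm (pol_c V') -> Nm xi = Nm xi' ->
     forall (Q : quiver V xi) (Q' : quiver V' xi'), quiver_isomorphic Q Q')
  /\
  (forall (F : cyclic_algebra sigk n) (V : polarized_space m beta F) (xi : F),
     in_Xi_sigma m xi ->
     forall (Q : quiver V xi) (P : quiver_pairings Q),
     [/\ H_is_product Q,
         g_xi_is_sum Q
       & forall alpha : {set {set Q}}, alpha \in Pi_orbits Q ->
         [/\ exists (l : nat) (v : nat -> Q),
               [\/ is_CC alpha l v, is_VV alpha l v,
                   is_VE alpha l v | is_EE alpha l v],
             forall (l : nat) (v : nat -> Q), is_CC alpha l v ->
               pair_described P alpha
                 (label_set v 1 l.+1) set0
                 (label_set v 1 l.+1) set0 set0,
             forall (l : nat) (v : nat -> Q), is_VV alpha l v ->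
               pair_described P alpha
                 (label_set v 0 l.+1) [set v 0%N; v l]
                 (label_set v 0 l) set0 set0,
             forall (l : nat) (v : nat -> Q), is_VE alpha l v ->
               pair_described P alpha
                 (label_set v 0 l.+1) [set v 0%N]
                 (label_set v 0 l) [set v l] set0
           & forall (l : nat) (v : nat -> Q), is_EE alpha l v ->
               pair_described P alpha
                 (label_set v 1 l.+1) set0
                 (label_set v 1 l) [set v l] [set dia (v 1%N)]]]).
Proof.
split=> [F F' V V' xi xi' _ _ cc xx Q Q'|F V xi [xi_unit _ xi_fixed] Q P].
  exact: quiver_iso_of_norms.
split=> [||alpha aP]; [exact: H_product | exact: g_sum | split].
- exact: shape_exists.
- by move=> l v; apply: described_CC.
- by move=> l v; apply: described_VV.
- by move=> l v; apply: described_VE.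
by move=> l v; apply: described_EE.
Qed.
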